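(* Let $n\ge1$ and $k\ge1$ be integers, let $0\le\alpha\le1$, let $A\subseteq\mathbb{R}^n$ (an arbitrary subset), and let $X$ be the set of all $a\in\mathbb{R}^n$ such that $A$ is approximately differentiable of order $(k,\alpha)$ at $a$. Then $X$ is a Borel subset of $\mathbb{R}^n$. Moreover, the map $a\mapsto \mathrm{ap\,Tan}(A,a)_\natural$ is a Borel map whose domain is a Borel subset of $\mathbb{R}^n$, and, for every integer $j\ge2$, $\mathrm{ap\,D}^jA$ is a Borel map whose domain is a Borel subset of $\mathbb{R}^n$.
   Context: Notation. $\mathscr{H}^m$ is the $m$ dimensional Hausdorff measure on $\mathbb{R}^n$, regarded as an outer measure on all subsets; $\boldsymbol{\alpha}(m)$ is the Lebesgue measure of the unit ball of $\mathbb{R}^m$; $\mathbf{B}(a,r)$ is the closed ball. $\mathbf{G}(n,m)$ is the set of $m$ dimensional linear subspaces of $\mathbb{R}^n$; for $T\in\mathbf{G}(n,m)$, $T_\natural$ is the orthogonal projection of $\mathbb{R}^n$ onto $T$ (a linear map $\mathbb{R}^n\to\mathbb{R}^n$), $T^\perp$ is the orthogonal complement and $T^\perp_\natural$ the orthogonal projection onto it. $\boldsymbol{\delta}_B(x)=\inf\{|x-b|:b\in B\}$. For $f:T\to T^\perp$, $\mathrm{gr}(f)=\{\chi+f(\chi):\chi\in T\}$. $\mathbf{C}(T,a,s,t)=\{x\in\mathbb{R}^n:|T_\natural(x-a)|<s,\ |T^\perp_\natural(x-a)|<t\}$. $\bigodot^j(\mathbb{R}^n,\mathbb{R}^n)$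 is the vector space of symmetric $j$ linear maps from $(\mathbb{R}^n)^j$ to $\mathbb{R}^n$. Approximate differentiability. Let $A\subseteq\mathbb{R}^n$, $a\in\mathbb{R}^n$, $A_1=\{x-a:x\in A\}$, $k\ge1$ an integer, $0\le\alpha\le1$. $A$ is approximately differentiable of order $(k,\alpha)$ at $a$ if there exist an integer $1\le m\le n$, $T\in\mathbf{G}(n,m)$ and a polynomial function $P:T\to T^\perp$ of degree at most $k$ with $P(0)=0$, $\mathrm{D}P(0)=0$ such that: (1) for every $\epsilon>0$ there exist $\rho>0$ and $\eta>0$ such that $\mathscr{H}^m(\mathbf{C}(T,z,\epsilon r,\epsilon r)\cap A_1)\ge\eta r^m$ for every $0\le r\le\rho$ and every $z\in T\cap\mathbf{B}(0,r)$; (2) for every $\epsilon>0$, $\lim_{r\to0+}\frac{\mathscr{H}^m(A_1\cap\mathbf{B}(0,r)\cap\{z:\boldsymbol{\delta}_{\mathrm{gr}(P)}(z)>\epsilon r^k\})}{\boldsymbol{\alpha}(m)r^m}=0$, and, if $\alpha>0$, there exists $0\le\lambda<\infty$ such that $\lim_{r\to0+}\frac{\mathscr{H}^m(A_1\cap\mathbf{B}(0,r)\cap\{z:\boldsymbol{\delta}_{\mathrm{gr}(P)}(z)>\lambda r^{k+\alpha}\})}{\boldsymbol{\alpha}(m)r^m}=0$. ''Order $k$'' means order $(k,0)$. The objects $m$, $T$ (determined by $A$, $a$) and $P$ (determined by $A$, $a$, $k$) are unique. If $A$ is approximately differentiable of order $1$ at $a$, then $\mathrm{ap\,Tan}(A,a)$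 is the unique linear subspace $T$ of $\mathbb{R}^n$, of dimension $m$ with $1\le m\le n$, such that conditions (1) and (2) hold with $k=1$, $\alpha=0$ and $P=0$; so the domain of $a\mapsto\mathrm{ap\,Tan}(A,a)_\natural$ is the set of $a$ at which $A$ is approximately differentiable of order $1$. If $j\ge2$ and $A$ is approximately differentiable of order $j$ at $a$, then $\mathrm{ap\,D}^jA(a)=\mathrm{D}^j(P\circ T_\natural)(0)\in\bigodot^j(\mathbb{R}^n,\mathbb{R}^n)$, where $T=\mathrm{ap\,Tan}(A,a)$ and $P:T\to T^\perp$ is the unique polynomial function of degree at most $j$ with $P(0)=0$, $\mathrm{D}P(0)=0$ such that conditions (1) and (2) hold with $m=\dim T$, $k=j$ and $\alpha=0$; the domain of $\mathrm{ap\,D}^jA$ is the set of $a\in\mathbb{R}^n$ at which $A$ is approximately differentiable of order $j$. A map is Borel if preimages of open sets are Borel sets. *)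

(* Defs.v *)
From HB Require Import structures.
From mathcomp Require Import all_boot all_order all_algebra all_fingroup.
From mathcomp Require Import all_classical all_reals all_analysis.
Set Implicit Arguments.
Unset Strict Implicit.
Unset Printing Implicit Defensive.
Import Order.TTheory GRing.Theory Num.Theory.
Import numFieldNormedType.Exports.
Local Open Scope classical_set_scope.
Local Open Scope ring_scope.

(* The library norm on 'rV[R]_n is the sup norm: its topology is the usual one,
   so [open] and [<<s open>>] are used as they are, but balls, distances and
   diameters below are taken with respect to the Euclidean norm [enorm]. *)
Section Euclidean.
Context {R : realType} {n : nat}.
Implicit Types (u v x : 'rV[R]_n) (B : set 'rV[R]_n) (T : {vspace 'rV[R]_n}).

Definition dotr u v : R := \sum_(i < n) u 0 i * v 0 i.

Fact dotr_linear_l v : scalar (dotr^~ v).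
Proof.
move=> a x y; rewrite /dotr mulr_sumr -big_split; apply: eq_bigr => i _ /=.
by rewrite !mxE mulrDl mulrA.
Qed.

Fact dotr_linear_r u : scalar (dotr u).
Proof.
move=> a x y; rewrite /dotr mulr_sumr -big_split; apply: eq_bigr => i _ /=.
by rewrite !mxE mulrDr mulrCA.
Qed.

HB.instance Definition _ := @bilinear_isBilinear.Build R _ _ R *%R *%R dotr
  (dotr_linear_l, dotr_linear_r).

Fact dotrC u v : dotr u v = (-1) ^+ false * idfun (dotr v u).
Proof.
by rewrite expr0 mul1r; apply: eq_bigr => i _; rewrite mulrC.
Qed.

HB.instance Definition _ :=
  @isHermitianSesquilinear.Build R 'rV[R]_n false idfun dotr dotrC.

Definition enorm x : R := Num.sqrt (dotr x x).

Definition ecball x (r : R) : set 'rV[R]_n := [set y | enorm (y - x) <= r].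

Definition eucl_dist B x : R := inf [set enorm (x - b) | b in B].

Definition ediam B : \bar R :=
  ereal_sup [set (enorm (x.1 - x.2))%:E | x in B `*` B].

Definition orthc T : {vspace 'rV[R]_n} :=
  orthov (dotr : {hermitian 'rV[R]_n for false & idfun}) T.

Definition orthproj T : 'End('rV[R]_n) := daddv_pi T (orthc T).

Definition grassmannian (m : nat) : set {vspace 'rV[R]_n} :=
  [set T | \dim T = m].

Definition cylinder T x (s t : R) : set 'rV[R]_n :=
  [set y | enorm (orthproj T (y - x)) < s /\
           enorm (orthproj (orthc T) (y - x)) < t].

End Euclidean.

Section HausdorffMeasure.
Context {R : realType}.
Local Open Scope ereal_scope.

Definition cbox (m : nat) (a b : 'rV[R]_m) : set 'rV[R]_m :=
  [set x | forall i, (a 0 i <= x 0 i <= b 0 i)%R].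

(* The predicate [P] lets finite families of boxes count as countable covers. *)
Definition lebesgue_outer (m : nat) (A : set 'rV[R]_m) : \bar R :=
  ereal_inf [set s | exists (P : pred nat) (a b : nat -> 'rV[R]_m),
    [/\ forall k i, (a k 0 i <= b k 0 i)%R,
        A `<=` \bigcup_(k in [set k | P k]) cbox (a k) (b k) &
        s = \sum_(0 <= k <oo | P k) (\prod_(i < m) (b k 0 i - a k 0 i))%:E]].

Definition unit_ball_vol (m : nat) : \bar R :=
  lebesgue_outer (ecball (0 : 'rV[R]_m) 1).

(* Empty sets are left out of the sum: their [ediam] is -oo. *)
Definition hausdorff_pre (n m : nat) (d : R) (A : set 'rV[R]_n) : \bar R :=
  ereal_inf [set s | exists S : nat -> set 'rV[R]_n,
    [/\ forall i, ediam (S i) <= d%:E,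
        A `<=` \bigcup_i S i &
        s = \sum_(0 <= i <oo | S i != set0)
              unit_ball_vol m * (2 ^- m)%:E * ediam (S i) ^+ m]].

Definition hausdorff (n m : nat) (A : set 'rV[R]_n) : \bar R :=
  ereal_sup [set hausdorff_pre m d A | d in [set d : R | (0 < d)%R]].

End HausdorffMeasure.

Section Multilinear.
Context {K : pzRingType} {U V : lmodType K}.

Definition multilinear (j : nat) (f : ('I_j -> U) -> V) : Prop :=
  forall (i : 'I_j) (v : 'I_j -> U),
    linear (fun u : U => f (fun l => if l == i then u else v l)).

Definition symmultilinear (j : nat) : set (('I_j -> U) -> V) :=
  [set f | multilinear f /\ forall (s : 'S_j) v, f (v \o s) = f v].

Definition poly_fun (k : nat) (P : U -> V) : Prop :=
  exists phi : forall i : nat, ('I_i -> U) -> V,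
    (forall i, (i <= k)%N -> symmultilinear (phi i)) /\
    forall x, P x = \sum_(i < k.+1) phi i (fun=> x).

End Multilinear.
Arguments symmultilinear {K} U V j.

Section Differential.
Context {R : realType} {n : nat}.
Local Notation E := 'rV[R]_n.

(* [D^j f x (v_1, ..., v_j)]: the derivative at [x], in the direction [v_1], of
   the map [y |-> D^(j-1) f y (v_2, ..., v_j)]. *)
Fixpoint iter_diff (f : E -> E) (s : seq E) : E -> E :=
  if s is v :: s' then fun x => 'd (iter_diff f s') x v else f.

Definition Dn (j : nat) (f : E -> E) (x : E) : ('I_j -> E) -> E :=
  fun v => iter_diff f [seq v i | i <- enum 'I_j] x.

(* Open subsets of the space of symmetric multilinear maps, for the norm
   [sup {|f (v_1, ..., v_j)| : |v_i| <= 1}]. *)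
Definition symmultilinear_open (j : nat) : set (set (('I_j -> E) -> E)) :=
  [set O | O `<=` symmultilinear E E j /\
    forall f, O f -> exists2 e : R, 0 < e &
      forall g, symmultilinear E E j g ->
        (forall v, (forall i, enorm (v i) <= 1) -> enorm (g v - f v) <= e) ->
        O g].

End Differential.

Section ApproximateDifferentiability.
Context {R : realType} {n : nat}.
Local Notation E := 'rV[R]_n.
Implicit Types (A : set E) (a : E) (T : {vspace E}) (k j m : nat) (al : R).

Definition graph T (P : subvs_of T -> subvs_of (orthc T)) : set E :=
  [set vsval x + vsval (P x) | x in [set: subvs_of T]].

(* [subvs_of T] carries no topology: that the Frechet derivative of [P] at the
   origin is zero is spelled out with the Euclidean norm. *)
Definition diff0_eq0 T (P : subvs_of T -> subvs_of (orthc T)) : Prop :=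
  forall e : R, 0 < e -> exists2 d : R, 0 < d &
    forall x : subvs_of T, enorm (vsval x) <= d ->
      enorm (vsval (P x - P 0)) <= e * enorm (vsval x).

Definition translate A a : set E := [set x - a | x in A].

Definition ap_density (A1 : set E) m T : Prop :=
  forall e : R, 0 < e -> exists rho eta : R, [/\ 0 < rho, 0 < eta &
    forall (r : R) (z : E), 0 <= r <= rho -> z \in T -> ecball 0 r z ->
      ((eta * r ^+ m)%:E <= hausdorff m (cylinder T z (e * r) (e * r) `&` A1))%E].

(* [s r] is the tolerance at scale [r]. *)
Definition ap_negligible (A1 G : set E) m (s : R -> R) : Prop :=
  (fun r : R =>
     let far := A1 `&` ecball 0 r `&` [set z | s r < eucl_dist G z] in
     (hausdorff m far / (unit_ball_vol m * (r ^+ m)%:E))%E) @ 0^'+ --> 0%E.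

Definition ap_close (A1 G : set E) m k al : Prop :=
  (forall e : R, 0 < e -> ap_negligible A1 G m (fun r => e * r ^+ k)) /\
  (0 < al -> exists2 lam : R, 0 <= lam &
     ap_negligible A1 G m (fun r => lam * r `^ (k%:R + al))).

Definition ap_jet A a m T k al (P : subvs_of T -> subvs_of (orthc T)) : Prop :=
  [/\ [/\ poly_fun k P, P 0 = 0 & diff0_eq0 P],
      ap_density (translate A a) m T &
      ap_close (translate A a) (graph P) m k al].

Definition ap_diff A k al a : Prop :=
  exists m T (P : subvs_of T -> subvs_of (orthc T)),
    [/\ (1 <= m <= n)%N, grassmannian m T & ap_jet A a m k al P].

Definition ap_tan A a : {vspace E} :=
  xget 0%VS [set T | exists m, [/\ (1 <= m <= n)%N, grassmannian m T,
    ap_density (translate A a) m T &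
    ap_close (translate A a) (graph (fun _ : subvs_of T => 0)) m 1 0]].

(* Matrix of the projection, acting on row vectors by right multiplication. *)
Definition ap_tan_proj A a : 'M[R]_n := lin1_mx (orthproj (ap_tan A a)).

Definition ap_poly A j a :
    subvs_of (ap_tan A a) -> subvs_of (orthc (ap_tan A a)) :=
  xget (fun=> 0) [set P | ap_jet A a (\dim (ap_tan A a)) j 0 P].
Definition ap_D A j a : ('I_j -> E) -> E :=
  let T := ap_tan A a in
  Dn (fun x => vsval (@ap_poly A j a (vsproj T (orthproj T x)))) 0.

Definition borel : set (set E) := <<s (@open E) >>.

(* A Borel map from [D] to a space with points [Y] and open sets [Yopen]. *)
Definition borel_map (S : Type) (Y : set S) (Yopen : set (set S))
    (D : set E) (f : E -> S) : Prop :=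
  (forall a, D a -> Y (f a)) /\
  forall O, Yopen O -> borel (D `&` f @^-1` O).

End ApproximateDifferentiability.
Arguments symmultilinear_open {R n} j.
Arguments ap_poly {R n} A j a.
Arguments ap_D {R n} A j a.

(* Main.v *)
(* A plane [T] together with a polynomial [P : T -> T^perp] is encoded by one
   finite vector [c], the coefficients of the vertical defect
   [z |-> T^perp z - P (T z)], whose zero set is the graph of [P]; distance to
   the graph and size of the defect are comparable.  For a fixed scale range,
   density and closeness are stable under small perturbations of the point and
   of [c] up to constant factors, and such factors are harmless in the
   definition; so the set of points that admit, for each precision, some [c]
   from a closed set lies within constants of a countable combination of closed
   sets.  Two vectors admissible at the same point are close to each other,
   because near every point of the tangent plane [A] has points at which both
   defects are small, and this forces the coefficients of their difference to be
   small; hence the vectors obtained for increasing precision converge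
   and one single [c] works.  This makes the set of points having a [c] in a
   prescribed open set Borel.  As [c] is unique, open conditions on the tangent
   plane or on the top-degree coefficients are of this form. *)

Require Import Defs.
From HB Require Import structures.
From mathcomp Require Import all_boot all_order all_algebra all_fingroup.
From mathcomp Require Import all_classical all_reals all_analysis.
From mathcomp Require Import ring lra zify.
Import Order.TTheory GRing.Theory Num.Theory.
Import numFieldNormedType.Exports.
Local Open Scope classical_set_scope.
Local Open Scope ring_scope.

Set Implicit Arguments.
Unset Strict Implicit.
Unset Printing Implicit Defensive.

(** * Hausdorff measure *)

Section Hausdorff.
Context {R : realType}.
Local Open Scope ereal_scope.

(** As [A] is arbitrary, its Hausdorff measure gives only an outer measure. The estimates rest on
    monotonicity, translation invariance and finite subadditivity. Moving the base point translates
    [A], so it is paid for by larger balls and tolerances; this is where the constants lost in a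
    closure come from.

    Compactness requires bounded coefficients, but no bound is known in advance, so the bound is a
    countable union taken innermost. The density constants must instead be fixed before the
    precision: two parameters can be compared only when the density at one fixed relative radius
    exceeds the measure of both exceptional sets.

    The comparison bounds a coefficient difference of degree d, times r^d, by K s r^b. For b = k it
    makes the degrees below k agree and leaves an error K s in degree k, so a limit s -> 0 is taken.
    For b = k + alpha > k all coefficients agree already for one fixed s, so a single lambda
    suffices.

    Uniqueness of the dimension uses that the volume of the unit ball is positive. This is read off
    from the density condition: if the volume were 0, the Hausdorff measure would vanish
    identically. *)

Lemma enorm_ge0 n (x : 'rV[R]_n) : (0 <= enorm x)%R.
Proof. exact: sqrtr_ge0. Qed.

Lemma le_norm_enorm n (x : 'rV[R]_n) : (`|x| <= enorm x)%R.
Proof.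
rewrite [leLHS]/Num.norm /= mx_normrE; apply/bigmax_leP; split; first exact: enorm_ge0.
move=> [i j] _ /=; rewrite ord1 -sqrtr_sqr ler_sqrt; last first.
  by apply: sumr_ge0 => l _; rewrite -expr2 sqr_ge0.
rewrite /dotr (bigD1 j) //= -expr2 lerDl.
by apply: sumr_ge0 => l _; rewrite -expr2 sqr_ge0.
Qed.

Lemma le_coord_norm m n (x : 'M[R]_(m, n)) i j : (`|x i j| <= `|x|)%R.
Proof.
by rewrite [leRHS]/Num.norm /= mx_normrE; apply: (le_bigmax_cond _ (fun p => `|x p.1 p.2|%R) (j := (i, j))).
Qed.

Lemma enorm_le_norm n (x : 'rV[R]_n) : (enorm x <= n%:R * `|x|)%R.
Proof.
rewrite -(ler_sqr (enorm_ge0 _)) ?nnegrE ?mulr_ge0 //; last first.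
rewrite sqr_sqrtr; last by apply: sumr_ge0 => l _; rewrite -expr2 sqr_ge0.
apply: (@le_trans _ _ (\sum_(i < n) `|x| ^+ 2)%R).
  apply: ler_sum => i _; rewrite -expr2 -real_normK ?num_real //.
  by rewrite lerXn2r ?nnegrE //; exact: le_coord_norm.
rewrite sumr_const card_ord -[leLHS]mulr_natl exprMn ler_wpM2r ?sqr_ge0 //.
by rewrite -natrX expnS expn1 ler_nat; case: n {x} => // n; rewrite leq_pmulr.
Qed.

Lemma lebesgue_outer_ge0 m (A : set 'rV[R]_m) : 0 <= lebesgue_outer A.
Proof.
apply: le_ereal_inf_tmp => _ [P [a [b [ab _ ->]]]].
apply: nneseries_ge0 => k _ _; rewrite lee_fin; apply: prodr_ge0 => i _.
by rewrite subr_ge0.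
Qed.

Lemma unit_ball_vol_ge0 m : 0 <= unit_ball_vol m :> \bar R.
Proof. exact: lebesgue_outer_ge0. Qed.

(** The cube of all points with coordinates in [-1, 1] covers the ball; [pred1 0%N] makes it a cover
    by one box. *)
Lemma unit_ball_vol_fin m : unit_ball_vol m \is a @fin_num R.
Proof.
rewrite ge0_fin_numE ?unit_ball_vol_ge0 //.
apply: (@le_lt_trans _ _ (\sum_(0 <= k <oo | pred1 0%N k) (\prod_(i < m) (1 - (-1)))%:E)).
  apply: ereal_inf_lbound; exists (pred1 0%N), (fun=> const_mx (-1)%R), (fun=> const_mx 1%R).
  split=> [k i| x /= xB|].
  - by rewrite !mxE (le_trans (lerN10 R)).
  - exists 0%N => // i; rewrite !mxE -ler_norml.
    by apply: le_trans (le_coord_norm _ _ _) (le_trans (le_norm_enorm _) _); rewrite /ecball /= subr0 in xB.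
  - by apply: eq_eseriesr => i _; congr (_%:E); apply: eq_bigr => j _; rewrite !mxE.
rewrite (_ : (fun n => _) = (fun n => if n is k.+1 then (\prod_(i < m) (1 - (-1)))%:E else 0)); last first.
  apply/funext; case=> [|k]; first by rewrite big_geq.
  by rewrite big_mkcond big_nat_recl //= big1_eq adde0.
rewrite (_ : lim _ = (\prod_(i < m) (1 - (-1)))%:E) ?ltry //.
by apply/cvg_lim => //; rewrite -cvg_shiftS /=; exact: cvg_cst.
Qed.

Section fixed.
Variables n m : nat.
Implicit Types S A B : set 'rV[R]_n.

Definition hterm S : \bar R := unit_ball_vol m * (2 ^- m)%:E * ediam S ^+ m.

Lemma ediam_ge0 S : S !=set0 -> 0 <= ediam S.
Proof.
move=> [x Sx]; apply: ereal_sup_ubound; exists (x, x) => //=.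
rewrite subrr /enorm /dotr big1 ?sqrtr0 // => i _.
by rewrite mxE mul0r.
Qed.

Lemma hterm_ge0 S : S != set0 -> 0 <= hterm S.
Proof.
move=> /set0P S0; rewrite /hterm mule_ge0 // ?expe_ge0 ?ediam_ge0 //.
by rewrite mule_ge0 ?unit_ball_vol_ge0 // lee_fin invr_ge0 exprn_ge0.
Qed.

Lemma hausdorff_pre_ge0 d A : 0 <= hausdorff_pre m d A.
Proof.
apply: le_ereal_inf_tmp => _ [S [_ _ ->]].
by apply: nneseries_ge0 => i _ Si; exact: hterm_ge0.
Qed.

Lemma hausdorff_ge0 A : 0 <= hausdorff m A.
Proof.
apply: le_trans (hausdorff_pre_ge0 1 A) _.
by apply: ereal_sup_ubound; exists 1%R => //=.
Qed.

Lemma le_hausdorff A B : A `<=` B -> hausdorff m A <= hausdorff m B.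
Proof.
move=> AB; apply: ge_ereal_sup => _ [d d0 <-].
apply: (@le_trans _ _ (hausdorff_pre m d B)); last by apply: ereal_sup_ubound; exists d.
apply: le_ereal_inf => _ [S [dS BS ->]]; exists S; split=> //.
exact: subset_trans BS.
Qed.

Lemma ediam_translate S a : ediam (translate S a) = ediam S.
Proof.
rewrite /ediam; congr ereal_sup; apply/seteqP; split => [_ [[_ _] [/= [x Sx <-] [y Sy <-]] <-]|].
  by exists (x, y) => //=; do 2 f_equal; rewrite opprB addrA subrK.
move=> _ [[x y] [/= Sx Sy] <-]; exists (x - a, y - a)%R => /=.
  by split; [exists x|exists y].
by do 2 f_equal; rewrite opprB addrA subrK.
Qed.

Lemma translate_eq0 S a : (translate S a != set0) = (S != set0).
Proof.
apply/idP/idP => /set0P; first by move=> [_ [x Sx _]]; apply/set0P; exists x.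
by move=> [x Sx]; apply/set0P; exists (x - a)%R; exists x.
Qed.

Lemma hausdorff_translate_le A a : hausdorff m (translate A a) <= hausdorff m A.
Proof.
apply: ge_ereal_sup => _ [d d0 <-].
apply: (@le_trans _ _ (hausdorff_pre m d A)); last by apply: ereal_sup_ubound; exists d.
apply: le_ereal_inf => _ [S [dS AS ->]]; exists (fun i => translate (S i) a); split.
- by move=> i; rewrite ediam_translate.
- by move=> _ [x /AS [i _ Six] <-]; exists i => //; exists x.
- congr (limn _); apply/funext => k.
  rewrite [RHS](eq_bigl (fun i => S i != set0)); last by move=> i; rewrite translate_eq0.
  by apply: eq_bigr => i _; rewrite ediam_translate.
Qed.

(** All dependence on the base point goes through this comparison: changing [a] to [a'] only shifts
    the test set. *)
Lemma le_hausdorff_translate A S S' a a' :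
  (forall y, S y -> S' (y + (a - a'))%R) ->
  hausdorff m (translate A a `&` S) <= hausdorff m (translate A a' `&` S').
Proof.
move=> SS'; apply: le_trans (hausdorff_translate_le _ (a - a')%R).
apply: le_hausdorff => _ [[x Ax <-] /SS' S'x].
exists (x - a')%R; last by rewrite opprB addrA subrK.
by split; [exists x|move: S'x; rewrite addrA subrK].
Qed.

Lemma hausdorff_pre_adherent d A e : hausdorff_pre m d A < +oo -> (0 < e)%R ->
  exists S : nat -> set 'rV[R]_n, [/\ forall i, ediam (S i) <= d%:E,
    A `<=` \bigcup_i S i &
    \sum_(0 <= i <oo | S i != set0) hterm (S i) < hausdorff_pre m d A + e%:E].
Proof.
move=> Afin e0.
have Afin' : hausdorff_pre m d A \is a fin_num.
  by rewrite ge0_fin_numE // hausdorff_pre_ge0.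
have [_ [S [dS AS ->]] ltS] := lb_ereal_inf_adherent e0 Afin'.
by exists S.
Qed.

(** Near-optimal covers, each with error [e / 2], are interleaved. Infinite values are split off
    first, because a near-optimal cover is chosen at a finite infimum. *)
Lemma hausdorff_preU d A B :
  hausdorff_pre m d (A `|` B) <= hausdorff_pre m d A + hausdorff_pre m d B.
Proof.
case: (leP +oo (hausdorff_pre m d A)) => [|Afin].
  rewrite leye_eq => /eqP ->; rewrite addye ?leey //.
  by rewrite -ltNye (lt_le_trans _ (hausdorff_pre_ge0 _ _)).
case: (leP +oo (hausdorff_pre m d B)) => [|Bfin].
  rewrite leye_eq => /eqP ->; rewrite addey ?leey //.
  by rewrite -ltNye (lt_le_trans _ (hausdorff_pre_ge0 _ _)).
apply/lee_addgt0Pr => e e0; have e20 : (0 < e / 2)%R by rewrite divr_gt0.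
have [S [dS AS ltS]] := hausdorff_pre_adherent Afin e20.
have [T [dT BT ltT]] := hausdorff_pre_adherent Bfin e20.
rewrite [e]splitr EFinD addeACA.
apply: le_trans (leeD (ltW ltS) (ltW ltT)).
pose U i := if odd i then T i./2 else S i./2.
apply: (@le_trans _ _ (\sum_(0 <= i <oo | U i != set0) hterm (U i))).
  apply: ereal_inf_lbound; exists U; split=> // [i|x]; first by rewrite /U; case: odd.
  case=> [/AS|/BT] [i _ ix].
    by exists i.*2 => //; rewrite /U odd_double doubleK.
  by exists i.*2.+1 => //; rewrite /U /= odd_double /= uphalf_double.
(* Partial sums of even length split exactly; a sum of length [k] is at most the one of length
   [k.*2]. *)
have UST k : (\sum_(0 <= i < k.*2 | U i != set0) hterm (U i) =
    \sum_(0 <= i < k | S i != set0) hterm (S i) +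
    \sum_(0 <= i < k | T i != set0) hterm (T i))%R.
  rewrite !(big_mkcond (fun i => _ i != set0)) /=.
  elim: k => [|k IH]; first by rewrite !big_geq // adde0.
  rewrite doubleS !big_nat_recr //= IH /U /= odd_double /= uphalf_double doubleK.
  by rewrite -addeA addeACA.
apply: lime_le; first by apply: is_cvg_nneseries => i _ Ui; exact: hterm_ge0.
near=> k.
apply: (@le_trans _ _ (\sum_(0 <= i < k.*2 | U i != set0) hterm (U i))).
  rewrite [leRHS](big_cat_nat (n := k)) //= -?addnn ?leq_addr //.
  by rewrite leeDl // sume_ge0 // => i Ui; exact: hterm_ge0.
apply: (@le_trans _ _ (\sum_(0 <= i < k | S i != set0) hterm (S i) + \sum_(0 <= i < k | T i != set0) hterm (T i))).
  by rewrite UST.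
apply: leeD; apply: nneseries_lim_ge => i _ Si; exact: hterm_ge0.
Unshelve. all: by end_near.
Qed.

Lemma hausdorffU A B : hausdorff m (A `|` B) <= hausdorff m A + hausdorff m B.
Proof.
apply: ge_ereal_sup => _ [d d0 <-]; apply: le_trans (hausdorff_preU _ _ _) _.
by apply: leeD; apply: ereal_sup_ubound; exists d.
Qed.

End fixed.

(** For pieces of diameter at most d', the power m2 of the diameter is at most d'^(m2 - m1) times
    the power m1, and the mesh d' can be shrunk. The positive volume in dimension [m1] lets the
    terms of one measure be expressed through those of the other. *)
Lemma hausdorff_lt_eq0 n (m1 m2 : nat) (A : set 'rV[R]_n) :
  0 < unit_ball_vol m1 :> \bar R -> (m1 < m2)%N -> hausdorff m1 A < +oo ->
  hausdorff m2 A = 0.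
Proof.
have := unit_ball_vol_fin m1; have := unit_ball_vol_fin m2.
have := unit_ball_vol_ge0 m2.
case E2 : (unit_ball_vol m2) => [c2| |] //; case E1 : (unit_ball_vol m1) => [c1| |] //.
rewrite !lee_fin !lte_fin => c20 _ _ c10 m12 Afin.
apply/eqP; rewrite eq_le hausdorff_ge0 andbT.
have : 0 <= hausdorff m1 A by exact: hausdorff_ge0.
case EA : (hausdorff m1 A) Afin => [h| |] //; rewrite lee_fin => _ h0.
apply: ge_ereal_sup => _ [d /= d0 <-].
apply/lee_addgt0Pr => e e0; rewrite add0e.
pose K := (c2 * 2 ^- m2 / (c1 * 2 ^- m1))%R.
have c1' : (0 < c1 * 2 ^- m1)%R by rewrite mulr_gt0 // invr_gt0 exprn_gt0.
have K0 : (0 <= K)%R.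
  by rewrite divr_ge0 ?(ltW c1') // mulr_ge0 // invr_ge0 exprn_ge0.
(* The entry [d] keeps the cover admissible, 1 bounds the surplus power of the diameter by [d'], and
   the last entry brings the total below [e]. *)
pose d' := Num.min d (Num.min 1 (e / (K * (h + 1) + 1)))%R.
have Kh : (0 < K * (h + 1) + 1)%R by rewrite ltr_wpDl // mulr_ge0 // addr_ge0.
have d'0 : (0 < d')%R by rewrite !lt_min d0 ltr01 divr_gt0.
have pre_le : hausdorff_pre m1 d' A <= h%:E.
  by rewrite -EA; apply: ereal_sup_ubound; exists d'.
have [S [dS AS ltS]] := hausdorff_pre_adherent (le_lt_trans pre_le (ltry _)) (@ltr01 R).
apply: (@le_trans _ _ (\sum_(0 <= i <oo | S i != set0) hterm m2 (S i))).
  apply: ereal_inf_lbound; exists S; split=> // i.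
  by apply: le_trans (dS i) _; rewrite lee_fin /d' ge_min lexx.
apply: (@le_trans _ _ (\sum_(0 <= i <oo | S i != set0) (K * d')%:E * hterm m1 (S i))).
  apply: lee_nneseries => i; first by move=> _; exact: hterm_ge0.
  move=> /set0P/ediam_ge0; rewrite /hterm E1 E2; move: (dS i).
  case: (ediam _) => [x| |] //; rewrite !lee_fin => xd x0.
  rewrite -!EFin_expe -!EFinM lee_fin.
  have -> : (K * d' * (c1 / 2 ^+ m1 * x ^+ m1) = c2 / 2 ^+ m2 * (x ^+ m1 * d'))%R.
    by rewrite /K; field; rewrite !gt_eqF ?exprn_gt0.
  rewrite ler_wpM2l ?mulr_ge0 ?invr_ge0 ?exprn_ge0 //.
  rewrite -{1}(subnKC (ltnW m12)) exprD.
  rewrite ler_wpM2l ?exprn_ge0 //.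
  have : (0 < m2 - m1)%N by rewrite subn_gt0.
  case: (m2 - m1)%N => // p _; rewrite exprS -[leRHS]mulr1.
  apply: ler_pM; rewrite ?exprn_ge0 // exprn_ile1 //.
  by apply: le_trans xd _; rewrite /d' !ge_min lexx orbT.
rewrite nneseriesZl; last by move=> i; exact: hterm_ge0.
apply: (@le_trans _ _ ((K * d')%:E * (h + 1)%:E)).
  apply: lee_wpmul2l; first by rewrite lee_fin mulr_ge0 // ltW.
  by apply: le_trans (ltW ltS) _; rewrite EFinD leeD2r.
rewrite -EFinM lee_fin.
apply: (@le_trans _ _ ((K * (h + 1) + 1) * (e / (K * (h + 1) + 1)))%R).
  rewrite mulrAC; apply: ler_pM; rewrite ?lerDl ?(ltW d'0) //.
    by rewrite mulr_ge0 // addr_ge0.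
  by rewrite /d' !ge_min lexx !orbT.
by rewrite mulrC divfK ?gt_eqF.
Qed.

End Hausdorff.

(** * Symmetric tensors and polynomial maps *)

Section PermInvariance.
Context {I : eqType} {T : Type}.

(** Adjacent swaps carry the first letter of [s] to the front of [t]; it then joins the common
    prefix and the induction goes on. *)
Lemma swap_perm (F : seq I -> T) :
  (forall u a b w, F (u ++ a :: b :: w) = F (u ++ b :: a :: w)) ->
  forall s t, perm_eq s t -> F s = F t.
Proof.
move=> sw s t st; rewrite -[s]/([::] ++ s) -[t]/([::] ++ t).
elim: s t st [::] => [|x s IH] t; first by rewrite perm_sym => /perm_nilP ->.
move=> st u; have xt : x \in t by rewrite -(perm_mem st) mem_head.
case/splitPr: t / xt st => t1 t2.
rewrite -(cat1s x t2) perm_sym perm_catCA /= perm_cons perm_sym => st.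
rewrite -cat_rcons (IH _ st) cat_rcons catA.
elim/last_ind: t1 {st} t2 => [|t1 y IHt] t2; first by rewrite cats0.
by rewrite -rcons_cat !cat_rcons IHt sw.
Qed.

End PermInvariance.

Section Polynomials.
Context {R : realType} {n : nat}.
Local Notation E := 'rV[R]_n.
Implicit Types (C : seq 'I_n -> E) (s : seq E).

(* A tensor is given by its coefficients [C w] on the words [w] in the basis
   vectors; evaluating it letter by letter keeps every proof an induction on
   the list of arguments. *)
Fixpoint mlin C s : E :=
  if s is v :: s' then \sum_(a < n) v 0 a *: mlin (fun w => C (a :: w)) s'
  else C [::].

Definition tsym C :=
  forall u a b w, C (u ++ a :: b :: w) = C (u ++ b :: a :: w).

Lemma tsym_cons C a : tsym C -> tsym (fun w => C (a :: w)).
Proof. by move=> sC u b c w; apply: (sC (a :: u)). Qed.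

Lemma eq_mlin C C' s : (forall w, size w = size s -> C w = C' w) ->
  mlin C s = mlin C' s.
Proof.
elim: s C C' => [|v s IH] C C' CC' /=; first exact: CC'.
by apply: eq_bigr => a _; congr (_ *: _); apply: IH => w sw; apply: CC'; rewrite /= sw.
Qed.

Lemma mlinD C C' s : mlin (fun w => C w + C' w) s = mlin C s + mlin C' s.
Proof.
elim: s C C' => [//|v s IH] C C' /=; rewrite -big_split /=.
by apply: eq_bigr => a _; rewrite IH scalerDr.
Qed.

Lemma mlinZ k C s : mlin (fun w => k *: C w) s = k *: mlin C s.
Proof.
elim: s C => [//|v s IH] C /=; rewrite scaler_sumr.
by apply: eq_bigr => a _; rewrite IH scalerA mulrC -scalerA.
Qed.

Lemma mlinB C C' s : mlin (fun w => C w - C' w) s = mlin C s - mlin C' s.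
Proof.
rewrite -scaleN1r -mlinZ -mlinD; apply: eq_mlin => w _.
by rewrite scaleN1r.
Qed.

Lemma mlin0 s : mlin (fun=> 0) s = 0.
Proof.
by elim: s => //= v s IH; rewrite big1 // => a _; rewrite IH scaler0.
Qed.

Lemma mlin_sum (I : finType) (F : I -> seq 'I_n -> E) (k : I -> R) s :
  mlin (fun w => \sum_i k i *: F i w) s = \sum_i k i *: mlin (F i) s.
Proof.
elim: s F => [//|v s IH] F /=.
under eq_bigr do rewrite IH scaler_sumr.
rewrite exchange_big /=; apply: eq_bigr => i _; rewrite scaler_sumr.
by apply: eq_bigr => a _; rewrite !scalerA mulrC.
Qed.

(** Contraction of the first slot. [C] holds one form for each word length at once; contracting a
    prefix of arguments turns a claim about a middle slot into one about the first. *)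
Definition ctr (v : E) C : seq 'I_n -> E := fun w => \sum_(a < n) v 0 a *: C (a :: w).

Lemma mlin_ctr v C s : mlin C (v :: s) = mlin (ctr v C) s.
Proof. by rewrite /ctr mlin_sum. Qed.

Lemma tsym_ctr v C : tsym C -> tsym (ctr v C).
Proof. by move=> sC u a b w; apply: eq_bigr => c _; rewrite (sC (c :: u)). Qed.

Lemma mlin_cat C s t : mlin C (s ++ t) = mlin (foldl (fun C v => ctr v C) C s) t.
Proof. by elim: s C => [//|v s IH] C; rewrite cat_cons mlin_ctr IH. Qed.

Lemma tsym_foldl C s : tsym C -> tsym (foldl (fun C v => ctr v C) C s).
Proof. by elim: s C => [//|v s IH] C sC; apply/IH/tsym_ctr. Qed.

Lemma mlin_linear C s t : linear (fun u => mlin C (s ++ u :: t)).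
Proof.
move=> k u v /=; rewrite !mlin_cat /= scaler_sumr -big_split /=.
by apply: eq_bigr => a _; rewrite !mxE scalerDl scalerA.
Qed.

Lemma mlin_perm C s t : tsym C -> perm_eq s t -> mlin C s = mlin C t.
Proof.
move=> sC; apply: swap_perm => u v w r; rewrite !mlin_cat.
move: (foldl _ _ _) (tsym_foldl u sC) => {}C {}sC /=.
under eq_bigr do rewrite scaler_sumr.
rewrite exchange_big /=; apply: eq_bigr => a _; rewrite scaler_sumr.
apply: eq_bigr => b _; rewrite !scalerA mulrC; congr (_ *: _).
by apply: eq_mlin => x _; apply: (sC [::]).
Qed.

Lemma norm_mlin C s B M : 0 <= M -> 0 <= B ->
  (forall w, size w = size s -> `|C w| <= M) -> (forall v, v \in s -> `|v| <= B) ->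
  `|mlin C s| <= (n%:R * B) ^+ size s * M.
Proof.
move=> M0 B0; elim: s C => [|v s IH] C CM sB /=; first by rewrite mul1r CM.
apply: le_trans (ler_norm_sum _ _ _) _.
apply: (@le_trans _ _ (\sum_(a < n) B * ((n%:R * B) ^+ size s * M))).
  apply: ler_sum => a _; rewrite normrZ; apply: ler_pM => //.
    by apply: le_trans (le_coord_norm _ _ _) (sB _ _); rewrite mem_head.
  apply: IH => [w sw|u us]; first by apply: CM; rewrite /= sw.
  by apply: sB; rewrite in_cons us orbT.
by rewrite sumr_const card_ord -[leLHS]mulr_natl exprS !mulrA.
Qed.

(** The slots are changed one at a time. [L] is chosen before [C], so the bound is linear in the
    size [M] of the coefficients. *)
Lemma mlin_nseq_lip i B : 0 <= B -> exists2 L, 0 <= L & forall C M x y, 0 <= M ->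
  (forall w, size w = i -> `|C w| <= M) -> `|x| <= B -> `|y| <= B ->
  `|mlin C (nseq i x) - mlin C (nseq i y)| <= L * M * `|x - y|.
Proof.
move=> B0; elim: i => [|i [L L0 IH]].
  by exists 0 => // C M x y M0 _ _ _ /=; rewrite subrr normr0 !mul0r.
exists (n%:R * (B * L + (n%:R * B) ^+ i)) => [|C M x y M0 CM xB yB].
  by rewrite mulr_ge0 // addr_ge0 ?mulr_ge0 // exprn_ge0 // mulr_ge0.
rewrite /= -sumrB; apply: le_trans (ler_norm_sum _ _ _) _.
rewrite -!mulrA mulr_natl -[X in _ *+ X]card_ord -sumr_const; apply: ler_sum => a _.
have -> : x 0 a *: mlin (fun w => C (a :: w)) (nseq i x) -
    y 0 a *: mlin (fun w => C (a :: w)) (nseq i y) =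
  x 0 a *: (mlin (fun w => C (a :: w)) (nseq i x) - mlin (fun w => C (a :: w)) (nseq i y)) +
  (x - y) 0 a *: mlin (fun w => C (a :: w)) (nseq i y).
  by rewrite !mxE scalerBr scalerBl addrA subrK.
have Ca w : size w = i -> `|C (a :: w)| <= M by move=> sw; apply: CM; rewrite /= sw.
apply: le_trans (ler_normD _ _) _; rewrite mulrDl -mulrA; apply: lerD; rewrite normrZ.
  apply: ler_pM => //; first exact: le_trans (le_coord_norm _ _ _) xB.
  by rewrite mulrA; apply: IH.
rewrite mulrC mulrA; apply: ler_pM => //; last exact: le_coord_norm.
rewrite -[X in _ ^+ X](size_nseq i y); apply: norm_mlin => // [w|v].
  by rewrite size_nseq; apply: Ca.
by rewrite mem_nseq => /andP[_ /eqP ->].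
Qed.

Lemma mlin_nseqZ C i r x : mlin C (nseq i (r *: x)) = r ^+ i *: mlin C (nseq i x).
Proof.
elim: i C => [|i IH] C /=; first by rewrite expr0 scale1r.
rewrite scaler_sumr; apply: eq_bigr => a _.
by rewrite IH !mxE !scalerA exprS mulrAC.
Qed.

Lemma mlin_cat0 C s i : mlin C (s ++ nseq i.+1 0) = 0.
Proof. by rewrite mlin_cat /= big1 // => a _; rewrite mxE scale0r. Qed.

Lemma mlin_delta C w : mlin C [seq delta_mx 0 a | a <- w] = C w.
Proof.
elim: w C => [//|a w IH] C /=; rewrite (bigD1 a) //= IH mxE !eqxx scale1r.
by rewrite big1 ?addr0 // => b ba; rewrite mxE (negbTE ba) andbF scale0r.
Qed.

Lemma scale_is_bilinear : bilinear_for
  (GRing.Scale.Law.clone _ _ *:%R _) (GRing.Scale.Law.clone _ _ *:%R _)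
  (@GRing.scale R E).
Proof.
by split=> [u'|u] a x y /=; rewrite ?scalerDl ?scalerDr !scalerA // mulrC.
Qed.

HB.instance Definition _ := bilinear_isBilinear.Build R R E E _ _ (@GRing.scale R E)
  scale_is_bilinear.

Lemma is_diff_scale (f df : E -> R) (g dg : E -> E) x :
  is_diff x f df -> is_diff x g dg ->
  is_diff x (fun y => f y *: g y) (fun w => f x *: dg w + df w *: g x).
Proof.
move=> dfx dgx.
have bil p : is_diff p (fun q : R * E => q.1 *: q.2)
    (fun q => p.1 *: q.2 + q.1 *: p.2).
  apply: DiffDef; last by rewrite diff_bilin // => ?; apply: scale_continuous.
  by apply: differentiable_bilin => ?; apply: scale_continuous.
have -> : (fun y => f y *: g y) = (fun p : R * E => p.1 *: p.2) \o (fun y => (f y, g y)) by [].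
exact: is_diff_eq.
Qed.

Lemma is_diff_sum (I : finType) (F dF : I -> E -> E) x :
  (forall i, is_diff x (F i) (dF i)) ->
  is_diff x (fun y => \sum_i F i y) (fun w => \sum_i dF i w).
Proof.
move=> H.
have -> : (fun y => \sum_i F i y) = \sum_i F i by apply/funext => y; rewrite fct_sumE.
have -> : (fun y => \sum_i dF i y) = \sum_i dF i by apply/funext => y; rewrite fct_sumE.
elim/big_ind2: _ => //; first exact: is_diff_cst.
by move=> f df g dg fx gx; apply: is_diffD.
Qed.

Lemma is_diff_coord (a : 'I_n) (x : E) : is_diff x (fun y : E => y 0 a) (fun y => y 0 a).
Proof.
have lin : linear (fun y : E => y 0 a : R^o) by move=> k u v; rewrite !mxE.
pose linM := GRing.isLinear.Build _ _ _ _ _ lin.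
pose L : {linear E -> R^o} := HB.pack (fun y : E => y 0 a : R^o) linM.
have cL : continuous L by move=> y; apply: coord_continuous.
apply: DiffDef; first exact: (@linear_differentiable _ _ _ L).
by rewrite (@diff_lin _ _ _ L).
Qed.

(** The product rule gives one term per slot, and symmetry makes all of them equal. *)
Lemma is_diff_mlin_nseq C i x : tsym C ->
  is_diff x (fun y => mlin C (nseq i y)) (fun v => i%:R *: mlin C (v :: nseq i.-1 x)).
Proof.
elim: i C => [|i IH] C sC.
  apply: is_diff_eq; first exact: (is_diff_cst (C [::])).
  by apply/funext => v; rewrite scale0r.
apply: is_diff_eq.
  apply: is_diff_sum => a; apply: is_diff_scale; first exact: is_diff_coord.
  by apply: IH; exact: tsym_cons.
apply/funext => v /=.
transitivity (mlin C (v :: nseq i x) + i%:R *: mlin C (x :: v :: nseq i.-1 x)).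
  rewrite big_split /= addrC; congr (_ + _).
  rewrite scaler_sumr; apply: eq_bigr => a _.
  by rewrite scalerA mulrC -scalerA.
(* For [i = 0] the truncated predecessor leaves one argument too many, but that term carries the
   factor 0. *)
case: i {IH} => [|i]; first by rewrite scale0r addr0 scale1r.
rewrite (@mlin_perm C (x :: _) (v :: x :: nseq i x)) //; last first.
  by rewrite (perm_catCA [:: x] [:: v] (nseq i x)).
transitivity ((i.+1%:R + 1) *: mlin C (v :: nseq i.+1 x)).
  by rewrite scalerDl scale1r addrC.
by rewrite natr1.
Qed.

(** Each differentiation fills one slot and multiplies by the number of free slots, whence the
    falling factorial. It is 0 when [i < size s], which makes the truncated subtraction harmless. *)
Lemma iter_diff_mlin_nseq k C s x : tsym C ->
  iter_diff (fun y => \sum_(i < k.+1) mlin C (nseq i y)) s x =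
  \sum_(i < k.+1) (i ^_ size s)%:R *: mlin C (s ++ nseq (i - size s) x).
Proof.
move=> sC; elim: s x => [|v s IH] x.
  by apply: eq_bigr => i _; rewrite ffactn0 scale1r subn0.
rewrite /= (_ : iter_diff _ s = fun y => \sum_(i < k.+1) (i ^_ size s)%:R *: mlin C (s ++ nseq (i - size s) y)); last exact/funext.
have H : is_diff x (fun y => \sum_(i < k.+1) (i ^_ size s)%:R *: mlin C (s ++ nseq (i - size s) y))
   (fun v => \sum_(i < k.+1) (i ^_ size s)%:R *: ((i - size s)%:R *:
      mlin C (s ++ v :: nseq (i - size s).-1 x))).
  apply: is_diff_sum => i; apply: is_diffZ.
  under [X in is_diff _ X _]eq_fun do rewrite mlin_cat.
  under [X in is_diff _ _ X]eq_fun do rewrite mlin_cat.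
  exact/is_diff_mlin_nseq/tsym_foldl.
rewrite diff_val; apply: eq_bigr => i _; rewrite -[RHS]/(_ *: mlin C (v :: _)).
rewrite scalerA -natrM -ffactnSr subnS; congr (_ *: _).
by apply: mlin_perm => //; rewrite (perm_catCA s [:: v]).
Qed.

Lemma Dn_mlin_nseq k C j (v : 'I_j -> E) : tsym C -> (j <= k)%N ->
  Dn (fun y => \sum_(i < k.+1) mlin C (nseq i y)) 0 v =
  j`!%:R *: mlin C [seq v i | i <- enum 'I_j].
Proof.
move=> sC jk; rewrite /Dn iter_diff_mlin_nseq // size_map size_enum_ord.
have jk' : (j < k.+1)%N by [].
rewrite (bigD1 (Ordinal jk')) //= subnn cats0 ffactnn big1 ?addr0 // => i.
rewrite -val_eqE /= neq_ltn => /orP[ij|ji].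
  by rewrite ffact_small // scale0r.
by rewrite -(subnSK ji) mlin_cat0 scaler0.
Qed.

End Polynomials.

(** * Polynomials as points of a finite-dimensional normed space *)

Section TensorCoefficients.
Context {R : realType} {n k : nat}.
Local Notation E := 'rV[R]_n.
Local Notation Par := 'rV[R]_#|{: {bseq k of 'I_n} * 'I_n}|.
Implicit Types (c : Par) (x y : E).

(** Words of length at most [k] form a finite type, so the parameters are row vectors, where bounded
    closed sets are compact. Longer words read as 0, so one parameter serves [mlin] in all
    degrees. *)
Definition coef c (w : seq 'I_n) : E :=
  \row_l (if insub w is Some t then c 0 (enum_rank (t : {bseq k of 'I_n}, l)) else 0).

Definition par (C : seq 'I_n -> E) : Par :=
  \row_i (let p : {bseq k of 'I_n} * 'I_n := enum_val i in C p.1 0 p.2).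

Lemma coef_par C w : (size w <= k)%N -> coef (par C) w = C w.
Proof.
move=> wk; apply/rowP => l; rewrite mxE.
by case: insubP => [t _ <-|]; rewrite ?wk // mxE enum_rankK.
Qed.

Lemma coef_big c w : (k < size w)%N -> coef c w = 0.
Proof. by rewrite ltnNge => wk; apply/rowP => l; rewrite !mxE insubN. Qed.

Lemma coefD c c' w : coef (c + c') w = coef c w + coef c' w.
Proof. by apply/rowP => l; rewrite !mxE; case: insub => [t|]; rewrite ?mxE ?addr0. Qed.

Lemma coefZ r c w : coef (r *: c) w = r *: coef c w.
Proof. by apply/rowP => l; rewrite !mxE; case: insub => [t|]; rewrite ?mxE ?mulr0. Qed.

Lemma coefB c c' w : coef (c - c') w = coef c w - coef c' w.
Proof. by rewrite -scaleN1r coefD coefZ scaleN1r. Qed.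

Lemma norm_coef c w : `|coef c w| <= `|c|.
Proof.
rewrite [leLHS]/Num.norm /= mx_normrE; apply/bigmax_leP; split => // -[i l] _ /=.
by rewrite mxE; case: insub => [t|]; rewrite ?normr0 //; exact: le_coord_norm.
Qed.

Lemma norm_par_le c B : 0 <= B ->
  (forall w, (size w <= k)%N -> `|coef c w| <= B) -> `|c| <= B.
Proof.
move=> B0 cB; rewrite [leLHS]/Num.norm /= mx_normrE; apply/bigmax_leP; split => // -[i p] _ /=.
rewrite ord1 -[p]enum_valK; case: (enum_val p) => t l.
have -> : c 0 (enum_rank (t, l)) = coef c t 0 l.
  by rewrite mxE; case: insubP => [u _ /val_inj -> //|]; rewrite size_bseq.
by apply: le_trans (le_coord_norm _ _ _) (cB _ _); rewrite size_bseq.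
Qed.

Lemma coef_inj c c' : (forall w, (size w <= k)%N -> coef c w = coef c' w) -> c = c'.
Proof.
move=> cc'; apply/eqP; rewrite -subr_eq0 -normr_le0; apply: norm_par_le => // w wk.
by rewrite coefB cc' // subrr normr0.
Qed.

Definition pev c x : E := \sum_(i < k.+1) mlin (coef c) (nseq i x).

Lemma pevB c c' x : pev (c - c') x = pev c x - pev c' x.
Proof.
rewrite -sumrB; apply: eq_bigr => i _; rewrite -mlinB.
by apply: eq_mlin => w _; rewrite coefB.
Qed.

Lemma pevZ r c x : pev (r *: c) x = r *: pev c x.
Proof.
rewrite scaler_sumr; apply: eq_bigr => i _; rewrite -mlinZ.
by apply: eq_mlin => w _; rewrite coefZ.
Qed.

Lemma pev_lip B : 0 <= B -> exists2 L, 0 <= L & forall c x y,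
  `|x| <= B -> `|y| <= B -> `|pev c x - pev c y| <= L * `|c| * `|x - y|.
Proof.
move=> B0; 
have : forall i, exists L, 0 <= L /\ forall (C : seq 'I_n -> E) M x y, 0 <= M ->
  (forall w, size w = i -> `|C w| <= M) -> `|x| <= B -> `|y| <= B ->
  `|mlin C (nseq i x) - mlin C (nseq i y)| <= L * M * `|x - y|.
  by move=> i; have [L] := @mlin_nseq_lip R n i B B0; exists L.
move=> /choice[L HL].
exists (\sum_(i < k.+1) L i) => [|c x y xB yB].
  by apply: sumr_ge0 => i _; case: (HL i).
rewrite -sumrB; apply: le_trans (ler_norm_sum _ _ _) _.
rewrite -mulrA mulr_suml; apply: ler_sum => i _; rewrite mulrA; case: (HL i) => _; apply => //.
by move=> w _; exact: norm_coef.
Qed.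

Lemma pev_order d c x M : 0 <= M -> `|x| <= 1 -> (forall w, `|coef c w| <= M) ->
  (forall w, (size w < d)%N -> coef c w = 0) ->
  `|pev c x| <= k.+1%:R * (n%:R + 1) ^+ k * M * `|x| ^+ d.
Proof.
move=> M0 x1 cM cd; apply: le_trans (ler_norm_sum _ _ _) _.
rewrite -!mulrA mulr_natl -[X in _ *+ X]card_ord -sumr_const; apply: ler_sum => -[i ik] _ /=.
have [id|di] := ltnP i d.
  rewrite (@eq_mlin _ _ _ (fun=> 0)) ?mlin0 ?normr0; last first.
    by move=> w; rewrite size_nseq => wi; rewrite cd // wi.
  by rewrite !mulr_ge0 ?exprn_ge0 // ?addr_ge0.
apply: (@le_trans _ _ ((n%:R * `|x|) ^+ i * M)).
  rewrite -[X in _ ^+ X](size_nseq i x); apply: norm_mlin => // v.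
  by rewrite mem_nseq => /andP[_ /eqP ->].
rewrite [M * _]mulrC exprMn -!mulrA; apply: ler_pM; rewrite ?exprn_ge0 ?mulr_ge0 ?exprn_ge0 //.
  (* The base [n%:R + 1] is at least 1, so its powers increase with the exponent even for
     [n = 0]. *)
  apply: (@le_trans _ _ ((n%:R + 1) ^+ i)).
    by rewrite lerXn2r ?nnegrE ?addr_ge0 // lerDl.
  by apply: ler_weXn2l; rewrite ?lerDr.
by apply: ler_wpM2r => //; apply: ler_wiXn2l.
Qed.

Lemma pev_bound B : 0 <= B -> exists2 L, 0 <= L & forall c x,
  `|x| <= B -> `|pev c x| <= L * `|c|.
Proof.
move=> B0; exists (\sum_(i < k.+1) (n%:R * B) ^+ i) => [|c x xB].
  by apply: sumr_ge0 => i _; rewrite exprn_ge0 ?mulr_ge0.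
apply: le_trans (ler_norm_sum _ _ _) _; rewrite mulr_suml; apply: ler_sum => i _.
rewrite -[X in _ ^+ X](size_nseq i x); apply: norm_mlin => //.
  by move=> w _; exact: norm_coef.
by move=> v; rewrite mem_nseq => /andP[_ /eqP ->].
Qed.

Lemma pev_near c B e : 0 <= B -> 0 < e -> exists2 d, 0 < d & forall c' x y,
  `|x| <= B -> `|c' - c| <= d -> `|y - x| <= d -> `|pev c' y - pev c x| < e.
Proof.
move=> B0 e0; have x10 : 0 <= B + 1 by rewrite addr_ge0.
have [L1 L10 HL1] := pev_lip x10; have [L2 L20 HL2] := pev_bound x10.
pose d := Num.min 1 (e / (L1 * `|c| + L2 + 1)).
have D0 : 0 < L1 * `|c| + L2 + 1 by rewrite ltr_wpDl // addr_ge0 // mulr_ge0.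
have d0 : 0 < d by rewrite lt_min ltr01 divr_gt0.
exists d => // c' x y xB' cc' xy.
have xB : `|x| <= B + 1 by rewrite (le_trans xB') // lerDl.
have yB : `|y| <= B + 1.
  rewrite -[y](subrK x) addrC; apply: le_trans (ler_normD _ _) _; apply: lerD => //.
  by apply: le_trans xy _; rewrite ge_min lexx.
rewrite -[pev c' y](subrK (pev c y)) -pevB -addrA.
apply: le_lt_trans (ler_normD _ _) _.
apply: (@le_lt_trans _ _ (L2 * d + L1 * `|c| * d)).
  apply: lerD.
    by apply: le_trans (HL2 _ _ yB) _; apply: ler_wpM2l.
  by apply: le_trans (HL1 _ _ _ yB xB) _; apply: ler_wpM2l => //; rewrite mulr_ge0.
rewrite -mulrDl; apply: (@lt_le_trans _ _ ((L1 * `|c| + L2 + 1) * d)).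
  by rewrite ltr_pM2r // addrC ltrDl.
by rewrite mulrC -ler_pdivlMr // ge_min lexx orbT.
Qed.

(** Dilation by [r] acting on coefficients; through it, estimates on points of size about 1 apply at
    scale [r]. *)
Definition psc r c : Par := par (fun w => r ^+ size w *: coef c w).

Lemma pev_psc r c x : pev (psc r c) x = pev c (r *: x).
Proof.
apply: eq_bigr => i _; rewrite mlin_nseqZ -mlinZ; apply: eq_mlin => w.
rewrite size_nseq => wi; rewrite coef_par ?wi //.
by rewrite -ltnS.
Qed.

Lemma tsym_psc r c : tsym (coef c) -> tsym (coef (psc r c)).
Proof.
move=> sc u a b w.
have swk : size (u ++ [:: b, a & w]) = size (u ++ [:: a, b & w]) by rewrite !size_cat.
have [uk|uk] := leqP (size (u ++ [:: a, b & w])) k; last by rewrite !coef_big ?swk.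
by rewrite (coef_par _ uk) coef_par ?swk // sc.
Qed.

Lemma Dn_pev j c (v : 'I_j -> E) : tsym (coef c) -> (j <= k)%N ->
  Dn (pev c) 0 v = j`!%:R *: mlin (coef c) [seq v i | i <- enum 'I_j].
Proof. exact: Dn_mlin_nseq. Qed.

Lemma iter_diff0 (s : seq E) : iter_diff (fun=> 0 : E) s = fun=> 0.
Proof.
elim: s => [//|v s IH] /=; rewrite IH; apply/funext => x.
by rewrite (_ : (fun=> 0) = cst 0) // diff_cst.
Qed.

(** Derivatives at the origin along basis vectors return a factorial times a symmetric coefficient,
    and factorials are nonzero in [R]. *)
Lemma pev_eq0 c : tsym (coef c) -> (forall x, pev c x = 0) -> c = 0.
Proof.
move=> sc c0; apply: coef_inj => w wk.
have := @Dn_pev (size w) c (fun i => delta_mx 0 (tnth (in_tuple w) i)) sc wk.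
have -> : pev c = fun=> 0 by apply/funext.
rewrite /Dn iter_diff0 => /esym/eqP; rewrite scaler_eq0 pnatr_eq0 -leqn0 leqNgt fact_gt0 /=.
have -> : [seq delta_mx 0 (tnth (in_tuple w) i) | i <- enum 'I_(size w)] =
    [seq delta_mx 0 a : E | a <- w].
  transitivity [seq delta_mx 0 a : E | a <- [seq tnth (in_tuple w) i | i <- enum 'I_(size w)]].
    by rewrite -(map_comp (fun a => delta_mx 0 a : E) (tnth (in_tuple w))) .
  congr map; exact: (map_tnth_enum (in_tuple w)).
by rewrite mlin_delta => /eqP ->; apply/rowP => l; rewrite !mxE; case: insub => // t; rewrite mxE.
Qed.

End TensorCoefficients.

(** * Norm estimates for orthogonal projections *)

Section MatrixNorms.
Context {R : realType}.

Lemma norm_mulmx_row n p (x : 'rV[R]_n) (A : 'M[R]_(n, p)) :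
  `|x *m A| <= n%:R * `|x| * `|A|.
Proof.
rewrite [leLHS]/Num.norm /= mx_normrE; apply/bigmax_leP; split; first by rewrite !mulr_ge0.
move=> [i j] _ /=; rewrite mxE; apply: le_trans (ler_norm_sum _ _ _) _.
rewrite -mulrA mulr_natl -[X in _ *+ X]card_ord -sumr_const; apply: ler_sum => l _.
by rewrite normrM; apply: ler_pM => //; exact: le_coord_norm.
Qed.

Definition orth_proj_mx n (P : 'M[R]_n) := P *m P = P /\ P^T = P.

(** [P i i] is the sum of the squares of row [i]. Hence its own square is at most itself, so it is
    at most 1 and bounds the square of every entry of the row. *)
Lemma orth_proj_mx_entry n (P : 'M[R]_n) i j : orth_proj_mx P -> `|P i j| <= 1.
Proof.
move=> [PP PT].
have Pii l : P l l = \sum_q P l q ^+ 2.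
  rewrite -{1}PP mxE; apply: eq_bigr => q _.
  by rewrite -{2}PT mxE expr2.
have Pii1 : P i i <= 1.
  have : P i i ^+ 2 <= P i i by rewrite {2}Pii (bigD1 i) //= lerDl sumr_ge0 // => q _; exact: sqr_ge0.
  by rewrite leNgt => H; rewrite leNgt; apply: contra H => H; rewrite -[ltLHS]mulr1 expr2 ltr_pM2l // (lt_trans ltr01).
have : P i j ^+ 2 <= 1.
  apply: le_trans Pii1; rewrite Pii (bigD1 j) //= lerDl sumr_ge0 // => q _; exact: sqr_ge0.
by rewrite -real_normK ?num_real // expr_le1.
Qed.

Lemma orth_proj_mx_norm n (P : 'M[R]_n) : orth_proj_mx P -> `|P| <= 1.
Proof.
move=> oP; rewrite [leLHS]/Num.norm /= mx_normrE; apply/bigmax_leP; split => // -[i j] _.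
exact: orth_proj_mx_entry.
Qed.

Lemma norm_mul_proj n (x : 'rV[R]_n) (P : 'M[R]_n) : orth_proj_mx P ->
  `|x *m P| <= n%:R * `|x|.
Proof.
move=> oP; apply: le_trans (norm_mulmx_row _ _) _.
by apply: ler_piMr; rewrite ?mulr_ge0 // orth_proj_mx_norm.
Qed.

Lemma mxtrace_mul_tr n (M : 'M[R]_n) : \tr (M *m M^T) = \sum_i \sum_j M i j ^+ 2.
Proof.
by apply: eq_bigr => i _; rewrite mxE; apply: eq_bigr => j _; rewrite mxE expr2.
Qed.

(* For two orthogonal projections of the same rank, one half of the difference
   controls all of it: [|P - Q|^2 = 2 |P (1 - Q)|^2] in the Hilbert-Schmidt norm. *)
Lemma orth_proj_mx_dist n (P Q : 'M[R]_n) : orth_proj_mx P -> orth_proj_mx Q ->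
  \tr P = \tr Q -> `|P - Q| <= 2 * n%:R * `|P *m (1%:M - Q)|.
Proof.
move=> [PP PT] [QQ QT] trPQ; set M := P *m (1%:M - Q).
have HS : \sum_i \sum_j (P - Q) i j ^+ 2 = 2 * \sum_i \sum_j M i j ^+ 2.
  have MM : M *m M^T = P - P *m Q *m P.
    have tB : (1%:M - Q)^T = 1%:M - Q by rewrite linearB /= trmx1 QT.
    rewrite /M trmx_mul PT tB mulmxA -(mulmxA P).
    rewrite (_ : (1%:M - Q) *m (1%:M - Q) = 1%:M - Q); last first.
      by rewrite mulmxBl mul1mx mulmxBr mulmx1 QQ subrr subr0.
    by rewrite mulmxBr mulmx1 mulmxBl PP.
  have tB : (P - Q)^T = P - Q by rewrite linearB /= PT QT.
  rewrite -!mxtrace_mul_tr MM tB mulmxBl !mulmxBr PP QQ !(raddfB (mxtrace (n := n))) /=.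
  by rewrite -trPQ (mxtrace_mulC (P *m Q)) mulmxA PP (mxtrace_mulC Q); ring.
rewrite [leLHS]/Num.norm /= mx_normrE; apply/bigmax_leP; split => [|[i j] _ /=].
  by rewrite !mulr_ge0.
rewrite -(@ler_pXn2r _ 2%N) ?nnegrE // ?mulr_ge0 // real_normK ?num_real //.
apply: (@le_trans _ _ (2 * \sum_i \sum_j M i j ^+ 2)).
  rewrite -HS (bigD1 i) //= (bigD1 j) //= -addrA lerDl addr_ge0 //.
    by apply: sumr_ge0 => l _; exact: sqr_ge0.
  by apply: sumr_ge0 => l _; apply: sumr_ge0 => q _; exact: sqr_ge0.
apply: (@le_trans _ _ (2 * (n%:R ^+ 2 * `|M| ^+ 2))).
  rewrite ler_pM2l // expr2 -mulrA mulr_natl -[X in _ *+ X]card_ord -sumr_const.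
  apply: ler_sum => l _; rewrite mulr_natl -[X in _ *+ X]card_ord -sumr_const.
  apply: ler_sum => q _; rewrite -real_normK ?num_real //.
  by rewrite lerXn2r ?nnegrE // le_coord_norm.
by rewrite !exprMn -mulrA ler_wpM2r ?mulr_ge0 ?exprn_ge0 // expr2 ler_peMl // ler1n.
Qed.
End MatrixNorms.

Section ClosedSets.
Context {R : realType} {V : normedModType R}.

Lemma closed_eq_cont (W : normedModType R) (f g : V -> W) :
  continuous f -> continuous g -> closed [set x | f x = g x].
Proof.
move=> cf cg; have -> : [set x | f x = g x] = (fun x => `|f x - g x|) @^-1` [set r | r <= 0].
  by apply/seteqP; split=> x /=; [move=> ->; rewrite subrr normr0|rewrite normr_le0 subr_eq0 => /eqP].
apply: closed_comp; last exact: closed_le.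
by move=> x _; exact: (cvg_norm (cvgB (cf x) (cg x))).
Qed.

Lemma closed_forall (I : Type) (S : I -> set V) :
  (forall i, closed (S i)) -> closed [set x | forall i, S i x].
Proof.
move=> cS; rewrite (_ : [set x | _] = \bigcap_i S i); first exact: closed_bigI.
by apply/seteqP; split=> x /= Sx i //; apply: Sx.
Qed.

Lemma lip_continuous (W : normedModType R) (f : V -> W) (L : R) :
  (forall x y, `|f x - f y| <= L * `|x - y|) -> continuous f.
Proof.
move=> fL x; apply/cvgrPdist_le => e e0; near=> y.
apply: le_trans (fL _ _) _; apply: (@le_trans _ _ ((`|L| + 1) * `|x - y|)).
  by apply: ler_wpM2r => //; apply: le_trans (ler_norm _) _; rewrite lerDl.
have L1 : 0 < `|L| + 1 by rewrite ltr_wpDl.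
rewrite mulrC -ler_pdivlMr //; near: y.
by apply: cvgr_dist_le; [exact: cvg_id|rewrite divr_gt0].
Unshelve. all: by end_near. Qed.

End ClosedSets.

Lemma near_right0P {R : realType} (P : R -> Prop) :
  (\forall t \near 0^'+, P t) <-> exists2 rho : R, 0 < rho & forall t, 0 < t <= rho -> P t.
Proof.
split=> [[e /= e0 He]|[rho rho0 H]].
  exists (e / 2); first by rewrite divr_gt0.
  move=> t /andP[t0 te]; apply: He => //=.
  by rewrite sub0r normrN gtr0_norm // (le_lt_trans te) // ltr_pdivrMr // ltr_pMr // ltr1n.
near=> t; apply: H; apply/andP; split; near: t; first exact: nbhs_right_gt.
exact: nbhs_right_le.
Unshelve. all: by end_near. Qed.

Section Norming.
Context {R : realType} {n k : nat}.
Local Notation E := 'rV[R]_n.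
Local Notation Par := 'rV[R]_#|{: {bseq k of 'I_n} * 'I_n}|.
Implicit Types (c : Par) (x y : E).

Lemma coef_continuous w : continuous (fun c : Par => coef c w : E).
Proof.
by apply: (@lip_continuous _ _ _ _ 1) => c c'; rewrite mul1r -coefB norm_coef.
Qed.

Lemma closed_tsym : closed [set c : Par | tsym (coef c)].
Proof.
do 4!apply: closed_forall => ?.
by apply: closed_eq_cont; exact: coef_continuous.
Qed.

Lemma bounded_closed_compact_le (F : set Par) (N : R) : closed F ->
  compact [set c | F c /\ `|c| <= N].
Proof.
move=> cF; apply: bounded_closed_compact.
  by exists N; split; [exact: num_real|move=> M NM c /= [_ cN]; apply: le_trans cN (ltW NM)].
apply: closedI => //; apply: (@closed_comp _ _ (fun c : Par => `|c|) [set r | r <= N]).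
  by move=> c _; exact: norm_continuous.
exact: closed_le.
Qed.

(* A nonzero polynomial is bounded below near some point; the constant is uniform
   by compactness of the unit sphere of symmetric tensors. *)
Lemma norming : exists2 t : R, 0 < t <= 1 & forall c, tsym (coef c) ->
  exists2 z : E, `|z| <= t^-1 & forall x, `|x - z| <= t -> t * `|c| <= `|pev c x|.
Proof.
pose K := [set c : Par | (tsym (coef c) /\ `|c| = 1) /\ `|c| <= 1].
have cK : compact K.
  apply: bounded_closed_compact_le; apply: closedI; first exact: closed_tsym.
  apply: (@closed_eq_cont _ _ R^o (fun c : Par => `|c|) (fun=> 1)) => c.
    exact: norm_continuous.
  exact: cst_continuous.
(* The radius [t^-1] grows and the two bounds by [t] weaken as [t] decreases, so near each tensor
   every small [t] works, and compactness yields one [t] for all. *)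
pose good t c := exists2 z : E, `|z| <= t^-1 & forall x, `|x - z| <= t -> t <= `|pev c x|.
have : \forall t \near 0^'+, K `<=` (good t).
  move/compact_near_coveringP : cK; apply => c [[sc c1] _].
  have [z z0] : exists z, pev c z != 0.
    apply/not_existsP => H; have := pev_eq0 sc (fun x => elimT eqP (negbNE (introN idP (H x)))).
    by move=> c0; move: c1; rewrite c0 normr0 => /esym/eqP; rewrite oner_eq0.
  have e0 : 0 < `|pev c z| / 2 by rewrite divr_gt0 // normr_gt0.
  have [d d0 Hd] := pev_near c (normr_ge0 z) e0.
  near=> c' t; rewrite /=.
  have t0 : 0 < t by near: t; exact: nbhs_right_gt.
  have td : t <= d by near: t; exact: nbhs_right_le.
  have z1 : 0 < `|z| + 1 by rewrite ltr_wpDl.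
  exists z.
    rewrite (@le_trans _ _ (`|z| + 1)) ?lerDl // -[leLHS]invrK lef_pV2 ?posrE ?invr_gt0 //.
    by near: t; apply: nbhs_right_le; rewrite invr_gt0.
  move=> x xz.
  have cc' : `|c' - c| <= d.
    rewrite distrC; near: c'.
    by apply: (@cvgr_dist_le _ _ _ _ _ id c) => //; exact: cvg_id.
  have := Hd c' z x (lexx _) cc' (le_trans xz td).
  rewrite distrC => /(le_lt_trans (lerB_dist _ _)).
  rewrite ltrBlDl -ltrBlDr {1}[`|pev c z|]splitr addrK => /ltW; apply: le_trans.
  by near: t; exact: nbhs_right_le.
move=> /near_right0P[rho rho0 Hrho].
pose t := Num.min rho 1.
have t0 : 0 < t by rewrite lt_min rho0 ltr01.
exists t; first by rewrite t0 /= /t ge_min lexx orbT.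
have Kt : K `<=` good t by apply: Hrho; rewrite t0 /= /t ge_min lexx.
move=> c sc; have [->|c0] := eqVneq c 0.
  by exists 0; rewrite ?normr0 ?invr_ge0 ?(ltW t0) // => x _; rewrite mulr0.
have nc0 : 0 < `|c| by rewrite normr_gt0.
have [|z zt Hz] := Kt (`|c|^-1 *: c).
  have nc1 : `|(`|c|^-1 *: c)| = 1 by rewrite normrZ normfV normr_id mulVf ?gt_eqF.
  split; last by rewrite nc1.
  by split=> // u a b w; rewrite !coefZ sc.
exists z => // x /Hz; rewrite pevZ normrZ normfV normr_id.
by rewrite mulrC ler_pdivlMr.
Unshelve. all: by end_near. Qed.

End Norming.

(** * Graphs encoded by vertical defects *)

Section LinearParameters.
Context {R : realType} {n k : nat}.
Local Notation E := 'rV[R]_n.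
Local Notation Par := 'rV[R]_#|{: {bseq k of 'I_n} * 'I_n}|.
Implicit Types (c : Par) (x y z : E).

Definition lin_mx c : 'M[R]_n := \matrix_(i, j) coef c [:: i] 0 j.
Definition tan_mx c : 'M[R]_n := 1%:M - lin_mx c.

(* [pev c] is the vertical defect [z - zT - Q (zT)] of a graph over the image of
   the projection [tan_mx c]: the graph is its zero set, its linear part is the
   normal projection, and its terms of degree at least 2 are those of [- Q]. *)
Record graph_par (m : nat) c : Prop := GraphPar {
  graph_par_proj : orth_proj_mx (tan_mx c);
  graph_par_tr : \tr (tan_mx c) = m%:R;
  graph_par_nil : coef c [::] = 0;
  graph_par_sym : tsym (coef c);
  graph_par_normal : forall z, pev c z *m tan_mx c = 0;
  graph_par_base : forall z, pev c z = z *m lin_mx c + pev c (z *m tan_mx c) }.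

Definition lpar (A : 'M[R]_n) : Par :=
  par (fun w => if w is [:: a] then row a A else 0).

Lemma coef_lpar A w : (1 <= k)%N ->
  coef (lpar A) w = if w is [:: a] then row a A else 0.
Proof.
move=> k1; have [wk|wk] := leqP (size w) k; first by rewrite coef_par.
by rewrite coef_big //; case: w wk => // a [|b w] //=; rewrite ltnNge k1.
Qed.

Lemma pev_lpar A x : (1 <= k)%N -> pev (lpar A) x = x *m A.
Proof.
move=> k1; have k1' : (1 < k.+1)%N by [].
rewrite /pev (bigD1 (Ordinal k1')) //= [X in _ + X]big1 ?addr0 => [|i i1].
  rewrite mulmx_sum_row; apply: eq_bigr => a _.
  by rewrite coef_lpar.
rewrite (@eq_mlin _ _ _ (fun=> 0)) ?mlin0 // => w; rewrite size_nseq coef_lpar //.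
by case: w => [//|a [|b w]] //= i1'; move: i1; rewrite -val_eqE /= -i1'.
Qed.

Lemma tsym_lpar A : (1 <= k)%N -> tsym (coef (lpar A)).
Proof.
by move=> k1 u a b w; rewrite !coef_lpar //; case: u => [//|? [|? ?]].
Qed.

Lemma row_lin_mx c a : row a (lin_mx c) = coef c [:: a].
Proof. by apply/rowP => l; rewrite !mxE. Qed.

Lemma le_norm_lpar A : (1 <= k)%N -> `|A| <= `|lpar A|.
Proof.
move=> k1; rewrite [leLHS]/Num.norm /= mx_normrE; apply/bigmax_leP; split => // -[i j] _ /=.
have -> : A i j = coef (lpar A) [:: i] 0 j by rewrite coef_lpar // mxE.
exact: le_trans (le_coord_norm _ _ _) (norm_coef _ _).
Qed.

(** Subtracting the linear part leaves terms of degree at least 2. For [k = 1] nothing is left; the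
    exact value [M = 0] is what lets planes be compared with no quadratic error. *)
Lemma pev_linear_part c : (1 <= k)%N -> coef c [::] = 0 ->
  exists2 M : R, 0 <= M & (k = 1%N -> M = 0) /\
    forall y, `|y| <= 1 -> `|pev c y - y *m lin_mx c| <= M * `|y| ^+ 2.
Proof.
move=> k1 c0; pose c' := c - lpar (lin_mx c).
have c'2 w : (size w < 2)%N -> coef c' w = 0.
  rewrite coefB coef_lpar //; case: w => [|a [|b w]] // _; first by rewrite c0 subrr.
  by rewrite row_lin_mx subrr.
exists (k.+1%:R * (n%:R + 1) ^+ k * `|c'|); first by rewrite !mulr_ge0 ?exprn_ge0 ?addr_ge0.
split=> [k1'|y y1].
  suff -> : c' = 0 by rewrite normr0 mulr0.
  apply: coef_inj => w; rewrite {1}k1' => wk; rewrite c'2 //.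
  by apply/rowP => l; rewrite !mxE; case: insub => // t; rewrite mxE.
rewrite -(pev_lpar _ y k1) -pevB; apply: pev_order => //.
by move=> w; exact: norm_coef.
Qed.

End LinearParameters.

(** * Density and closeness at a fixed range of scales *)

Section RestrictedMeasure.
Context {R : realType} {n : nat}.
Local Notation E := 'rV[R]_n.
Variables (m : nat) (A : set E).
Implicit Types (a x y z : E) (S : set E) (P : 'M[R]_n) (G : E -> E).
Local Open Scope ereal_scope.

Definition nu a S := hausdorff m (translate A a `&` S).

(** Quantitative form of density with all constants exposed: sup-norm balls replace cylinders, and
    the plane is given by its projection matrix. *)
Definition dens a P (e eta rho : R) := forall (r : R) z,
  (0 < r <= rho)%R -> z *m P = z -> (`|z| <= r)%R ->
  (eta * r ^+ m)%:E <= nu a [set y | (`|y - z| < e * r)%R].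

(** Distance to the graph is replaced by the size of a defect [G]; the real exponent [b] covers both
    [k] and [k + al]. *)
Definition clos a G (s b eta rho : R) := forall r : R, (0 < r <= rho)%R ->
  nu a [set y | (`|y| <= r)%R /\ (s * r `^ b < `|G y|)%R] <= (eta * r ^+ m)%:E.

Lemma le_nu a S a' S' : (forall y, S y -> S' (y + (a - a'))%R) ->
  nu a S <= nu a' S'.
Proof. exact: le_hausdorff_translate. Qed.

Lemma subset_nu a S S' : S `<=` S' -> nu a S <= nu a S'.
Proof. by move=> SS'; apply: le_nu => y /SS'; rewrite subrr addr0. Qed.

Lemma nuU a S1 S2 : nu a (S1 `|` S2) <= nu a S1 + nu a S2.
Proof. by rewrite /nu setIUr; exact: hausdorffU. Qed.

Lemma dens_le a P e eta rho e' eta' rho' :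
  dens a P e eta rho -> (e <= e')%R -> (eta' <= eta)%R -> (rho' <= rho)%R ->
  dens a P e' eta' rho'.
Proof.
move=> H ee' ee rr r z /andP[r0 rr'] zP zr.
apply: le_trans (le_trans (H r z _ zP zr) _); rewrite ?lee_fin ?r0 ?(le_trans rr') //.
  by apply: ler_wpM2r; rewrite ?exprn_ge0 // ltW.
apply: subset_nu => y /= /lt_le_trans; apply.
by apply: ler_wpM2r => //; rewrite ltW.
Qed.

Lemma clos_le a G s b eta rho s' eta' rho' :
  clos a G s b eta rho -> (s <= s')%R -> (eta <= eta')%R -> (rho' <= rho)%R ->
  clos a G s' b eta' rho'.
Proof.
move=> H ss ee rr r /andP[r0 rr'].
apply: le_trans (le_trans (H r _) _); rewrite ?lee_fin ?r0 ?(le_trans rr') //.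
  apply: subset_nu => y /= [yr Gy]; split=> //; apply: le_lt_trans Gy.
  by apply: ler_wpM2r => //; exact: powR_ge0.
by apply: ler_wpM2r => //; rewrite exprn_ge0 // ltW.
Qed.

(** The ball around [z] lies in the ball of radius [2 * r], where the two exceptional sets together
    have measure at most eta 2^(m+1) r^m. This is less than the density, so some point of the
    translated [A] in the ball avoids both. *)
Lemma dens_clos_witness a P G1 G2 s b eta eta0 rho e r z :
  dens a P e eta0 rho -> clos a G1 s b eta rho -> clos a G2 s b eta rho ->
  (e <= 1)%R -> (eta * 2 ^+ m.+1 < eta0)%R -> (0 < r)%R -> (2 * r <= rho)%R ->
  z *m P = z -> (`|z| <= r)%R ->
  exists y, [/\ (`|y - z| < e * r)%R, (`|y| <= 2 * r)%R,
    (`|G1 y| <= s * (2 * r) `^ b)%R & (`|G2 y| <= s * (2 * r) `^ b)%R].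
Proof.
move=> D C1 C2 e1 ee r0 rrho zP zr.
have r20 : (0 < 2 * r)%R by rewrite mulr_gt0.
apply: contrapT => H.
have rrho' : (0 < r <= rho)%R by rewrite r0 (le_trans _ rrho) // ler_peMl // ?ler1n // ltW.
have := D r z rrho' zP zr.
apply/negP; rewrite -ltNge.
pose F G := [set y | (`|y| <= 2 * r)%R /\ (s * (2 * r) `^ b < `|G y|)%R].
apply: (@le_lt_trans _ _ (nu a (F G1 `|` F G2))).
  apply: subset_nu => y /= yz.
  have y2 : (`|y| <= 2 * r)%R.
    rewrite -[y](subrK z) (le_trans (ler_normD _ _)) // mulr_natl mulr2n lerD //.
    by rewrite (le_trans (ltW yz)) // ler_piMl // ltW.
  have [G1y|G1y] := leP `|G1 y|%R (s * (2 * r) `^ b)%R; last by left.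
  have [G2y|G2y] := leP `|G2 y|%R (s * (2 * r) `^ b)%R; last by right.
  by exfalso; apply: H; exists y.
apply: le_lt_trans (nuU _ _ _) _.
apply: (@le_lt_trans _ _ ((eta * (2 * r) ^+ m)%:E + (eta * (2 * r) ^+ m)%:E)).
  by apply: leeD; [apply: C1|apply: C2]; rewrite r20.
rewrite -EFinD lte_fin.
have -> : (eta * (2 * r) ^+ m + eta * (2 * r) ^+ m = eta * 2 ^+ m.+1 * r ^+ m)%R.
  by rewrite exprMn exprS; ring.
by rewrite ltr_pM2r // exprn_gt0.
Qed.

End RestrictedMeasure.

Section Comparison.
Context {R : realType}.

Lemma norm_row n p (A : 'M[R]_(n, p)) i : `|row i A| <= `|A|.
Proof.
rewrite [leLHS]/Num.norm /= mx_normrE; apply/bigmax_leP; split => // -[j l] _ /=.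
by rewrite mxE le_coord_norm.
Qed.

Lemma le0_of_small (x C r0 : R) : 0 < r0 -> (forall r, 0 < r <= r0 -> x <= C * r) -> x <= 0.
Proof.
move=> r00 H; apply/ler_addgt0Pr => e e0; rewrite add0r; pose r := Num.min r0 (e / (`|C| + 1)).
have C1 : 0 < `|C| + 1 by rewrite ltr_wpDl.
have r0' : 0 < r by rewrite lt_min r00 divr_gt0.
apply: (@le_trans _ _ (C * r)); first by apply: H; rewrite r0' ge_min lexx.
apply: (@le_trans _ _ ((`|C| + 1) * r)).
  by rewrite ler_pM2r // (le_trans (ler_norm _)) // lerDl.
by rewrite mulrC -ler_pdivlMr // ge_min lexx orbT.
Qed.

(* [norming] is applied twice, with the density supplying points of [A] near the
   norming ones: first to the linear map [P1 (1 - P2)], which bounds the distance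
   of the planes by [orth_proj_mx_dist] and, for [2 <= k], makes them equal; then
   to the rescaled difference of the two coefficient vectors. *)
Lemma par_comparison n k (b : R) : (1 <= n)%N -> (1 <= k)%N -> k%:R <= b ->
  exists e0 K : R, [/\ 0 < e0, 0 <= K &
  forall m A a (c1 c2 : 'rV[R]_#|{: {bseq k of 'I_n} * 'I_n}|) s eta eta0 rho,
    graph_par m c1 -> graph_par m c2 -> 0 <= s -> 0 < rho ->
    eta * 2 ^+ m.+1 < eta0 ->
    dens m A a (tan_mx c1) e0 eta0 rho ->
    clos m A a (pev c1) s b eta rho -> clos m A a (pev c2) s b eta rho ->
  exists2 r0, 0 < r0 & forall r, 0 < r <= r0 ->
    forall w, `|coef c1 w - coef c2 w| * r ^+ size w <= K * s * r `^ b].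
Proof.
move=> n1 k1 kb; have [t /andP[t0 t1] Hnorm] := @norming R n k.
pose N : R := n%:R; have N1 : 1 <= N by rewrite ler1n.
have N0 : 0 < N by rewrite (lt_le_trans ltr01).
(* Witnesses come from balls of radius [e0 * (N / t * r)]; dividing by [r] and projecting, which
   costs a factor [N], gives exactly the radius [t] of the norming ball. *)
pose e0 := t ^+ 2 / N ^+ 2.
have e00 : 0 < e0 by rewrite divr_gt0 ?exprn_gt0.
have e01 : e0 <= 1.
  by rewrite ler_pdivrMr ?exprn_gt0 // mul1r (le_trans (exprn_ile1 _ (ltW t0) t1)) ?exprn_ege1 // ltW.
pose kap := (2 * (N / t)) `^ b.
have kap0 : 0 <= kap by exact: powR_ge0.
pose K1 := (2 + N) * kap / t; pose K2 := 2 * kap / t.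
have K10 : 0 <= K1 by rewrite divr_ge0 ?(ltW t0) // mulr_ge0 // addr_ge0 // ltW.
have K20 : 0 <= K2 by rewrite divr_ge0 ?(ltW t0) // mulr_ge0.
exists e0, (2 * N * K1 + K2); split=> //; first by rewrite addr_ge0 // mulr_ge0 // mulr_ge0 // ltW.
move=> m A a c1 c2 s eta eta0 rho V1 V2 s0 rho0 ee D C1 C2.
set P1 := tan_mx c1; set P2 := tan_mx c2.
have [oP1 oP2] := (graph_par_proj V1, graph_par_proj V2).
have P1K := oP1.1 : P1 *m P1 = P1.
pose r1 := Num.min rho 1 * t / (2 * N).
have r10 : 0 < r1 by rewrite divr_gt0 ?mulr_gt0 // lt_min rho0 ltr01.
have scale r : 0 < r <= r1 -> [/\ 0 < N / t * r, 2 * (N / t * r) <= rho & 2 * (N / t * r) <= 1].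
  move=> /andP[r0 rr1].
  have : 2 * (N / t * r) <= Num.min rho 1.
    apply: (@le_trans _ _ (2 * (N / t * r1))).
      by rewrite !ler_pM2l ?divr_gt0.
    by rewrite /r1 (_ : 2 * _ = Num.min rho 1) //; field; rewrite !gt_eqF.
  by rewrite le_min => /andP[? ?]; split=> //; rewrite mulr_gt0 // divr_gt0.
have wit r (z : 'rV[R]_n) : 0 < r <= r1 -> `|z| <= t^-1 -> exists x y : 'rV[R]_n,
    [/\ `|x - z| <= t, x *m P1 = r^-1 *: (y *m P1), `|y| <= 2 * (N / t * r),
     `|pev c1 y| <= s * kap * r `^ b & `|pev c2 y| <= s * kap * r `^ b].
  move=> r01 zt; have [R0 Rrho R1] := scale r r01; have /andP[r0 _] := r01.
  pose z' := r *: (z *m P1).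
  have z'P : z' *m P1 = z' by rewrite /z' -scalemxAl -mulmxA P1K.
  have z'r : `|z'| <= N / t * r.
    rewrite normrZ gtr0_norm // mulrC ler_pM2r //.
    by apply: le_trans (norm_mul_proj _ oP1) _; rewrite ler_pM2l.
  have [y [yz y2 G1 G2]] := dens_clos_witness D C1 C2 e01 ee R0 Rrho z'P z'r.
  have pw : (2 * (N / t * r)) `^ b = kap * r `^ b.
    by rewrite mulrA powRM // ?(ltW r0) // mulr_ge0 // divr_ge0 // ltW.
  (* The norming point [z] need not lie in the plane. It is moved along the plane until its
     projection is that of [y / r], which keeps it within [t]. *)
  exists (z + (r^-1 *: y - z *m P1) *m P1), y; split => //; last 2 first.
  - by rewrite -mulrA -pw.
  - by rewrite -mulrA -pw.
  - rewrite addrC addKr.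
    have -> : r^-1 *: y - z *m P1 = r^-1 *: (y - z').
      by rewrite scalerBr /z' scalerA mulVf ?gt_eqF // scale1r.
    apply: le_trans (norm_mul_proj _ oP1) _; rewrite normrZ gtr0_norm ?invr_gt0 //.
    apply: (@le_trans _ _ (N * (r^-1 * (e0 * (N / t * r))))).
      by rewrite !ler_pM2l ?invr_gt0 // ltW.
    by rewrite (_ : N * _ = t) // /e0; field; rewrite !gt_eqF.
  - by rewrite mulmxDl -mulmxA P1K mulmxBl -scalemxAl -mulmxA P1K addrC subrK.
have [M1 M10 [M1z HM1]] := pev_linear_part k1 (graph_par_nil V1).
have [M2 M20 [M2z HM2]] := pev_linear_part k1 (graph_par_nil V2).
pose K1' := (2 + N) * (M1 + M2) * (2 * (N / t)) ^+ 2 / t.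
(* Writing v1, v2 for the normal parts of [y] with respect to the two planes, the vector y P1 (1 -
   P2) equals v2 - v1 + v1 P2. Each normal part is a small defect up to a quadratic error, which
   yields the two terms. *)
have stepA r : 0 < r <= r1 ->
    `|P1 *m (1%:M - P2)| * r <= K1 * s * r `^ b + K1' * r ^+ 2.
  move=> r01; have [R0 Rrho R1] := scale r r01; have /andP[r0 _] := r01.
  pose L : 'rV[R]_#|{: {bseq k of 'I_n} * 'I_n}| := lpar (P1 *m (1%:M - P2)).
  have [z zt Hz] := Hnorm L (tsym_lpar _ k1).
  have [x [y [xz xP y2 G1 G2]]] := wit r z r01 zt.
  have y1 : `|y| <= 1 by exact: le_trans y2 R1.
  have := Hz x xz; rewrite pev_lpar // mulmxA xP -scalemxAl normrZ gtr0_norm ?invr_gt0 //.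
  rewrite -ler_pdivrMl ?invr_gt0 // invrK => HL.
  pose v1 := y *m lin_mx c1; pose v2 := y *m lin_mx c2.
  have bnd (v u : 'rV[R]_n) M : 0 <= M -> `|u| <= s * kap * r `^ b -> `|u - v| <= M * `|y| ^+ 2 ->
      `|v| <= s * kap * r `^ b + M * (2 * (N / t * r)) ^+ 2.
    move=> M0 ub uv; rewrite -[v](subKr u); apply: le_trans (ler_normB _ _) _.
    apply: lerD => //; apply: le_trans uv _; apply: ler_wpM2l => //.
    by rewrite lerXn2r ?nnegrE // mulr_ge0 // ltW.
  have v1b := bnd v1 _ _ M10 G1 (HM1 y y1).
  have v2b := bnd v2 _ _ M20 G2 (HM2 y y1).
  have yP : y *m P1 *m (1%:M - P2) = v2 - (v1 - v1 *m P2).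
    have q2 : 1%:M - P2 = lin_mx c2 by rewrite subKr.
    have -> : y *m P1 = y - v1 by rewrite mulmxBr mulmx1.
    by rewrite mulmxBl {1}q2 mulmxBr mulmx1.
  have : `|y *m P1 *m (1%:M - P2)| <=
      (2 + N) * (s * kap * r `^ b + (M1 + M2) * (2 * (N / t * r)) ^+ 2).
    set X := s * _ * _ in G1 G2 v1b v2b *; set Y := _ ^+ 2 in v1b v2b *.
    have X0 : 0 <= X by rewrite !mulr_ge0 // powR_ge0.
    have Y0 : 0 <= Y by exact: sqr_ge0.
    rewrite yP; apply: le_trans (ler_normB _ _) _.
    apply: (@le_trans _ _ (`|v2| + (`|v1| + N * `|v1|))).
      by rewrite lerD2l (le_trans (ler_normB _ _)) // lerD2l norm_mul_proj.
    have v1b' : `|v1| <= X + (M1 + M2) * Y.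
      by apply: le_trans v1b _; rewrite lerD2l; apply: ler_wpM2r; rewrite ?lerDl.
    have v2b' : `|v2| <= X + (M1 + M2) * Y.
      by apply: le_trans v2b _; rewrite lerD2l; apply: ler_wpM2r; rewrite ?lerDr.
    rewrite mulrDl addrA; apply: lerD; last by rewrite ler_pM2l.
    by rewrite mulr_natl mulr2n lerD.
  move=> HB; have {}HL := le_trans HL HB.
  have : t * `|P1 *m (1%:M - P2)| * r <= (2 + N) * (s * kap * r `^ b + (M1 + M2) * (2 * (N / t * r)) ^+ 2).
    apply: le_trans HL; rewrite [leRHS]mulrC ler_pM2r // ler_pM2l //.
    exact: le_norm_lpar.
  rewrite -mulrA -ler_pdivlMl // => /le_trans; apply.
  by rewrite /K1 /K1' le_eqVlt; apply/orP; left; apply/eqP; field; rewrite gt_eqF.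
have [k_1|k_n1] := eqVneq k 1%N.
  exists r1 => // r r01 w; have /andP[r0 _] := r01.
  have RHS0 : 0 <= (2 * N * K1 + K2) * s * r `^ b.
    by rewrite mulr_ge0 ?powR_ge0 // mulr_ge0 // addr_ge0 // mulr_ge0 // mulr_ge0 // ltW.
  case: w => [|i [|j w]].
  - by rewrite (graph_par_nil V1) (graph_par_nil V2) subrr normr0 mul0r.
  - have := stepA r r01; rewrite /K1' M1z // M2z // addr0 mulr0 !mul0r addr0 => H.
    have trP : \tr P1 = \tr P2 by rewrite (graph_par_tr V1) (graph_par_tr V2).
    have := orth_proj_mx_dist oP1 oP2 trP => HP.
    apply: (@le_trans _ _ (2 * N * K1 * s * r `^ b)); last first.
      by apply: ler_wpM2r; [exact: powR_ge0|apply: ler_wpM2r => //; rewrite lerDl].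
    rewrite expr1 -!row_lin_mx -raddfB /=.
    apply: (@le_trans _ _ (`|P1 - P2| * r)).
      rewrite ler_pM2r //; apply: le_trans (norm_row _ _) _.
      by rewrite distrC /P1 /P2 /tan_mx opprB [X in _ <= `|X|]addrC [X in _ <= `|X|]addrA subrK.
    apply: (@le_trans _ _ (2 * N * `|P1 *m (1%:M - P2)| * r)); first by rewrite ler_pM2r.
    have -> : 2 * N * K1 * s * r `^ b = 2 * N * (K1 * s * r `^ b) by ring.
    by rewrite -mulrA ler_pM2l // mulr_gt0.
  - by rewrite !coef_big ?k_1 // subrr normr0 mul0r.
have k2 : (2 <= k)%N by rewrite ltn_neqAle eq_sym k_n1.
(* Since [2 <= k <= b], after division by [r] the bound of [stepA] is a constant times [r], and [r]
   tends to 0. *)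
have P12 : P1 = P2.
  have trP : \tr P1 = \tr P2 by rewrite (graph_par_tr V1) (graph_par_tr V2).
  have := orth_proj_mx_dist oP1 oP2 trP.
  suff -> : `|P1 *m (1%:M - P2)| = 0 by rewrite mulr0 normr_le0 subr_eq0 => /eqP.
  apply/eqP; rewrite eq_le normr_ge0 andbT.
  apply: (@le0_of_small _ (K1 * s + K1') (Num.min r1 1)); first by rewrite lt_min r10 ltr01.
  move=> r /andP[r0]; rewrite le_min => /andP[rr1 r11].
  have := stepA r; rewrite r0 rr1 => /(_ isT) H.
  rewrite -(ler_pM2r r0); apply: le_trans H _.
  rewrite -[leRHS]mulrA -expr2 mulrDl lerD2r; apply: ler_wpM2l; first by rewrite mulr_ge0.
  rewrite -powR_mulrn ?(ltW r0) //; apply: ger_powR; first by rewrite r0.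
  by apply: le_trans kb; rewrite ler_nat.
exists r1 => // r r01 w; have /andP[r0 _] := r01.
have sd : tsym (coef (psc r (c1 - c2))).
  apply: tsym_psc => u i j v; rewrite !coefB.
  by rewrite (graph_par_sym V1) (graph_par_sym V2).
have [z zt Hz] := Hnorm _ sd.
have [x [y [xz xP y2 G1 G2]]] := wit r z r01 zt.
have := Hz x xz; rewrite pev_psc.
(* With equal planes the linear parts cancel, so the difference depends only on the projection of
   [v]; it may be evaluated at [y], where both defects are small. *)
have base v : pev (c1 - c2) v = pev (c1 - c2) (v *m P1).
  rewrite !pevB (graph_par_base V1 v) (graph_par_base V2 v) -/P1 -/P2 -P12.
  have -> : lin_mx c2 = lin_mx c1.
    by rewrite -(subKr 1%:M (lin_mx c2)) -(subKr 1%:M (lin_mx c1)) -/(tan_mx c1) -/(tan_mx c2) -/P1 -/P2 P12.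
  by rewrite opprD addrACA subrr add0r.
rewrite base -scalemxAl xP scalerA mulfV ?gt_eqF // scale1r -base pevB => H.
have {}H : t * `|psc r (c1 - c2)| <= 2 * (s * kap * r `^ b).
  by apply: le_trans H _; apply: le_trans (ler_normB _ _) _; rewrite mulr_natl mulr2n lerD.
apply: (@le_trans _ _ (K2 * s * r `^ b)); last first.
  apply: ler_wpM2r; first exact: powR_ge0.
  by apply: ler_wpM2r => //; rewrite lerDr mulr_ge0 // mulr_ge0 // ltW.
have [wk|wk] := leqP (size w) k; last first.
  by rewrite !coef_big // subrr normr0 mul0r mulr_ge0 ?powR_ge0 // mulr_ge0.
apply: (@le_trans _ _ `|psc r (c1 - c2)|).
  apply: le_trans (norm_coef _ w); rewrite coef_par // coefB normrZ mulrC.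
  by rewrite ger0_norm // exprn_ge0 // ltW.
rewrite -(ler_pM2l t0); apply: le_trans H _.
by rewrite /K2 le_eqVlt; apply/orP; left; apply/eqP; field; rewrite gt_eqF.
Qed.

End Comparison.

(** * Borel measurability of the set of points admitting a jet *)

Section BorelSets.
Context {R : realType} {n : nat}.
Implicit Types (S : set 'rV[R]_n).

Lemma borelC S : borel S -> borel (~` S).
Proof.
have [_ H _] := smallest_sigma_algebra setT (@open 'rV[R]_n).
by move=> /H; rewrite setTD.
Qed.

Lemma borel_bigcup (F : nat -> set 'rV[R]_n) :
  (forall i, borel (F i)) -> borel (\bigcup_i F i).
Proof. by have [_ _] := smallest_sigma_algebra setT (@open 'rV[R]_n); apply. Qed.

Lemma borel_bigcap (F : nat -> set 'rV[R]_n) :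
  (forall i, borel (F i)) -> borel (\bigcap_i F i).
Proof.
move=> bF; rewrite -[\bigcap_i _]setCK setC_bigcap.
by apply: borelC; apply: borel_bigcup => i; exact: borelC.
Qed.

Lemma borel_open S : open S -> borel S.
Proof. by move=> oS; exact: sub_sigma_algebra. Qed.

Lemma borel_closed S : closed S -> borel S.
Proof.
by move=> cS; rewrite -[S]setCK; apply: borelC; apply: borel_open; rewrite openC.
Qed.

Lemma borel0 : borel (set0 : set 'rV[R]_n).
Proof. by apply: borel_open; exact: open0. Qed.

End BorelSets.

(** * Semicontinuity in the base point and the coefficients *)

Section Semicontinuity.
Context {R : realType} {n k : nat}.
Local Notation E := 'rV[R]_n.
Local Notation Par := 'rV[R]_#|{: {bseq k of 'I_n} * 'I_n}|.
Variables (m : nat) (A : set E).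
Implicit Types (c : Par) (a : E).

Lemma tan_mx_lip c c' : `|tan_mx c - tan_mx c'| <= `|c - c'|.
Proof.
rewrite [leLHS]/Num.norm /= mx_normrE; apply/bigmax_leP; split => // -[i j] _ /=.
have -> : (tan_mx c - tan_mx c') i j = - (coef (c - c') [:: i] 0 j).
  have mxB p (X Y : 'M[R]_(p, n)) l : (X - Y) l j = X l j - Y l j by rewrite !mxE.
  have tE x : tan_mx x i j = (i == j)%:R - coef x [:: i] 0 j by rewrite !mxE.
  by rewrite mxB !tE coefB mxB; ring.
by rewrite normrN; apply: le_trans (le_coord_norm _ _ _) (norm_coef _ _).
Qed.

(** A failing ball at scale [r] still defeats nearby data at scale [2 * r]: its centre is projected
    to the new plane, and the radius 2 e r plus two shifts of at most e r stays within 4 e r.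
    Doubling the scale leaves room for the new centre to be longer than [r]. *)
Lemma not_dens_near a c e eta rho : 0 < e -> 0 <= eta ->
  ~ dens m A a (tan_mx c) (4 * e) eta (rho / 2) ->
  exists2 d, 0 < d & forall a' c', `|a' - a| <= d -> `|c' - c| <= d ->
    orth_proj_mx (tan_mx c') -> ~ dens m A a' (tan_mx c') e eta rho.
Proof.
move=> e0 eta0 /existsNP[r /existsNP[z /not_implyP[/andP[r0 rr]]]].
move=> /not_implyP[zP /not_implyP[zr /negP]]; rewrite -ltNge => H.
pose d := Num.min (e * r) (Num.min 1 e / (n%:R + 1)).
have n0 : 0 < n%:R + 1 :> R by rewrite ltr_wpDl.
have d0 : 0 < d by rewrite lt_min mulr_gt0 //= divr_gt0 // lt_min ltr01.
exists d => // a' c' aa cc oP H'.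
pose z' := z *m tan_mx c'.
have zz' : `|z' - z| <= Num.min 1 e * r.
  have -> : z' - z = z *m (tan_mx c' - tan_mx c) by rewrite mulmxBr zP.
  apply: le_trans (norm_mulmx_row _ _) _.
  apply: (@le_trans _ _ ((n%:R + 1) * r * d)).
    apply: ler_pM; rewrite ?mulr_ge0 //; last exact: le_trans (tan_mx_lip _ _) cc.
    by apply: ler_pM => //; rewrite lerDl.
  rewrite mulrAC ler_pM2r // mulrC -ler_pdivlMr //.
  by rewrite /d ge_min lexx orbT.
have z'r : `|z'| <= 2 * r.
  rewrite -[z'](subrK z); apply: le_trans (ler_normD _ _) _.
  rewrite mulr_natl mulr2n lerD //; apply: le_trans zz' _.
  by rewrite ler_piMl ?(ltW r0) // ge_min lexx.
have r20 : 0 < 2 * r <= rho.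
  by rewrite mulr_gt0 //= mulrC -ler_pdivlMr.
have z'P : z' *m tan_mx c' = z' by rewrite -mulmxA oP.1.
have := H' _ _ r20 z'P z'r; apply/negP; rewrite -ltNge.
apply: (@lt_le_trans _ _ (eta * r ^+ m)%:E); last first.
  rewrite lee_fin; apply: ler_wpM2l => //; rewrite lerXn2r ?nnegrE ?mulr_ge0 ?(ltW r0) //.
  by rewrite ler_peMl ?(ltW r0) // ler1n.
apply: le_lt_trans H; apply: le_nu => y /= yz'.
have -> : y + (a' - a) - z = (y - z') + ((z' - z) + (a' - a)).
  by rewrite [RHS]addrA [y - z' + _]addrA subrK addrAC.
have er : 4 * e * r = e * (2 * r) + (e * r + e * r) by ring.
rewrite er; apply: le_lt_trans (ler_normD _ _) _; apply: ltr_leD => //.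
apply: le_trans (ler_normD _ _) _; apply: lerD.
  by apply: le_trans zz' _; rewrite ler_pM2r // ge_min lexx orbT.
by apply: le_trans aa _; rewrite /d ge_min lexx.
Qed.

(** A failure at scale [r] is transported to scale [2 * r]. The defect changes by less than s
    (2r)^b, half of the original threshold, so the other half remains; 2^m compensates the mass
    bound at the doubled radius. *)
Lemma not_clos_near a c s b eta rho : 0 < s ->
  ~ clos m A a (pev c) (2 * 2 `^ b * s) b (2 ^+ m * eta) (rho / 2) ->
  exists2 d, 0 < d & forall a' c', `|a' - a| <= d -> `|c' - c| <= d ->
    ~ clos m A a' (pev c') s b eta rho.
Proof.
move=> s0 /existsNP[r /not_implyP[/andP[r0 rr] /negP]]; rewrite -ltNge => H.
have pw : (2 * r) `^ b = 2 `^ b * r `^ b by rewrite powRM // ltW.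
have e0 : 0 < s * (2 * r) `^ b by rewrite mulr_gt0 // powR_gt0 // mulr_gt0.
have [d d0 Hd] := pev_near c (ltW r0) e0.
exists (Num.min d r); first by rewrite lt_min d0.
move=> a' c' aa cc H'.
have r20 : 0 < 2 * r <= rho by rewrite mulr_gt0 //= mulrC -ler_pdivlMr.
have := H' _ r20; apply/negP; rewrite -ltNge.
rewrite exprMn mulrA [eta * _]mulrC; apply: lt_le_trans H _.
apply: le_nu => y /= [yr Gy].
have [aad aar] : `|a - a'| <= d /\ `|a - a'| <= r.
  by move: aa; rewrite distrC le_min => /andP[].
split.
  by apply: le_trans (ler_normD _ _) _; rewrite mulr_natl mulr2n lerD.
have cd : `|c' - c| <= d by move: cc; rewrite le_min => /andP[].
have := Hd c' y (y + (a - a')) yr cd; rewrite addrC addKr => /(_ aad).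
rewrite distrC => /(le_lt_trans (lerB_dist _ _)); rewrite ltrBlDl -ltrBlDr.
apply: le_lt_trans; rewrite lerBrDl; apply: le_trans (ltW Gy).
by rewrite pw le_eqVlt; apply/orP; left; apply/eqP; ring.
Qed.

(** Tube argument: if every [c] in the compact set fails [Q'] at [a], finitely many neighbourhoods
    give one neighbourhood of [a] in which all of them fail [Q]. *)
Lemma closure_exists_compact (F : set Par) (N : R) (Q Q' : E -> Par -> Prop) :
  closed F ->
  (forall a c, F c -> ~ Q' a c -> exists2 d, 0 < d & forall a' c', F c' ->
    `|a' - a| <= d -> `|c' - c| <= d -> ~ Q a' c') ->
  closure [set a | exists c, [/\ F c, `|c| <= N & Q a c]] `<=`
    [set a | exists c, [/\ F c, `|c| <= N & Q' a c]].
Proof.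
move=> cF QQ' a cla; apply: contrapT => H.
have /compact_near_coveringP := @bounded_closed_compact_le _ _ _ F N cF.
move=> /(_ E (nbhs a) (fun a' c' => F c' -> ~ Q a' c')) cov.
have /cla[a' [[c [Fc cN Qc]] Ha']] :
    \forall a' \near a, [set c | F c /\ `|c| <= N] `<=` (fun c' => F c' -> ~ Q a' c').
  apply: cov => c [Fc cN].
  have [|d d0 Hd] := QQ' a c Fc; first by move=> Q'c; apply: H; exists c.
  near=> c' a' => Fc'; apply: (Hd a' c' Fc'); rewrite distrC /=.
    by near: a'; apply: (@cvgr_dist_le _ _ _ _ _ id a) => //; exact: cvg_id.
  by near: c'; apply: (@cvgr_dist_le _ _ _ _ _ id c) => //; exact: cvg_id.
exact: (Ha' c).
Unshelve. all: by end_near. Qed.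

End Semicontinuity.

Section ContinuousMaps.
Context {R : realType} {V : normedModType R}.

Lemma eps_continuous (W : normedModType R) (f : V -> W) :
  (forall x e, 0 < e -> exists2 d, 0 < d & forall y, `|y - x| <= d -> `|f y - f x| < e) <->
  continuous f.
Proof.
split=> [H x|cf x e e0].
  apply/cvgrPdist_lt => e e0; have [d d0 Hd] := H x e e0.
  near=> y; rewrite distrC; apply: Hd; rewrite distrC; near: y.
  by apply: cvgr_dist_le => //; exact: cvg_id.
have /cvgrPdist_lt/(_ e e0)/nbhs_ballP[d /= d0 Hd] := cf x.
exists (d / 2); first by rewrite divr_gt0.
move=> y yx; rewrite distrC; apply: Hd; rewrite -ball_normE /= distrC.
by rewrite (le_lt_trans yx) // ltr_pdivrMr // ltr_pMr // ltr1n.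
Unshelve. all: by end_near. Qed.

Lemma continuous_add (W : normedModType R) (f g : V -> W) :
  continuous f -> continuous g -> continuous (fun x => f x + g x).
Proof. by move=> cf cg x; apply: cvgD; [exact: cf|exact: cg]. Qed.

Lemma continuous_sub (W : normedModType R) (f g : V -> W) :
  continuous f -> continuous g -> continuous (fun x => f x - g x).
Proof. by move=> cf cg x; apply: cvgB; [exact: cf|exact: cg]. Qed.

Lemma continuous_mul (f g : V -> R^o) :
  continuous f -> continuous g -> continuous (fun x => f x * g x : R^o).
Proof. by move=> cf cg x; apply: cvgM; [exact: cf|exact: cg]. Qed.

Lemma continuous_bigsum (I : finType) (f : I -> V -> R^o) :
  (forall i, continuous (f i)) -> continuous (fun x => \sum_i f i x : R^o).
Proof.
move=> cf; elim: (index_enum I) => [|i r IH].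
  by under eq_fun do rewrite big_nil; exact: cst_continuous.
by under eq_fun do rewrite big_cons; exact: continuous_add.
Qed.

Lemma closed_norm_le (x0 : V) (r : R) : closed [set x | `|x - x0| <= r].
Proof.
apply: (@closed_comp _ _ (fun x => `|x - x0|) [set t | t <= r]); last exact: closed_le.
by move=> x _; exact: (cvg_norm (cvgB (@cvg_id _ _) (cvg_cst x0))).
Qed.

Lemma closed_norm_ge (x0 : V) (r : R) : closed [set x | r <= `|x0 - x|].
Proof.
apply: (@closed_comp _ _ (fun x => `|x0 - x|) [set t | r <= t]); last exact: closed_ge.
by move=> x _; exact: (cvg_norm (cvgB (cvg_cst x0) (@cvg_id _ _))).
Qed.

Lemma closed_imp (b : bool) (S : set V) : closed S -> closed [set x | b -> S x].
Proof.
case: b => cS; first by rewrite (_ : mkset _ = S) //; apply/seteqP; split=> x /=; [apply|].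
by rewrite (_ : mkset _ = setT); [exact: closedT|apply/seteqP; split].
Qed.

End ContinuousMaps.

Section GraphParClosed.
Context {R : realType} {n k : nat}.
Local Notation E := 'rV[R]_n.
Local Notation Par := 'rV[R]_#|{: {bseq k of 'I_n} * 'I_n}|.
Implicit Types (c : Par).

Lemma tan_mx_entry_continuous i j : continuous (fun c : Par => tan_mx c i j : R^o).
Proof.
apply: (@lip_continuous _ _ _ _ 1) => c c'; rewrite mul1r.
have -> : tan_mx c i j - tan_mx c' i j = (tan_mx c - tan_mx c') i j by rewrite !mxE.
exact: le_trans (le_coord_norm _ _ _) (tan_mx_lip _ _).
Qed.

Lemma pev_continuous (f : Par -> E) : continuous f -> continuous (fun c => pev c (f c)).
Proof.
move=> /eps_continuous cf; apply/eps_continuous => c e e0.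
have [d d0 Hd] := pev_near c (normr_ge0 (f c)) e0.
have [d' d'0 Hd'] := cf c d d0.
exists (Num.min d d') => [|c']; first by rewrite lt_min d0.
by rewrite le_min => /andP[cd cd']; apply: Hd => //; exact/ltW/Hd'.
Qed.

Lemma mul_tan_mx_continuous (z : E) : continuous (fun c : Par => z *m tan_mx c).
Proof.
apply: (@lip_continuous _ _ _ _ (n%:R * `|z|)) => c c'.
rewrite -mulmxBr; apply: le_trans (norm_mulmx_row _ _) _.
by apply: ler_wpM2l; [exact: mulr_ge0|exact: tan_mx_lip].
Qed.

Lemma coord_pev_continuous (z : E) l : continuous (fun c : Par => pev c z 0 l : R^o).
Proof.
have /eps_continuous H := pev_continuous (f := fun=> z) (@cst_continuous _ _ z).
apply/eps_continuous => c e e0; have [d d0 Hd] := H c e e0.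
exists d => // c' /Hd; apply: le_lt_trans.
have -> : pev c' z 0 l - pev c z 0 l = (pev c' z - pev c z) 0 l by rewrite !mxE.
exact: le_coord_norm.
Qed.

(** Every clause is an equation between continuous functions of [c], possibly for all [z] or all
    entries. *)
Lemma closed_graph_par m : closed [set c : Par | graph_par m c].
Proof.
have -> : [set c : Par | graph_par m c] =
  [set c | forall i j, \sum_l tan_mx c i l * tan_mx c l j = tan_mx c i j] `&`
  [set c | forall i j, tan_mx c j i = tan_mx c i j] `&`
  [set c | \sum_i tan_mx c i i = m%:R] `&` [set c | coef c [::] = 0] `&`
  [set c | tsym (coef c)] `&`
  [set c | forall z j, \sum_l pev c z 0 l * tan_mx c l j = 0] `&`
  [set c | forall z : E, pev c z = z - z *m tan_mx c + pev c (z *m tan_mx c)].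
  apply/seteqP; split=> c /=.
    move=> [[PP PT] tr c0 sc nor base]; do !split => //.
    - by move=> i j; rewrite -[in RHS]PP mxE.
    - by move=> i j; rewrite -[in RHS]PT [RHS]mxE.
    - move=> z j; transitivity ((pev c z *m tan_mx c) 0 j); first by rewrite mxE.
      by rewrite nor mxE.
    - by move=> z; rewrite [LHS]base mulmxBr mulmx1 subKr.
  move=> [[[[[[PP PT] tr] c0] sc] nor] base]; split=> //.
  - split; first by apply/matrixP => i j; rewrite mxE PP.
    by apply/matrixP => i j; rewrite mxE PT.
  - by move=> z; apply/rowP => j; rewrite mxE nor mxE.
  - by move=> z; rewrite [LHS]base mulmxBr mulmx1 subKr.
have cT := tan_mx_entry_continuous.
do 6?apply: closedI.
- do 2!apply: closed_forall => ?; apply: (@closed_eq_cont _ _ R^o) => //.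
  by apply: continuous_bigsum => l; exact: continuous_mul.
- by do 2!apply: closed_forall => ?; apply: (@closed_eq_cont _ _ R^o).
- apply: (@closed_eq_cont _ _ R^o); last exact: cst_continuous.
  exact: continuous_bigsum.
- by apply: closed_eq_cont; [exact: coef_continuous|exact: cst_continuous].
- exact: closed_tsym.
- do 2!apply: closed_forall => ?; apply: (@closed_eq_cont _ _ R^o); last exact: cst_continuous.
  by apply: continuous_bigsum => l; apply: continuous_mul => //; exact: coord_pev_continuous.
- apply: closed_forall => z; apply: closed_eq_cont.
    by apply: (pev_continuous (f := fun=> z)); exact: cst_continuous.
  apply: continuous_add; last by apply: pev_continuous; exact: mul_tan_mx_continuous.
  by apply: continuous_sub; [exact: cst_continuous|exact: mul_tan_mx_continuous].
Qed.

End GraphParClosed.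

Section BorelSandwich.
Context {R : realType} {n k : nat}.
Local Notation E := 'rV[R]_n.
Local Notation Par := 'rV[R]_#|{: {bseq k of 'I_n} * 'I_n}|.
Variables (m : nat) (A : set E).
Implicit Types (c : Par) (a : E) (F : set Par).

Lemma inv_nat_le (e : R) : 0 < e -> exists i : nat, i.+1%:R^-1 <= e.
Proof.
move=> e0; exists (Num.truncn e^-1).
rewrite -[leRHS]invrK lef_pV2 ?posrE ?invr_gt0 //.
by rewrite ltW // truncnS_gt // invr_ge0 ltW.
Qed.

Lemma inv_nat_gt0 i : 0 < i.+1%:R^-1 :> R.
Proof. by rewrite invr_gt0. Qed.

Definition dense_at a (P : 'M[R]_n) := forall e : R, 0 < e ->
  exists rho eta : R, [/\ 0 < rho, 0 < eta & dens m A a P e eta rho].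

Definition close_at a (G : E -> E) (s b : R) := forall eta, 0 < eta ->
  exists2 rho : R, 0 < rho & clos m A a G s b eta rho.

(* The closures cost only constant factors, by semicontinuity and compactness;
   what remains after taking them is the statement with the parameter [c]
   allowed to depend on the precision [l]. *)
Lemma borel_sandwich F (s : nat -> R) (b : R) : closed F ->
  (forall c, F c -> graph_par m c) -> (forall l, 0 < s l) ->
  exists2 B, borel B &
   (forall a c, F c -> dense_at a (tan_mx c) ->
     (forall l, close_at a (pev c) (s l) b) -> B a) /\
   (forall a, B a -> forall e : R, 0 < e -> exists rho eta : R, [/\ 0 < rho, 0 < eta &
     forall l, exists2 rho', 0 < rho' & exists c, [/\ F c, dens m A a (tan_mx c) e eta rho &
        clos m A a (pev c) (2 * 2 `^ b * s l) b (2 ^+ m * l.+1%:R^-1) rho']]).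
Proof.
move=> cF FV s0.
(* Real quantifiers run over inverse integers: [i] is the density radius, [j] gives both density
   constants, [l] is the precision, and [q] gives both the range of scales and the norm bound. The
   union over [j] precedes the intersection over [l], which keeps the density constants independent
   of the precision. *)
pose W i j l q := [set a | exists c, [/\ F c, `|c| <= q.+1%:R &
   dens m A a (tan_mx c) i.+1%:R^-1 j.+1%:R^-1 j.+1%:R^-1 /\
   clos m A a (pev c) (s l) b l.+1%:R^-1 q.+1%:R^-1]].
exists (\bigcap_i \bigcup_j \bigcap_l \bigcup_q closure (W i j l q)).
  apply: borel_bigcap => i; apply: borel_bigcup => j; apply: borel_bigcap => l.
  by apply: borel_bigcup => q; apply: borel_closed; exact: closed_closure.
split=> [a c Fc D C i _|a Ba e e0].
  have [rho [eta [rho0 eta0 {}D]]] := D _ (inv_nat_gt0 i).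
  have m0 : 0 < Num.min rho eta by rewrite lt_min rho0.
  have [j] := inv_nat_le m0; rewrite le_min => /andP[jr je].
  exists j => // l _.
  have [rho' rho'0 {}C] := C l _ (inv_nat_gt0 l).
  have m'0 : 0 < Num.min rho' (`|c| + 1)^-1 by rewrite lt_min rho'0 invr_gt0 ltr_wpDl.
  have [q] := inv_nat_le m'0; rewrite le_min => /andP[qr qc].
  exists q => //; apply: subset_closure; exists c; split => //.
    move: qc; rewrite lef_pV2 ?posrE ?ltr_wpDl // => qc.
    by apply: le_trans qc; rewrite lerDl.
  by split; [apply: dens_le D _ _ _|apply: clos_le C _ _ _].
(* Taking the closure multiplies the density radius by 4. *)
have e40 : 0 < e / 4 by rewrite divr_gt0.
have [i ie] := inv_nat_le e40.
have [j _ Bj] := Ba i I.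
exists (j.+1%:R^-1 / 2), j.+1%:R^-1; split; rewrite ?divr_gt0 ?invr_gt0 //.
move=> l; have [q _ Bq] := Bj l I.
exists (q.+1%:R^-1 / 2); first by rewrite divr_gt0 ?invr_gt0.
pose Q a c := dens m A a (tan_mx c) i.+1%:R^-1 j.+1%:R^-1 j.+1%:R^-1 /\
   clos m A a (pev c) (s l) b l.+1%:R^-1 q.+1%:R^-1.
pose Q' a c := dens m A a (tan_mx c) (4 * i.+1%:R^-1) j.+1%:R^-1 (j.+1%:R^-1 / 2) /\
   clos m A a (pev c) (2 * 2 `^ b * s l) b (2 ^+ m * l.+1%:R^-1) (q.+1%:R^-1 / 2).
have QQ' a' c : F c -> ~ Q' a' c -> exists2 d, 0 < d & forall a'' c', F c' ->
    `|a'' - a'| <= d -> `|c' - c| <= d -> ~ Q a'' c'.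
  move: a' => {Ba Bj Bq} {}a Fc nQ'.
  have [D|nD] := pselect (dens m A a (tan_mx c) (4 * i.+1%:R^-1) j.+1%:R^-1 (j.+1%:R^-1 / 2)); last first.
    have [d d0 Hd] := not_dens_near (inv_nat_gt0 i) (ltW (inv_nat_gt0 j)) nD.
    exists d => // a' c' Fc' aa cc [D _]; apply: (Hd a' c' aa cc) => //.
    exact: graph_par_proj (FV _ Fc').
  have [C|nC] := pselect (clos m A a (pev c) (2 * 2 `^ b * s l) b (2 ^+ m * l.+1%:R^-1) (q.+1%:R^-1 / 2)); first by case: nQ'.
  have [d d0 Hd] := not_clos_near (s0 l) nC.
  by exists d => // a' c' _ aa cc [_ C]; apply: (Hd a' c' aa cc).
have [c [Fc _ [D C]]] := closure_exists_compact cF QQ' Bq.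
exists c; split => //; apply: dens_le D _ _ _ => //.
by rewrite mulrC -ler_pdivlMr.
Qed.

End BorelSandwich.

(** * Fixing one parameter for all precisions *)

Section Limits.
Context {R : realType} {n k : nat}.
Local Notation E := 'rV[R]_n.
Local Notation Par := 'rV[R]_#|{: {bseq k of 'I_n} * 'I_n}|.
Implicit Types (c : Par) (a : E) (F : set Par).

(** Dividing by the power of [r] leaves [K * r ^+ (k - size w)], which tends to 0 below the top
    degree and equals [K] in it. *)
Lemma coef_cmp_eq_order c c' (K r0 : R) : 0 <= K -> 0 < r0 ->
  (forall r, 0 < r <= r0 -> forall w,
     `|coef c w - coef c' w| * r ^+ size w <= K * r `^ k%:R) ->
  `|c - c'| <= K /\ forall w, (size w < k)%N -> coef c w = coef c' w.
Proof.
move=> K0 r00 H.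
have H' r w : 0 < r <= r0 -> (size w <= k)%N -> `|coef c w - coef c' w| <= K * r ^+ (k - size w).
  move=> r01 wk; have /andP[r0' _] := r01.
  rewrite -(ler_pM2r (exprn_gt0 (size w) r0')); apply: le_trans (H r r01 w) _.
  by rewrite -mulrA -exprD subnK // powR_mulrn // ltW.
have r1P (r1 := Num.min r0 1) : 0 < r1 /\ r1 <= r0 /\ r1 <= 1.
  by rewrite lt_min r00 ltr01 !ge_min !lexx orbT.
split=> [|w wk].
  apply: norm_par_le => // w wk; rewrite coefB.
  have [r1 [r10 [r1r0 r11]]] : exists r1, 0 < r1 /\ r1 <= r0 /\ r1 <= 1 by exists (Num.min r0 1).
  apply: le_trans (H' r1 w _ wk) _; first by rewrite r10.
  by apply: ler_piMr => //; apply: exprn_ile1 => //; exact: ltW.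
apply/eqP; rewrite -subr_eq0 -normr_le0.
apply: (@le0_of_small _ _ K (Num.min r0 1)); first by rewrite lt_min r00 ltr01.
move=> r /andP[r0']; rewrite le_min => /andP[rr0 r1].
apply: le_trans (H' r w _ (ltnW wk)) _; first by rewrite r0'.
apply: ler_wpM2l => //; rewrite -[leRHS]expr1.
by apply: ler_wiXn2l; rewrite ?(ltW r0') // subn_gt0.
Qed.

Lemma coef_cmp_gt_order c c' (K r0 b : R) : 0 <= K -> 0 < r0 -> k%:R < b ->
  (forall r, 0 < r <= r0 -> forall w,
     `|coef c w - coef c' w| * r ^+ size w <= K * r `^ b) -> c = c'.
Proof.
move=> K0 r00 kb H; have bk : 0 < b - k%:R by rewrite subr_gt0.
apply: coef_inj => w wk; apply/eqP; rewrite -subr_eq0 -normr_le0.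
pose r1 := Num.min r0 1.
have r10 : 0 < r1 by rewrite lt_min r00 ltr01.
apply: (@le0_of_small _ _ K (r1 `^ (b - k%:R))); first exact: powR_gt0.
(* The variable x = r^(b - k) makes the bound linear in a small quantity, as [le0_of_small]
   requires. *)
move=> x /andP[x0 xr]; pose r := x `^ (b - k%:R)^-1.
have r0' : 0 < r by exact: powR_gt0.
have rr1 : r <= r1.
  have -> : r1 = (r1 `^ (b - k%:R)) `^ (b - k%:R)^-1.
    by rewrite -powRrM mulfV ?gt_eqF // powRr1 // ltW.
  by apply: ge0_ler_powR; rewrite ?nnegrE ?powR_ge0 ?(ltW x0) // invr_ge0 ltW.
have /andP[rr0 r_1] : (r <= r0) && (r <= 1) by rewrite -le_min.
have xE : x = r `^ (b - k%:R) by rewrite /r -powRrM mulVf ?gt_eqF // powRr1 // ltW.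
rewrite -(ler_pM2r (exprn_gt0 (size w) r0')); apply: le_trans (H r _ w) _; first by rewrite r0'.
rewrite -mulrA; apply: ler_wpM2l => //.
rewrite xE -powR_mulrn ?(ltW r0') // -powRD; last by rewrite (gt_eqF r0') implybT.
apply: ger_powR; first by rewrite r0'.
by rewrite -lerBrDl opprB addrCA subrr addr0 ler_nat.
Qed.

Variables (m : nat) (A : set E).

(* The coefficients [c] may depend on the tolerance [sg] and on [eta'], but the
   density constants may not. *)
Definition approx_jets F (s : set R) b a := forall e : R, 0 < e ->
  exists rho eta : R, [/\ 0 < rho, 0 < eta &
    forall sg, s sg -> forall eta', 0 < eta' -> exists2 rho', 0 < rho' &
      exists c, [/\ F c, dens m A a (tan_mx c) e eta rho & clos m A a (pev c) sg b eta' rho']].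

Hypotheses (n1 : (1 <= n)%N) (k1 : (1 <= k)%N).
Variable F : set Par.
Hypotheses (cF : closed F) (FV : forall c, F c -> graph_par m c).

(** Any two admissible parameters coincide, so the one found for the mass bound [es] serves every
    density radius and every smaller mass bound. *)
Lemma approx_jets_gt_order lam b a : 0 <= lam -> k%:R < b -> approx_jets F [set lam] b a ->
  exists c, [/\ F c, dense_at m A a (tan_mx c) & close_at m A a (pev c) lam b].
Proof.
move=> lam0 kb st; have [e0 [K [e00 K0 cmp]]] := par_comparison n1 k1 (ltW kb).
have [rho0 [eta0 [rho00 eta00 H0]]] := st e0 e00.
(* [es * 2 ^+ m.+1] is half of [eta0], hence strictly below it as the comparison demands. *)
pose es := eta0 / 2 ^+ m.+2.
have es0 : 0 < es by rewrite divr_gt0 // exprn_gt0.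
have es1 : es * 2 ^+ m.+1 < eta0.
  rewrite /es [2 ^+ m.+2]exprS invfM mulrA mulrVK ?unitfE ?gt_eqF ?exprn_gt0 //.
  by rewrite ltr_pdivrMr // ltr_pMr // ltr1n.
have [rho1 rho10 [c [Fc D C]]] := H0 lam erefl es es0.
have uniq c' rho' : F c' -> 0 < rho' -> clos m A a (pev c') lam b es rho' -> c = c'.
  move=> Fc' rho'0 C'.
  pose rh := Num.min rho0 (Num.min rho1 rho').
  have rh0 : 0 < rh by rewrite !lt_min rho00 rho10.
  have [|||r0 r00] := cmp m A a c c' lam es eta0 rh (FV Fc) (FV Fc') lam0 rh0 es1.
  - by apply: dens_le D _ _ _; rewrite // ge_min lexx.
  - by apply: clos_le C _ _ _; rewrite // !ge_min lexx orbT.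
  - by apply: clos_le C' _ _ _; rewrite // !ge_min lexx !orbT.
  by apply: coef_cmp_gt_order => //; exact: mulr_ge0.
exists c; split=> // [e e0'|eta eta_0].
  have [rho [eta [rho_0 eta_0 H]]] := st e e0'.
  have [rho' rho'0 [c' [Fc' D' C']]] := H lam erefl es es0.
  by exists rho, eta; split=> //; rewrite (uniq c' rho').
have me0 : 0 < Num.min eta es by rewrite lt_min eta_0.
have [rho' rho'0 [c' [Fc' _ C']]] := H0 lam erefl _ me0.
exists rho' => //; rewrite (uniq c' rho') //.
  by apply: clos_le C' _ _ _; rewrite // ge_min lexx.
by apply: clos_le C' _ _ _; rewrite // ge_min lexx orbT.
Qed.

(** Parameters for the tolerances 1/(i+1) form a Cauchy sequence, and the limit differs from any
    parameter for tolerance s by at most K s, in top degree only. *)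
Lemma approx_jets_eq_order a : approx_jets F [set s | 0 < s] k%:R a ->
  exists c, [/\ F c, dense_at m A a (tan_mx c) &
    forall s, 0 < s -> close_at m A a (pev c) s k%:R].
Proof.
move=> st; have [e0 [K [e00 K0 cmp]]] := par_comparison n1 k1 (lexx (k%:R : R)).
have [rho0 [eta0 [rho00 eta00 H0]]] := st e0 e00.
pose es := eta0 / 2 ^+ m.+2.
have es0 : 0 < es by rewrite divr_gt0 // exprn_gt0.
have es1 : es * 2 ^+ m.+1 < eta0.
  rewrite /es [2 ^+ m.+2]exprS invfM mulrA mulrVK ?unitfE ?gt_eqF ?exprn_gt0 //.
  by rewrite ltr_pdivrMr // ltr_pMr // ltr1n.
have cmp' c c' s rho1 rho2 : F c -> F c' -> 0 < s -> 0 < rho1 -> 0 < rho2 ->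
    dens m A a (tan_mx c) e0 eta0 rho0 ->
    clos m A a (pev c) s k%:R es rho1 -> clos m A a (pev c') s k%:R es rho2 ->
    `|c - c'| <= K * s /\ forall w, (size w < k)%N -> coef c w = coef c' w.
  move=> Fc Fc' s0 rho10 rho20 D C C'.
  pose rh := Num.min rho0 (Num.min rho1 rho2).
  have rh0 : 0 < rh by rewrite !lt_min rho00 rho10.
  have [|||r0 r00] := cmp m A a c c' s es eta0 rh (FV Fc) (FV Fc') (ltW s0) rh0 es1.
  - by apply: dens_le D _ _ _; rewrite // ge_min lexx.
  - by apply: clos_le C _ _ _; rewrite // !ge_min lexx orbT.
  - by apply: clos_le C' _ _ _; rewrite // !ge_min lexx !orbT.
  by apply: coef_cmp_eq_order => //; rewrite mulr_ge0 // ltW.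
have : forall i : nat, exists c, [/\ F c, dens m A a (tan_mx c) e0 eta0 rho0 &
    exists2 rho', 0 < rho' & clos m A a (pev c) i.+1%:R^-1 k%:R es rho'].
  by move=> i; have [rho' rho'0 [c [Fc D C]]] := H0 _ (inv_nat_gt0 i) es es0; exists c; split=> //; exists rho'.
move=> /choice[u Hu].
have near_u c' s rho' : F c' -> 0 < s -> 0 < rho' -> clos m A a (pev c') s k%:R es rho' ->
    \forall i \near \oo, `|u i - c'| <= K * s /\ forall w, (size w < k)%N -> coef (u i) w = coef c' w.
  move=> Fc' s0 rho'0 C'; have [i0 i0s] := inv_nat_le s0.
  near=> i; have [Fu Du [rhoi rhoi0 Ci]] := Hu i.
  apply: (@cmp' (u i) c' s rhoi rho') => //.
  apply: clos_le Ci _ _ _ => //; apply: le_trans i0s.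
  rewrite lef_pV2 ?posrE // ler_nat ltnS; near: i; exact: nbhs_infty_ge.
have cu : cvg (u @ \oo).
  apply/cauchy_cvgP/cauchy_exP => e e_0.
  pose s := e / (K + 1).
  have K1 : 0 < K + 1 by rewrite ltr_wpDl.
  have s0 : 0 < s by rewrite divr_gt0.
  have [rho' rho'0 [c' [Fc' _ C']]] := H0 s s0 es es0.
  exists c'; suff : \forall i \near \oo, ball c' e (u i) by [].
  apply: filterS (near_u _ _ _ Fc' s0 rho'0 C') => i [uc' _].
  rewrite -ball_normE /= distrC.
  apply: le_lt_trans uc' _; rewrite /s mulrA ltr_pdivrMr // mulrC ltr_pM2l //.
  by rewrite ltrDl.
pose c := lim (u @ \oo); rewrite -/(cvg_to _ _) in cu.
have Fc : F c by apply: (closed_cvg _ cF _ c cu); near=> i; have [] := Hu i.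
have near_c c' s rho' : F c' -> 0 < s -> 0 < rho' -> clos m A a (pev c') s k%:R es rho' ->
    `|c - c'| <= K * s /\ forall w, (size w < k)%N -> coef c w = coef c' w.
  move=> Fc' s0 rho'0 C'.
  pose D := [set x : Par | `|x - c'| <= K * s] `&`
    [set x | forall w, (size w < k)%N -> coef x w = coef c' w].
  apply: (@closed_cvg _ _ _ _ u D _ _ c cu); last first.
    by apply: filterS (near_u _ _ _ Fc' s0 rho'0 C') => i.
  apply: closedI.
    exact: closed_norm_le.
  apply: closed_forall => w; apply: (closed_imp (S := [set x : Par | coef x w = coef c' w])).
  by apply: closed_eq_cont; [exact: coef_continuous|exact: cst_continuous].
exists c; split => // [e e0'|s s0 eta eta_0].
  have e4 : 0 < e / 4 by rewrite divr_gt0.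
  have [rho [eta [rho_0 eta_0 H]]] := st _ e4.
  exists (rho / 2), eta; split; rewrite ?divr_gt0 //.
  (* A failure of density at the limit would persist for all nearby parameters, yet parameters with
     small tolerance are nearby and dense. The factor 4 and the halved range come from
     [not_dens_near]. *)
  apply: contrapT => nD.
  have e4E : 4 * (e / 4) = e by rewrite mulrC divfK.
  rewrite -e4E in nD; have [d d0 Hd] := not_dens_near e4 (ltW eta_0) nD.
  pose s := d / (K + 1).
  have K1 : 0 < K + 1 by rewrite ltr_wpDl.
  have s0 : 0 < s by rewrite divr_gt0.
  have [rho' rho'0 [c' [Fc' D' C']]] := H s s0 es es0.
  have [cc' _] := near_c c' s rho' Fc' s0 rho'0 C'.
  apply: (Hd a c') D'; first by rewrite subrr normr0 ltW.
    rewrite distrC; apply: le_trans cc' _; rewrite /s mulrA ler_pdivrMr // mulrC ler_pM2l //.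
    by rewrite lerDl.
  exact: graph_par_proj (FV Fc').
pose kap := k.+1%:R * (n%:R + 1) ^+ k * K.
have kap0 : 0 <= kap by rewrite !mulr_ge0 ?exprn_ge0 // addr_ge0.
have kap1 : 0 < kap + 1 by rewrite ltr_wpDl.
(* The error in top degree contributes kap s' r^k, and s' + kap s' = s. *)
pose s' := s / (kap + 1).
have s'0 : 0 < s' by rewrite divr_gt0.
have me0 : 0 < Num.min eta es by rewrite lt_min eta_0.
have [rho' rho'0 [c' [Fc' _ C']]] := H0 s' s'0 _ me0.
have [|cc' cw] := near_c c' s' rho' Fc' s'0 rho'0.
  by apply: clos_le C' _ _ _; rewrite // ge_min lexx orbT.
exists (Num.min rho' 1); first by rewrite lt_min rho'0 ltr01.
move=> r /andP[r0]; rewrite le_min => /andP[rr' r1].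
have r0' : 0 < r <= rho' by rewrite r0.
apply: le_trans (le_trans _ (C' r r0')) _; last first.
  by rewrite lee_fin ler_wpM2r ?exprn_ge0 ?(ltW r0) // ge_min lexx.
apply: subset_nu => y /= [yr Gy]; split => //.
have y1 : `|y| <= 1 by exact: le_trans yr r1.
have : `|pev c y - pev c' y| <= kap * s' * r `^ k%:R.
  rewrite -pevB; apply: le_trans (pev_order (d := k) (M := K * s') _ y1 _ _) _.
  - by rewrite mulr_ge0 // ltW.
  - by move=> w; apply: le_trans (norm_coef _ _) cc'.
  - by move=> w wk; rewrite coefB cw // subrr.
  rewrite mulrA -/kap powR_mulrn ?(ltW r0) //; apply: ler_wpM2l; first by rewrite mulr_ge0 // ltW.
  by rewrite lerXn2r ?nnegrE // ltW.
move=> Hcc.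
have : s' * r `^ k%:R + kap * s' * r `^ k%:R < `|pev c y|.
  by move: Gy; rewrite (_ : s = s' + kap * s') ?mulrDl // /s'; field; rewrite gt_eqF.
rewrite -ltrBrDr => /lt_le_trans; apply.
rewrite lerBlDr -lerBlDl; apply: le_trans Hcc; exact: lerB_dist.
Unshelve. all: by end_near. Qed.

End Limits.

Section BorelJets.
Context {R : realType} {n k : nat}.
Local Notation E := 'rV[R]_n.
Local Notation Par := 'rV[R]_#|{: {bseq k of 'I_n} * 'I_n}|.
Implicit Types (c : Par) (a : E) (F : set Par).
Hypotheses (n1 : (1 <= n)%N) (k1 : (1 <= k)%N).
Variables (m : nat) (A : set E).

Definition jet al a c := [/\ dense_at m A a (tan_mx c),
  forall s, 0 < s -> close_at m A a (pev c) s k%:R &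
  0 < al -> exists2 lam, 0 <= lam & close_at m A a (pev c) lam (k%:R + al)].

Lemma close_at_le a (G : E -> E) s s' b : close_at m A a G s b -> s <= s' ->
  close_at m A a G s' b.
Proof.
move=> H ss eta eta0; have [rho rho0 C] := H eta eta0.
by exists rho => //; exact: clos_le C _ _ _.
Qed.

(** At small scales r^al absorbs [lam]. So for positive [al] the clause of order [k] follows from
    the one of order [k + al]. *)
Lemma close_at_lt_order a (G : E -> E) lam s b al : 0 <= lam -> 0 < s -> 0 < al ->
  close_at m A a G lam (b + al) -> close_at m A a G s b.
Proof.
move=> lam0 s0 al0 H eta eta0; have [rho rho0 C] := H eta eta0.
have l1 : 0 < lam + 1 by rewrite ltr_wpDl.
pose rho1 := Num.min rho ((s / (lam + 1)) `^ al^-1).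
exists rho1; first by rewrite lt_min rho0 powR_gt0 // divr_gt0.
move=> r /andP[r0]; rewrite le_min => /andP[rrho rs].
have r0' : 0 < r <= rho by rewrite r0.
apply: le_trans (C r r0'); apply: subset_nu => y /= [yr Gy]; split=> //.
apply: le_lt_trans Gy; rewrite powRD; last by rewrite (gt_eqF r0) implybT.
rewrite [r `^ b * _]mulrC mulrA; apply: ler_wpM2r; first exact: powR_ge0.
have ral : r `^ al <= s / (lam + 1).
  have -> : s / (lam + 1) = ((s / (lam + 1)) `^ al^-1) `^ al.
    by rewrite -powRrM mulVf ?gt_eqF // powRr1 // divr_ge0 ?ltW.
  by apply: ge0_ler_powR; rewrite ?nnegrE ?powR_ge0 // ltW.
apply: (@le_trans _ _ ((lam + 1) * r `^ al)).
  by apply: ler_wpM2r; [exact: powR_ge0|rewrite lerDl].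
by rewrite mulrC -ler_pdivlMr.
Qed.

(** For [al = 0] the constants of the sandwich vanish because every tolerance is allowed. For
    [al > 0] they are absorbed by [lam], which is only asked to exist and is taken over the positive
    integers. *)
Lemma borel_jet_closed F al : closed F -> (forall c, F c -> graph_par m c) -> 0 <= al ->
  borel [set a | exists2 c, F c & jet al a c].
Proof.
move=> cF FV; rewrite le_eqVlt => /orP[/eqP al0|al0].
  have [B bB [SB BS]] := @borel_sandwich R n k m A F _ k%:R cF FV (@inv_nat_gt0 R).
  suff -> : [set a | exists2 c, F c & jet al a c] = B by [].
  apply/seteqP; split => [a [c Fc [D C _]]|a Ba].
    by apply: SB Fc D _ => l; apply: C; exact: inv_nat_gt0.
  have [|c [Fc D C]] := @approx_jets_eq_order R n k m A n1 k1 F cF FV a; last first.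
    by exists c => //; split=> //; rewrite -al0 ltxx.
  move=> e e0; have [rho [eta [rho0 eta0 H]]] := BS a Ba e e0.
  exists rho, eta; split=> // s s0 eta' eta'0.
  have K0 : 0 < 2 * 2 `^ k%:R :> R by rewrite mulr_gt0 // powR_gt0.
  have m0 : 0 < 2 ^+ m :> R by rewrite exprn_gt0.
  have min0 : 0 < Num.min (s / (2 * 2 `^ k%:R)) (eta' / 2 ^+ m) by rewrite lt_min !divr_gt0.
  have [l] := inv_nat_le min0; rewrite le_min => /andP[ls le].
  have [rho' rho'0 [c [Fc D C]]] := H l; exists rho' => //; exists c; split => //.
  by apply: clos_le C _ _ _ => //; rewrite mulrC -ler_pdivlMr.
pose b := k%:R + al.
pose K := 2 * 2 `^ b : R.
have K1 : 1 <= K.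
  have -> : 1 = 1 * (2 `^ 0) :> R by rewrite powRr0 mulr1.
  apply: ler_pM; rewrite ?powR_ge0 ?ler1n //; apply: ler_powR; first by rewrite ler1n.
  by rewrite addr_ge0 // ltW.
have lam0 p (l : nat) : 0 < p.+1%:R :> R by [].
have /choice[B HB] : forall p : nat, exists B, borel B /\
   ((forall a c, F c -> dense_at m A a (tan_mx c) ->
       close_at m A a (pev c) p.+1%:R b -> B a) /\
    (forall a, B a -> approx_jets m A F [set K * p.+1%:R] b a)).
  move=> p; have [B bB [SB BS]] := @borel_sandwich R n k m A F _ b cF FV (lam0 p).
  exists B; split=> //; split => [a c Fc D C|a Ba e e0]; first by apply: SB Fc D _ => l.
  have [rho [eta [rho0 eta0 H]]] := BS a Ba e e0.
  exists rho, eta; split=> // s -> eta' eta'0.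
  have m0 : 0 < 2 ^+ m :> R by rewrite exprn_gt0.
  have [l le] := inv_nat_le (divr_gt0 eta'0 m0).
  have [rho' rho'0 [c [Fc D C]]] := H l; exists rho' => //; exists c; split => //.
  by apply: clos_le C _ _ _ => //; rewrite mulrC -ler_pdivlMr.
suff -> : [set a | exists2 c, F c & jet al a c] = \bigcup_p B p.
  by apply: borel_bigcup => p; have [] := HB p.
apply/seteqP; split=> [a [c Fc [D _ /(_ al0)[lam lam_0 C]]]|a [p _ Ba]].
  exists (Num.truncn lam) => //; have [_ [SB _]] := HB (Num.truncn lam).
  by apply: SB Fc D _; apply: close_at_le C _; rewrite ltW // truncnS_gt.
have [_ [_ BS]] := HB p.
have lamp : 0 <= K * p.+1%:R by rewrite mulr_ge0 // (le_trans _ K1).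
have kb : k%:R < b by rewrite ltrDl.
have [c [Fc D C]] := @approx_jets_gt_order R n k m A n1 k1 F FV _ b a lamp kb (BS a Ba).
exists c; first exact: Fc.
split; [exact: D|move=> s s0; exact: close_at_lt_order lamp s0 al0 C|move=> _].
by exists (K * p.+1%:R); [exact: lamp|exact: C].
Qed.

Lemma borel_jet (V : Par -> Prop) al :
  (forall c, graph_par m c -> V c -> exists2 d, 0 < d &
     forall c', graph_par m c' -> `|c' - c| <= d -> V c') -> 0 <= al ->
  borel [set a | exists c, [/\ graph_par m c, V c & jet al a c]].
Proof.
move=> Vopen al0.
(* A relatively open condition is a countable union of closed ones: [F i] keeps the parameters whose
   open ball of radius 1/(i+1) satisfies [V]. Each bad [c'] excludes an open ball, so [F i] is
   closed. *)
pose F i := [set c | graph_par m c] `&`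
  [set c | forall c', graph_par m c' -> `|c' - c| < i.+1%:R^-1 -> V c'].
have -> : [set a | exists c, [/\ graph_par m c, V c & jet al a c]] =
    \bigcup_i [set a | exists2 c, F i c & jet al a c].
  apply/seteqP; split => [a [c [gc Vc jc]]|a [i _ [c [gc Vc] jc]]].
    have [d d0 Hd] := Vopen c gc Vc; have [i id] := inv_nat_le d0.
    exists i => //; exists c => //; split => // c' gc' cc'.
    by apply: Hd => //; exact: le_trans (ltW cc') id.
  by exists c; split=> //; apply: Vc => //; rewrite subrr normr0 inv_nat_gt0.
apply: borel_bigcup => i; apply: borel_jet_closed => //; last by move=> c [].
apply: closedI; first exact: closed_graph_par.
apply: closed_forall => c'.
have [[gc' nV]|nH] := pselect (graph_par m c' /\ ~ V c').
  rewrite (_ : (fun c => _) = [set c : Par | i.+1%:R^-1 <= `|c' - c|]).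
    exact: closed_norm_ge.
  apply/seteqP; split=> c /=; rewrite leNgt; first by move=> H; apply/negP => /H; tauto.
  by move=> /negP.
rewrite (_ : (fun c => _) = setT); first exact: closedT.
apply/seteqP; split=> c // _ gc' _; apply: contrapT => nV; exact: nH.
Qed.

Lemma jet_uniq a c c' : graph_par m c -> graph_par m c' -> jet 0 a c -> jet 0 a c' -> c = c'.
Proof.
move=> gc gc' [D C _] [_ C' _].
have [e0 [K [e00 K0 cmp]]] := par_comparison n1 k1 (lexx (k%:R : R)).
have [rho0 [eta0 [rho00 eta00 De]]] := D e0 e00.
pose es := eta0 / 2 ^+ m.+2.
have es0 : 0 < es by rewrite divr_gt0 // exprn_gt0.
have es1 : es * 2 ^+ m.+1 < eta0.
  rewrite /es [2 ^+ m.+2]exprS invfM mulrA mulrVK ?unitfE ?gt_eqF ?exprn_gt0 //.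
  by rewrite ltr_pdivrMr // ltr_pMr // ltr1n.
apply/eqP; rewrite -subr_eq0 -normr_le0.
apply: (@le0_of_small _ _ K 1 ltr01) => s /andP[s0 _].
have [rho1 rho10 C1] := C s s0 es es0; have [rho2 rho20 C2] := C' s s0 es es0.
pose rh := Num.min rho0 (Num.min rho1 rho2).
have rh0 : 0 < rh by rewrite !lt_min rho00 rho10.
have [|||r0 r00 H] := cmp m A a c c' s es eta0 rh gc gc' (ltW s0) rh0 es1.
- by apply: dens_le De _ _ _; rewrite // ge_min lexx.
- by apply: clos_le C1 _ _ _; rewrite // !ge_min lexx orbT.
- by apply: clos_le C2 _ _ _; rewrite // !ge_min lexx !orbT.
by have [] := coef_cmp_eq_order (mulr_ge0 K0 (ltW s0)) r00 H.
Qed.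

End BorelJets.

(** * Tangent planes and orthogonal projections *)

Section Tangent.
Context {R : realType} {n : nat}.
Local Notation E := 'rV[R]_n.
Hypothesis n1 : (1 <= n)%N.
Variable A : set E.
Implicit Types (a z : E) (P : 'M[R]_n).

Definition tan_at m a P := [/\ orth_proj_mx P, \tr P = m%:R, dense_at m A a P &
  forall s, 0 < s -> close_at m A a (fun z => z *m (1%:M - P)) s 1].

(** At small scales the terms of degree at least 2 use at most half of the tolerance, so a jet of
    any order carries the tangent plane. *)
Lemma jet_tan_at k m al a (c : 'rV[R]_#|{: {bseq k of 'I_n} * 'I_n}|) : (1 <= k)%N ->
  graph_par m c -> jet m A al a c -> tan_at m a (tan_mx c).
Proof.
move=> k1 gc [D C _].
split; [exact: graph_par_proj gc|exact: graph_par_tr gc|exact: D|].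
move=> s s0 eta eta0; rewrite subKr.
have s20 : 0 < s / 2 by rewrite divr_gt0.
have [rho rho0 H] := C _ s20 eta eta0.
have [M M0 [_ HM]] := pev_linear_part k1 (graph_par_nil gc).
have M1 : 0 < M + 1 by rewrite ltr_wpDl.
pose rho1 := Num.min rho (Num.min 1 (s / 2 / (M + 1))).
exists rho1; first by rewrite !lt_min rho0 ltr01 divr_gt0.
move=> r /andP[r0]; rewrite !le_min => /andP[rr /andP[r_1 rM]].
have r0' : 0 < r <= rho by rewrite r0.
apply: le_trans (H r r0'); apply: subset_nu => y /= [yr Ly]; split=> //.
have y1 : `|y| <= 1 by exact: le_trans yr r_1.
have rk : r `^ k%:R <= r.
  rewrite powR_mulrn ?(ltW r0) // -[leRHS]expr1.
  by apply: ler_wiXn2l; rewrite ?(ltW r0).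
have My : M * `|y| ^+ 2 <= s / 2 * r.
  apply: (@le_trans _ _ ((M + 1) * r * r)).
    rewrite expr2 mulrA; apply: ler_pM; rewrite ?mulr_ge0 //.
    by apply: ler_pM => //; rewrite lerDl.
  by rewrite ler_pM2r // mulrC -ler_pdivlMr.
apply: (@le_lt_trans _ _ (s / 2 * r)); first by rewrite ler_pM2l.
have := HM y y1; rewrite distrC => /(le_trans (lerB_dist _ _)).
rewrite lerBlDl -lerBlDr; apply: lt_le_trans; rewrite ltrBrDl.
apply: le_lt_trans Ly; rewrite powRr1 ?(ltW r0) //.
apply: (@le_trans _ _ (s / 2 * r + s / 2 * r)); first by rewrite lerD2r.
by rewrite -mulrDl -splitr.
Qed.

(** A plane is a jet of degree 1 whose defect is the normal projection, so uniqueness of jets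
    applies. *)
Lemma tan_at_uniq m a P P' : tan_at m a P -> tan_at m a P' -> P = P'.
Proof.
have gp Q : tan_at m a Q -> exists c : 'rV[R]_#|{: {bseq 1 of 'I_n} * 'I_n}|,
    [/\ tan_mx c = Q, graph_par m c & jet m A 0 a c].
  move=> [oQ tQ D C]; exists (lpar (1%:M - Q)).
  have lE : lin_mx (lpar (1%:M - Q) : 'rV[R]_#|{: {bseq 1 of 'I_n} * 'I_n}|) = 1%:M - Q.
    by apply/row_matrixP => i; rewrite row_lin_mx coef_lpar.
  have tE : tan_mx (lpar (1%:M - Q) : 'rV[R]_#|{: {bseq 1 of 'I_n} * 'I_n}|) = Q.
    by rewrite /tan_mx lE subKr.
  have QQ : (1%:M - Q) *m Q = 0 by rewrite mulmxBl mul1mx oQ.1 subrr.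
  split=> //; split; rewrite ?tE //.
  - by rewrite coef_lpar.
  - exact: tsym_lpar.
  - by move=> z; rewrite pev_lpar // -mulmxA QQ mulmx0.
  - by move=> z; rewrite !pev_lpar // lE -(mulmxA z Q) [Q *m _]mulmxBr mulmx1 oQ.1 subrr mulmx0 addr0.
  - move=> s s0; rewrite (_ : pev _ = fun z => z *m (1%:M - Q)); first exact: C.
    by apply/funext => z; rewrite pev_lpar.
  - by rewrite ltxx.
move=> /gp[c [<- gc jc]] /gp[c' [<- gc' jc']].
by rewrite (jet_uniq n1 _ gc gc' jc jc').
Qed.

(** In a full-rank factorization of an idempotent as C S, cancellation gives S C = 1 in the size of
    the rank; the trace is cyclic. *)
Lemma mxtrace_idempotent p (Q : 'M[R]_p) : Q *m Q = Q -> \tr Q = (\rank Q)%:R.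
Proof.
move=> QQ; have [B RB] := row_freeP (row_base_free Q).
have [B' CB] := row_fullP (col_base_full Q).
have RC : row_base Q *m col_base Q = 1%:M.
  have : col_base Q *m row_base Q *m (col_base Q *m row_base Q) = col_base Q *m row_base Q.
    by rewrite !mulmx_base.
  move: (row_base Q) (col_base Q) B B' RB CB => S C B B' SB CB CSCS.
  transitivity (B' *m (C *m S *m (C *m S)) *m B); last by rewrite CSCS !mulmxA CB mul1mx.
  by rewrite !mulmxA CB mul1mx -mulmxA SB mulmx1.
by rewrite -[in LHS](mulmx_base Q) mxtrace_mulC RC mxtrace1.
Qed.

Lemma orth_proj_mx_ker m1 m2 (P1 P2 : 'M[R]_n) : orth_proj_mx P1 -> orth_proj_mx P2 ->
  \tr P1 = m1%:R -> \tr P2 = m2%:R -> (m1 < m2)%N ->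
  exists z : E, [/\ z != 0, z *m P1 = 0 & z *m P2 = z].
Proof.
move=> [PP1 _] [PP2 _].
rewrite !mxtrace_idempotent // => /eqP; rewrite eqr_nat => /eqP r1 /eqP; rewrite eqr_nat => /eqP r2 m12.
have : (kermx P1 :&: P2)%MS != 0.
  apply: contraTneq m12 => cap0; rewrite -leqNgt.
  have := mxrank_sum_cap (kermx P1) P2; rewrite cap0 mxrank0 addn0 mxrank_ker r1 r2 => H.
  have := rank_leq_col (kermx P1 + P2)%MS; rewrite H.
  have := rank_leq_col P1; rewrite r1; lia.
move=> /rowV0Pn[z]; rewrite sub_capmx => /andP[/sub_kermxP zP1 /submxP[w zw]] z0.
by exists z; split=> //; rewrite zw -mulmxA PP2.
Qed.

(* A higher-dimensional tangent plane would force positive measure inside a set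
   which is null in that dimension, being of finite lower-dimensional measure. *)
Lemma tan_at_dim m1 m2 a P1 P2 : (0 < unit_ball_vol m1 :> \bar R)%E ->
  tan_at m1 a P1 -> tan_at m2 a P2 -> (m2 <= m1)%N.
Proof.
move=> c1 [oP1 t1 _ C1] [oP2 t2 D2 _]; rewrite leqNgt; apply/negP => m12.
have [z0 [z0n z0P1 z0P2]] := orth_proj_mx_ker oP1 oP2 t1 t2 m12.
have N1 : 0 < n%:R + 1 :> R by rewrite ltr_wpDl.
(* Moving [z] by less than [e * r] changes its normal part by at most [r / 2], so at least [r / 2]
   remains. This exceeds the threshold 2r/5 given by the tolerance 1/5 at radius [2 * r]. *)
pose e := (2 * (n%:R + 1))^-1 : R.
have e0 : 0 < e by rewrite invr_gt0 mulr_gt0.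
have [rho [eta [rho0 eta0 D]]] := D2 e e0.
have s0 : 0 < 5^-1 :> R by rewrite invr_gt0.
have [rho' rho'0 C] := C1 _ s0 1 ltr01.
pose r := Num.min rho (rho' / 2).
have r0 : 0 < r by rewrite lt_min rho0 divr_gt0.
pose z := (r / `|z0|) *: z0.
have zr : `|z| = r by rewrite normrZ normrM normfV normr_id gtr0_norm // divfK // normr_eq0.
have zP2 : z *m P2 = z by rewrite -scalemxAl z0P2.
have zP1 : z *m P1 = 0 by rewrite -scalemxAl z0P1 scaler0.
have rr : 0 < r <= rho by rewrite r0 ge_min lexx.
have r2 : 0 < 2 * r <= rho' by rewrite mulr_gt0 //= mulrC -ler_pdivlMr // ge_min lexx orbT.
have := D r z rr zP2; rewrite zr lexx => /(_ isT).
pose S := [set y : E | `|y| <= 2 * r /\ 5^-1 * (2 * r) `^ 1 < `|y *m (1%:M - P1)|].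
have S0 : nu m2 A a S = 0%E.
  apply: (hausdorff_lt_eq0 c1 m12); apply: le_lt_trans (C _ r2) _; exact: ltry.
apply/negP; rewrite -ltNge.
apply: (@le_lt_trans _ _ (nu m2 A a S)); last by rewrite S0 lte_fin mulr_gt0 // exprn_gt0.
have e1 : e <= 1.
  by rewrite invf_le1 ?mulr_gt0 // mulr_ege1 // ?ler1n // lerDr.
apply: subset_nu => y /= yz; split.
  rewrite -[y](subrK z) (le_trans (ler_normD _ _)) // zr mulr_natl mulr2n lerD //.
  by rewrite (le_trans (ltW yz)) // ler_piMl // ltW.
rewrite powRr1 ?mulr_ge0 ?(ltW r0) //.
have -> : y *m (1%:M - P1) = z - ((z - y) - (z - y) *m P1).
  by rewrite mulmxBl zP1 sub0r opprK mulmxBr mulmx1 opprD opprB addrA [z + _]addrCA subrr addr0.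
apply: lt_le_trans (lerB_dist _ _); rewrite zr.
have : `|(z - y) - (z - y) *m P1| <= (n%:R + 1) * (e * r).
  apply: le_trans (ler_normB _ _) _; rewrite mulrDl mul1r addrC; apply: lerD.
    by apply: le_trans (norm_mul_proj _ oP1) _; rewrite ler_wpM2l // distrC ltW.
  by rewrite distrC ltW.
have -> : (n%:R + 1) * (e * r) = r / 2.
  by rewrite /e; field; rewrite gt_eqF.
move=> H; lra.
Qed.

End Tangent.

(** * Linear subspaces and symmetric idempotent matrices *)

Section OrthogonalProjections.
Context {R : realType} {n : nat}.
Local Notation E := 'rV[R]_n.
Implicit Types (T : {vspace E}) (x y u v : E).

Lemma dotrE x y : dotr x y = (x *m y^T) 0 0.
Proof. by rewrite mxE; apply: eq_bigr => i _; rewrite mxE. Qed.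

Lemma dotr_sym x y : dotr x y = dotr y x.
Proof. by apply: eq_bigr => i _; rewrite mulrC. Qed.

Lemma dotr_eq0 x : dotr x x = 0 -> x = 0.
Proof.
move=> /eqP; rewrite psumr_eq0 => [/allP H|i _]; last by rewrite -expr2 sqr_ge0.
apply/rowP => i; rewrite mxE; apply/eqP.
by have := H i (mem_index_enum _); rewrite mulf_eq0 orbb.
Qed.

Lemma orthcP T x : reflect (forall v, v \in T -> dotr x v = 0) (x \in orthc T).
Proof. by apply: (iffP mem_orthovP) => H v vT; exact: H. Qed.

Lemma capv_orthc T : (T :&: orthc T)%VS = 0%VS.
Proof.
apply/eqP; rewrite -subv0; apply/subvP => x; rewrite memv_cap => /andP[xT /orthcP xT'].
by rewrite memv0; apply/eqP/dotr_eq0/xT'.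
Qed.

(** A trivial intersection with the complement suffices to identify the projection once a
    decomposition is known; that one always exists is shown by the explicit matrix in
    [orthproj_spec]. *)
Lemma orthproj_eq T x u : u \in T -> x - u \in orthc T -> orthproj T x = u.
Proof.
move=> uT wT; have wTT : x - u \in (T + orthc T)%VS by apply: (subvP (addvSr T _)).
have cap' : (orthc T :&: T)%VS = 0%VS by rewrite capvC capv_orthc.
have := daddv_pi_add (capv_orthc T) wTT; rewrite (daddv_pi_id cap' wT) => /eqP.
rewrite -subr_eq0 addrK => /eqP w0.
by rewrite -[x](subrK u) addrC linearD /= /orthproj w0 addr0 daddv_pi_id // capv_orthc.
Qed.

Lemma mul_orthproj T x : x *m lin1_mx (orthproj T) = orthproj T x.
Proof. by rewrite mul_rV_lin1. Qed.

Lemma eq_mulmx_row m (P Q : 'M[R]_(m, n)) : (forall x : 'rV_m, x *m P = x *m Q) -> P = Q.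
Proof. by move=> PQ; apply/row_matrixP => i; rewrite !rowE PQ. Qed.

(* The projection is [B^T (B B^T)^-1 B], for [B] the matrix of a basis. *)
Lemma orthproj_spec T : [/\ forall x, x - orthproj T x \in orthc T,
  orth_proj_mx (lin1_mx (orthproj T)) & \tr (lin1_mx (orthproj T)) = (\dim T)%:R].
Proof.
pose B : 'M[R]_(\dim T, n) := \matrix_i (vbasis T)`_i.
have mulB (w : 'rV_(\dim T)) : w *m B = \sum_i w 0 i *: (vbasis T)`_i.
  by rewrite mulmx_sum_row; apply: eq_bigr => i _; rewrite rowK.
have memB (w : 'rV_(\dim T)) : w *m B \in T.
  rewrite mulB; apply: memv_suml => i _; apply/memvZ/vbasis_mem/mem_nth.
  by rewrite size_tuple.
have Bmem v : v \in T -> exists w, v = w *m B.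
  move=> vT; exists (\row_i coord (vbasis T) i v).
  by rewrite mulB {1}(coord_vbasis vT); apply: eq_bigr => i _; rewrite mxE.
pose G := B *m B^T.
have GT : G^T = G by rewrite trmx_mul trmxK.
(* For the Gram matrix, [w *m G = 0] forces [w *m B] to have length 0, and the basis is free. *)
have Gu : G \in unitmx.
  rewrite -row_free_unit; apply: inj_row_free => w wG.
  have wB : w *m B = 0.
    by apply: dotr_eq0; rewrite dotrE trmx_mul mulmxA -(mulmxA w) wG mul0mx mxE.
  have /freeP H := basis_free (vbasisP T).
  apply/rowP => i; rewrite mxE; apply: (H (fun i => w 0 i)).
  by rewrite -mulB.
pose P := B^T *m invmx G *m B.
have PT x : x *m P \in T by rewrite /P !mulmxA memB.
have PC x : x - x *m P \in orthc T.
  apply/orthcP => v /Bmem[w ->]; rewrite dotrE trmx_mul mulmxA.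
  have PB : P *m B^T = B^T by rewrite /P -!mulmxA -/G mulVmx // mulmx1.
  by rewrite mulmxBl -mulmxA PB subrr mul0mx mxE.
have PE : lin1_mx (orthproj T) = P.
  by apply: eq_mulmx_row => x; rewrite mul_orthproj; apply: orthproj_eq.
split=> [x||]; first by rewrite -mul_orthproj PE.
- rewrite PE; split; last by rewrite /P !trmx_mul trmxK trmx_inv GT mulmxA.
  by rewrite /P !mulmxA -(mulmxA (B^T *m invmx G)) -/G mulmxKV.
- by rewrite PE /P -mulmxA mxtrace_mulC -mulmxA -/G mulVmx // mxtrace1.
Qed.

Lemma orthproj_mem T x : orthproj T x \in T. Proof. exact: memv_pi. Qed.

Lemma orthproj_id T x : x \in T -> orthproj T x = x.
Proof. by move=> xT; apply: orthproj_eq => //; rewrite subrr mem0v. Qed.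

Lemma orthproj_orthc0 T x : x \in orthc T -> orthproj T x = 0.
Proof. by move=> xT; apply: orthproj_eq; rewrite ?mem0v // subr0. Qed.

Lemma orthprojC T x : orthproj (orthc T) x = x - orthproj T x.
Proof.
have [C _ _] := orthproj_spec T; apply: orthproj_eq; first exact: C.
rewrite subKr; apply/orthcP => v /orthcP vT; rewrite dotr_sym; apply: vT.
exact: orthproj_mem.
Qed.

Lemma orthproj_of_mx (P : 'M[R]_n) : orth_proj_mx P ->
  exists T : {vspace E}, lin1_mx (orthproj T) = P.
Proof.
move=> [PP PT]; exists (limg (linfun (mulmxr P : E -> E))).
apply: eq_mulmx_row => x; rewrite mul_orthproj; apply: orthproj_eq.
  by apply/memv_imgP; exists x; rewrite ?memvf // lfunE.
apply/orthcP => v /memv_imgP[y _ ->]; rewrite lfunE /= dotrE trmx_mul PT mulmxA.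
by rewrite mulmxBl -mulmxA PP subrr mul0mx mxE.
Qed.

End OrthogonalProjections.

(** * Passage to polynomial functions on the plane *)

Section PolynomialParameters.
Context {R : realType} {n : nat}.
Local Notation E := 'rV[R]_n.
Implicit Types (T : {vspace E}) (x y z u v : E).

Lemma enormZ (t : R) x : 0 <= t -> enorm (t *: x) = t * enorm x.
Proof.
move=> t0; rewrite /enorm (_ : dotr _ _ = t ^+ 2 * dotr x x).
  by rewrite sqrtrM ?sqr_ge0 // sqrtr_sqr ger0_norm.
by rewrite mulr_sumr; apply: eq_bigr => i _; rewrite !mxE; ring.
Qed.

(** Arguments are expanded in the standard basis one by one; the expanded ones move into the prefix
    [s1]. *)
Lemma mlin_expand (i : nat) (f : seq E -> E) :
  (forall s1 s2, (size s1 + size s2).+1 = i -> linear (fun u => f (s1 ++ u :: s2))) ->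
  forall s, size s = i -> f s = mlin (fun w => f [seq delta_mx 0 a | a <- w]) s.
Proof.
move=> lf s si; suff : forall s1, (size s1 + size s)%N = i ->
    f (s1 ++ s) = mlin (fun w => f (s1 ++ [seq delta_mx 0 a | a <- w])) s.
  by move=> /(_ [::]); apply.
elim: s {si} => [|v s IH] s1 /=; first by rewrite cats0.
rewrite addnS => si; have lin := lf s1 s si.
pose linM := GRing.isLinear.Build _ _ _ _ _ lin.
pose L : {linear E -> E} := HB.pack (fun u => f (s1 ++ u :: s)) linM.
rewrite -[LHS]/(L v) {1}(row_sum_delta v) linear_sum; apply: eq_bigr => a _.
rewrite linearZ /=; congr (_ *: _).
by rewrite -cat_rcons IH ?size_rcons ?addSn //; apply: eq_mlin => w _; rewrite cat_rcons.
Qed.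

Definition proj_mx T : 'M[R]_n := lin1_mx (orthproj T).

Definition defect T (P : subvs_of T -> subvs_of (orthc T)) z : E :=
  z *m (1%:M - proj_mx T) - vsval (P (vsproj T (orthproj T z))).

Section PolyToPar.
Variables (k : nat) (T : {vspace E}) (P : subvs_of T -> subvs_of (orthc T)).
Hypotheses (k1 : (1 <= k)%N).
Variable phi : forall i : nat, ('I_i -> subvs_of T) -> subvs_of (orthc T).
Arguments phi : clear implicits.
Hypothesis phi_sym : forall i, (i <= k)%N -> symmultilinear _ _ i (phi i).
Hypothesis P_sum : forall x : subvs_of T, P x = \sum_(i < k.+1) phi i (fun=> x).
Hypotheses (P0 : P 0 = 0) (P'0 : diff0_eq0 P).

(** The form [phi i] pulled back to the whole space along the projection, and fed a list so that it
    can be compared with [mlin]. *)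
Let f i (s : seq E) : E := vsval (phi i (fun l : 'I_i => vsproj T (orthproj T s`_l))).

Let f_linear i : (i <= k)%N -> forall s1 s2, (size s1 + size s2).+1 = i ->
  linear (fun u => f i (s1 ++ u :: s2)).
Proof.
move=> ik s1 s2 si a u v; rewrite /f.
have p_lt : (size s1 < i)%N by rewrite -si ltnS leq_addr.
have split_at x : (fun l : 'I_i => vsproj T (orthproj T (s1 ++ x :: s2)`_l)) =
    fun l => if l == Ordinal p_lt then vsproj T (orthproj T x) else
      vsproj T (orthproj T (s1 ++ 0 :: s2)`_l).
  apply/funext => l; rewrite -val_eqE /= !nth_cat.
  have [ls|ls|->] := ltngtP l (size s1) => //; last by rewrite subnn.
  by rewrite -(subnSK ls).
rewrite !split_at; have [/(_ (Ordinal p_lt)) H _] := phi_sym ik.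
have := H (fun l => vsproj T (orthproj T (s1 ++ 0 :: s2)`_l)) a
  (vsproj T (orthproj T u)) (vsproj T (orthproj T v)).
by rewrite -linearP /= => /(congr1 vsval); rewrite !linearP /=.
Qed.

Let f_swap i (u w : seq E) a b : (i <= k)%N -> size (u ++ [:: a, b & w]) = i ->
  f i (u ++ [:: a, b & w]) = f i (u ++ [:: b, a & w]).
Proof.
move=> ik si; have [_ H] := phi_sym ik.
have p_lt : (size u < i)%N by rewrite -si size_cat /= addnS ltnS leq_addr.
have q_lt : ((size u).+1 < i)%N by rewrite -si size_cat /= !addnS !ltnS leq_addr.
congr vsval; rewrite -(H (tperm (Ordinal p_lt) (Ordinal q_lt))); congr (phi _); apply/funext => l /=.
congr (vsproj _ (orthproj _ _)); rewrite !nth_cat; case: tpermP => [->|->|/eqP l1 /eqP l2] /=.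
- by rewrite ltnn subnn ltnNge leqnSn /= subSnn.
- by rewrite ltnn subnn ltnNge leqnSn /= subSnn.
- move: l1 l2; rewrite -!val_eqE /=; case: ltnP => // ul l1 l2.
  have : (size u < l)%N by rewrite ltn_neqAle eq_sym l1.
  move=> ul1; have {}ul1 : ((size u).+1 < l)%N by rewrite ltn_neqAle eq_sym l2.
  by rewrite -(subnSK (ltnW ul1)) -(subnSK ul1).
Qed.

Let f_nseq i x : f i (nseq i x) = vsval (phi i (fun=> vsproj T (orthproj T x))).
Proof. by congr (vsval (phi _ _)); apply/funext => l; rewrite nth_nseq ltn_ord. Qed.

Let f_nseqZ i t x : (i <= k)%N -> f i (nseq i (t *: x)) = t ^+ i *: f i (nseq i x).
Proof.
move=> ik; rewrite !(mlin_expand (f_linear ik)) ?size_nseq //.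
exact: mlin_nseqZ.
Qed.

Let vsval_P x : vsval (P (vsproj T (orthproj T x))) = \sum_(i < k.+1) f i (nseq i x).
Proof. by rewrite P_sum linear_sum; apply: eq_bigr => i _; rewrite f_nseq. Qed.

Let f0 s : f 0 s = 0.
Proof.
have : vsval (P (vsproj T (orthproj T 0))) = 0 by rewrite !linear0 P0 linear0.
rewrite vsval_P big_ord_recl big1 ?addr0 => [H|i _].
  by rewrite -[RHS]H /f; congr (vsval (phi _ _)); apply/funext => -[].
have := @f_nseqZ (lift ord0 i) 0 0; rewrite scale0r exprS mul0r scale0r; apply.
exact: ltn_ord.
Qed.

(** Along [t *: x] the linear term is the value of [P], which is o(t) by hypothesis, minus terms of
    order t^2; divide by t. *)
Let f1 x : f 1 [:: x] = 0.
Proof.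
have sumP t : t *: f 1 [:: x] = vsval (P (vsproj T (orthproj T (t *: x)))) -
    \sum_(i < k.-1) t ^+ i.+2 *: f i.+2 (nseq i.+2 x).
  rewrite vsval_P big_ord_recl f0 add0r.
  case: (k) k1 f_nseqZ => // k' _ fZ; rewrite big_ord_recl /= (fZ 1%N) // expr1.
  rewrite -addrA -sumrB big1 ?addr0 // => i _.
  by rewrite -(fZ i.+2) ?subrr //; exact: ltn_ord.
pose S := \sum_(i < k.-1) `|f i.+2 (nseq i.+2 x)|.
have S0 : 0 <= S by exact: sumr_ge0.
pose X := enorm (orthproj T x); have X0 : 0 <= X by exact: enorm_ge0.
apply/eqP; rewrite -normr_le0; apply: (@le0_of_small _ _ (X + 1) 1 ltr01) => e /andP[e0 _].
have [d d0 Hd] := P'0 e0.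
have S1 : 0 < S + 1 by rewrite ltr_wpDl.
have X1 : 0 < X + 1 by rewrite ltr_wpDl.
pose t := Num.min 1 (Num.min (e / (S + 1)) (d / (X + 1))).
have t0 : 0 < t by rewrite !lt_min ltr01 !divr_gt0.
have /and3P[t1 te td] : [&& t <= 1, t <= e / (S + 1) & t <= d / (X + 1)].
  by rewrite !ge_min !lexx !orbT.
have tX : enorm (vsval (vsproj T (orthproj T (t *: x)))) = t * X.
  by rewrite vsprojK ?orthproj_mem // linearZ enormZ // ltW.
have Pt : `|vsval (P (vsproj T (orthproj T (t *: x))))| <= e * (t * X).
  apply: le_trans (le_norm_enorm _) _; rewrite -tX -[P _]subr0 -P0; apply: Hd.
  rewrite tX; apply: (@le_trans _ _ (t * (X + 1))); first by rewrite ler_pM2l // lerDl.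
  by rewrite -ler_pdivlMr.
rewrite -(ler_pM2l t0) -{1}[t]gtr0_norm // -normrZ sumP.
apply: le_trans (ler_normB _ _) _.
have -> : t * ((X + 1) * e) = e * (t * X) + t * e by ring.
apply: lerD => //; apply: le_trans (ler_norm_sum _ _ _) _.
apply: (@le_trans _ _ (t * (t * S))).
  rewrite !mulr_sumr; apply: ler_sum => i _; rewrite normrZ mulrA.
  apply: ler_wpM2r => //; rewrite ger0_norm ?exprn_ge0 ?(ltW t0) //.
  rewrite -expr2; apply: ler_wiXn2l; rewrite ?(ltW t0) //.
rewrite ler_pM2l //; apply: (@le_trans _ _ (t * (S + 1))); first by rewrite ler_pM2l // lerDl.
by rewrite -ler_pdivlMr.
Qed.

Lemma par_of_poly_aux : exists c : 'rV[R]_#|{: {bseq k of 'I_n} * 'I_n}|,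
  [/\ graph_par (\dim T) c, tan_mx c = proj_mx T & forall z, pev c z = defect P z].
Proof.
have [oC oP trP] := orthproj_spec T.
(* The normal projection occupies degree 1, where [P] contributes nothing by [f1]; the higher
   degrees carry [P] with a minus sign. *)
pose C (w : seq 'I_n) : E := if (size w < 2)%N then
  (if w is [:: a] then row a (1%:M - proj_mx T) else 0) else
  - f (size w) [seq delta_mx 0 a | a <- w].
pose c : 'rV[R]_#|{: {bseq k of 'I_n} * 'I_n}| := par C.
have linc : lin_mx c = 1%:M - proj_mx T.
  by apply/row_matrixP => a; rewrite row_lin_mx coef_par.
have tanc : tan_mx c = proj_mx T by rewrite /tan_mx linc subKr.
have pevc z : pev c z = defect P z.
  rewrite /defect vsval_P.
  have -> : z *m (1%:M - proj_mx T) = \sum_(i < k.+1) (i == 1%N :> nat)%:R *: (z *m (1%:M - proj_mx T)).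
    have k1' : (1 < k.+1)%N by [].
    rewrite (bigD1 (Ordinal k1')) //= scale1r big1 ?addr0 // => i.
    by rewrite -val_eqE /= => /negbTE ->; rewrite scale0r.
  rewrite -sumrB; apply: eq_bigr => -[i ik] _ /=.
  case: i ik => [|[|i]] ik.
  - by rewrite scale0r f0 subrr /= coef_par.
  - rewrite scale1r f1 subr0 /= mulmx_sum_row; apply: eq_bigr => a _.
    by rewrite coef_par.
  - rewrite scale0r sub0r (mlin_expand (f_linear _)) ?size_nseq //.
    rewrite -scaleN1r -mlinZ; apply: eq_mlin => w; rewrite size_nseq => wi.
    by rewrite coef_par ?wi // /C wi /= scaleN1r.
exists c; split => //; split; rewrite ?tanc //.
- by rewrite coef_par.
- move=> u a b w; have [wk|wk] := leqP (size (u ++ [:: a, b & w])) k; last first.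
    rewrite !coef_big //; move: wk; rewrite !size_cat //.
  rewrite !coef_par //; last by move: wk; rewrite !size_cat.
  have sE : size (u ++ [:: b, a & w]) = size (u ++ [:: a, b & w]) by rewrite !size_cat.
  have s2 : (size (u ++ [:: a, b & w]) < 2)%N = false by rewrite size_cat /= !addnS.
  rewrite /C sE s2 !map_cat /=; congr (- _); apply: f_swap => //.
  by rewrite !size_cat /= !size_map.
- move=> z; rewrite pevc mulmxBl -mulmxA mulmxBl mul1mx oP.1 subrr mulmx0 sub0r.
  by rewrite mul_orthproj orthproj_orthc0 ?oppr0 // subvsP.
- move=> z; have Pi0 : proj_mx T *m (1%:M - proj_mx T) = 0.
    by rewrite mulmxBr mulmx1 oP.1 subrr.
  rewrite !pevc linc /defect -(mulmxA z) Pi0 mulmx0 sub0r.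
  by rewrite /proj_mx mul_orthproj (orthproj_id (orthproj_mem T z)).
Qed.

End PolyToPar.

Lemma par_of_poly k T (P : subvs_of T -> subvs_of (orthc T)) : (1 <= k)%N ->
  poly_fun k P -> P 0 = 0 -> diff0_eq0 P ->
  exists c : 'rV[R]_#|{: {bseq k of 'I_n} * 'I_n}|,
  [/\ graph_par (\dim T) c, tan_mx c = proj_mx T & forall z, pev c z = defect P z].
Proof. by move=> k1 [phi [sphi Pphi]] P0 P'0; apply: par_of_poly_aux sphi Pphi P0 P'0. Qed.

Lemma enum_ord_split j (i : 'I_j) : exists s1 s2,
  enum 'I_j = s1 ++ i :: s2 /\ (i \notin s1) && (i \notin s2).
Proof.
have : i \in enum 'I_j by rewrite mem_enum.
have := enum_uniq 'I_j; move: (enum 'I_j) => s + si; case/splitPr: s / si => s1 s2.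
rewrite cat_uniq /= negb_or => /and3P[_ /andP[i1 _] /andP[i2 _]].
by exists s1, s2; rewrite i1 i2.
Qed.

Lemma poly_of_par k m T (c : 'rV[R]_#|{: {bseq k of 'I_n} * 'I_n}|) : (1 <= k)%N ->
  graph_par m c -> tan_mx c = proj_mx T ->
  exists P : subvs_of T -> subvs_of (orthc T),
    [/\ poly_fun k P, P 0 = 0, diff0_eq0 P & forall z, pev c z = defect P z].
Proof.
move=> k1 gc tanc; have [oC oP trP] := orthproj_spec T.
have linc : lin_mx c = 1%:M - proj_mx T by rewrite -tanc subKr.
(* On the plane the linear part of the defect vanishes, so the defect is minus the polynomial and
   takes values in the complement. *)
pose P (x : subvs_of T) : subvs_of (orthc T) := vsproj (orthc T) (- pev c (vsval x)).
have linT (x : subvs_of T) : vsval x *m lin_mx c = 0.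
  by rewrite linc mulmxBr mulmx1 mul_orthproj orthproj_id ?subvsP // subrr.
have PE (x : subvs_of T) : vsval (P x) = - pev c (vsval x).
  rewrite vsprojK //; have := oC (- pev c (vsval x)).
  rewrite -mul_orthproj mulNmx -/(proj_mx T) -tanc (graph_par_normal gc) oppr0 subr0 //.
have pev0 : pev c 0 = 0.
  rewrite /pev big1 // => -[[|i] ik] _ /=; first exact: graph_par_nil gc.
  by rewrite -[RHS](mlin_cat0 (coef c) [::] i).
exists P; split.
- pose phi i (v : 'I_i -> subvs_of T) : subvs_of (orthc T) :=
    vsproj (orthc T) (- mlin (coef c) [seq vsval (v l) | l <- enum 'I_i]).
  exists phi; split=> [i ik|x].
    split=> [p v a u u'|s v].
      have [s1 [s2 [eqs /andP[p1 p2]]]] := enum_ord_split p.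
      have mapE (x : subvs_of T) : [seq vsval (if l == p then x else v l) | l <- enum 'I_i] =
          [seq vsval (v l) | l <- s1] ++ vsval x :: [seq vsval (v l) | l <- s2].
        rewrite eqs map_cat /= eqxx; congr (_ ++ _ :: _); apply/eq_in_map => l ls.
          by case: eqP => // lp; rewrite -lp ls in p1.
        by case: eqP => // lp; rewrite -lp ls in p2.
      rewrite /phi !mapE linearP /= mlin_linear opprD -scalerN linearP //.
    rewrite /phi; congr (vsproj _ (- _)); apply: mlin_perm; first exact: graph_par_sym gc.
    have -> : [seq vsval ((v \o s) l) | l <- enum 'I_i] =
        [seq vsval (v l) | l <- [seq s l | l <- enum 'I_i]].
      by rewrite -[RHS]map_comp.
    apply: perm_map; apply: uniq_perm; rewrite ?enum_uniq //.
      by rewrite map_inj_uniq ?enum_uniq //; exact: perm_inj.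
    move=> l; rewrite mem_enum; apply/mapP; exists ((s^-1)%g l); rewrite ?mem_enum //.
    by rewrite permKV.
  rewrite /P /pev -sumrN linear_sum; apply: eq_bigr => i _.
  rewrite /phi; congr (vsproj _ (- mlin _ _)).
  transitivity [seq vsval x | _ <- enum 'I_i]; last by [].
  rewrite -[in nseq i _](size_enum_ord i); by elim: (enum _) => //= _ s ->.
- by rewrite /P linear0 pev0 oppr0 linear0.
- move=> e e0; have [M M0 [_ HM]] := pev_linear_part k1 (graph_par_nil gc).
  have N1 : 0 < n%:R * M + 1 by rewrite ltr_wpDl // mulr_ge0.
  exists (Num.min 1 (e / (n%:R * M + 1))); first by rewrite lt_min ltr01 divr_gt0.
  move=> x; rewrite le_min => /andP[x1 xe].
  have P00 : P 0 = 0 by rewrite /P linear0 pev0 oppr0 linear0.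
  rewrite P00 subr0 PE; apply: le_trans (enorm_le_norm _) _; rewrite normrN.
  have xx : `|vsval x| <= enorm (vsval x) by exact: le_norm_enorm.
  have := HM (vsval x) (le_trans xx x1); rewrite linT subr0 => HMx.
  apply: (@le_trans _ _ (n%:R * (M * enorm (vsval x) ^+ 2))).
    apply: ler_wpM2l => //; apply: le_trans HMx _; apply: ler_wpM2l => //.
    by rewrite lerXn2r ?nnegrE ?enorm_ge0.
  rewrite expr2 !mulrA; apply: ler_wpM2r; first exact: enorm_ge0.
  apply: (@le_trans _ _ ((n%:R * M + 1) * enorm (vsval x))).
    by apply: ler_wpM2r; [exact: enorm_ge0|rewrite lerDl].
  by rewrite mulrC -ler_pdivlMr.
- move=> z; rewrite /defect PE opprK vsprojK ?orthproj_mem // -mul_orthproj -/(proj_mx T).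
  by rewrite (graph_par_base gc z) linc tanc.
Qed.

End PolynomialParameters.

(** * Equivalence with the Euclidean conditions on cylinders and distances *)

Section Conversion.
Context {R : realType} {n : nat}.
Local Notation E := 'rV[R]_n.
Hypothesis n1 : (1 <= n)%N.
Variables (m : nat) (A : set E).
Implicit Types (T : {vspace E}) (a x y z : E).

Let N : R := n%:R.
Let N1 : 1 <= N. Proof. by rewrite ler1n. Qed.
Let N0 : 0 < N. Proof. exact: lt_le_trans N1. Qed.

Lemma ap_densityP T a : (1 <= m)%N ->
  ap_density (translate A a) m T <-> dense_at m A a (proj_mx T).
Proof.
have [_ oP _] := orthproj_spec T.
move=> m1; split=> [H e e0|H e e0].
  (* The tangential and normal displacements add up, hence 2; a sup-norm radius [r] is a Euclidean
     radius at most [N * r], hence [N]. *)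
  have e10 : 0 < e / (2 * N) by rewrite divr_gt0 // mulr_gt0.
  have [rho [eta [rho0 eta0 D]]] := H _ e10.
  exists (rho / N), (eta * N ^+ m); split; rewrite ?divr_gt0 ?mulr_gt0 ?exprn_gt0 //.
  move=> r z /andP[r0 rr] zP zr.
  have zT : z \in T by rewrite -zP mul_orthproj orthproj_mem.
  have Nr : 0 <= N * r <= rho.
    by rewrite mulr_ge0 ?(ltW r0) ?(ltW N0) //= mulrC -ler_pdivlMr.
  have zB : ecball 0 (N * r) z.
    rewrite /ecball /= subr0; apply: le_trans (enorm_le_norm _) _.
    by rewrite ler_pM2l.
  have HD := D _ _ Nr zT zB; rewrite exprMn (mulrA eta) in HD.
  apply: le_trans HD _.
  rewrite setIC; apply: subset_nu => y [y1 y2] /=.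
  have -> : y - z = orthproj T (y - z) + orthproj (orthc T) (y - z).
    by rewrite orthprojC [RHS]addrC subrK.
  apply: le_lt_trans (ler_normD _ _) _.
  have -> : e * r = e / (2 * N) * (N * r) + e / (2 * N) * (N * r).
    by field; rewrite gt_eqF.
  by apply: ltrD; [apply: le_lt_trans y1|apply: le_lt_trans y2]; exact: le_norm_enorm.
have N10 : 0 < N * (N + 1) by rewrite mulr_gt0 // ltr_wpDl // ltW.
have [rho [eta [rho0 eta0 D]]] := H _ (divr_gt0 e0 N10).
(* Radius 0, which [dens] excludes, asks only for a nonnegative measure because [m] is positive. *)
exists rho, eta; split => // r z /andP[]; rewrite le_eqVlt => /orP[/eqP <- _ _ _|r0 rr zT zB].
  by rewrite expr0n gtn_eqF // mulr0 hausdorff_ge0.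
have zP : z *m proj_mx T = z by rewrite mul_orthproj orthproj_id.
have zr : `|z| <= r.
  by apply: le_trans (le_norm_enorm _) _; move: zB; rewrite /ecball /= subr0.
have r01 : 0 < r <= rho by rewrite r0.
apply: le_trans (D r z r01 zP zr) _; rewrite setIC; apply: le_hausdorff => y [/= yz Ay].
split=> //; have pr : `|orthproj T (y - z)| <= N * `|y - z|.
  by rewrite -mul_orthproj; exact: norm_mul_proj.
have eE : e * r = N * ((N + 1) * (e / (N * (N + 1)) * r)).
  by field; rewrite !gt_eqF // ltr_wpDl // ltW.
have N10' : 0 < N + 1 by rewrite ltr_wpDl // ltW.
split; apply: le_lt_trans (enorm_le_norm _) _; rewrite eE ltr_pM2l //.
  apply: (@le_lt_trans _ _ ((N + 1) * `|y - z|)); last by rewrite ltr_pM2l.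
  by apply: le_trans pr _; apply: ler_wpM2r => //; rewrite lerDl.
rewrite orthprojC; apply: (@le_lt_trans _ _ ((N + 1) * `|y - z|)); last by rewrite ltr_pM2l.
by apply: le_trans (ler_normB _ _) _; rewrite mulrDl mul1r addrC lerD2r.
Qed.

Lemma cvg_ratioP (f : R -> \bar R) (c : R) : 0 < c -> (forall r, (0 <= f r)%E) ->
  ((fun r => (f r / (c%:E * (r ^+ m)%:E))%E) @ 0^'+ --> 0%E) <->
  forall eta, 0 < eta -> exists2 rho, 0 < rho &
    forall r, 0 < r <= rho -> (f r <= (eta * r ^+ m)%:E)%E.
Proof.
move=> c0 f0.
have leE r eta : 0 < r -> (f r / (c%:E * (r ^+ m)%:E) <= eta%:E)%E = (f r <= (eta * c * r ^+ m)%:E)%E.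
  move=> r0; have cr : 0 < c * r ^+ m by rewrite mulr_gt0 // exprn_gt0.
  by rewrite -EFinM inver gt_eqF // lee_pdivrMr // -EFinM mulrA.
have g0 r : 0 < r -> (0 <= f r / (c%:E * (r ^+ m)%:E))%E.
  move=> r0; have cr : 0 < c * r ^+ m by rewrite mulr_gt0 // exprn_gt0.
  by rewrite -EFinM inver gt_eqF // mule_ge0 // lee_fin invr_ge0 ltW.
split=> [/fine_cvgP[fing /cvgrPdist_le cg] eta eta0|H].
  have e0 : 0 < eta / c by rewrite divr_gt0.
  have /near_right0P[rho rho0 Hr] : \forall r \near 0^'+,
      (f r / (c%:E * (r ^+ m)%:E) <= (eta / c)%:E)%E.
    near=> r; have fr : (f r / (c%:E * (r ^+ m)%:E))%E \is a fin_num by near: r.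
    rewrite -(fineK fr) lee_fin; apply: le_trans (ler_norm _) _.
    by rewrite -normrN -sub0r; near: r; exact: cg.
  exists rho => // r r01; have /andP[r0 _] := r01.
  by have := Hr r r01; rewrite leE // divfK ?gt_eqF.
have leg e : 0 < e -> \forall r \near 0^'+, 0 < r /\ (f r / (c%:E * (r ^+ m)%:E) <= e%:E)%E.
  move=> e0; have [rho rho0 Hr] := H (e * c) (mulr_gt0 e0 c0).
  apply/near_right0P; exists rho => // r r01; have /andP[r0 _] := r01.
  by split=> //; rewrite leE //; exact: Hr.
apply/fine_cvgP; split.
  apply: filterS (leg 1 ltr01) => r [r0 r1].
  by rewrite ge0_fin_numE ?g0 // (le_lt_trans r1) // ltry.
apply/cvgrPdist_le => e e0; apply: filterS (leg e e0) => r [r0 re] /=.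
have fr : (f r / (c%:E * (r ^+ m)%:E))%E \is a fin_num.
  by rewrite ge0_fin_numE ?g0 // (le_lt_trans re) // ltry.
rewrite sub0r normrN ger0_norm ?fine_ge0 ?g0 //.
by rewrite -lee_fin fineK.
Unshelve. all: by end_near. Qed.

Section CloseToGraph.
Variables (Gam : set E) (G : E -> E) (L c : R).
Hypotheses (c0 : 0 < c) (ubv : unit_ball_vol m = c%:E) (L0 : 0 <= L).
Hypotheses (GamG : forall z, Gam (z - G z)) (G0 : forall b, Gam b -> G b = 0).
Hypothesis GL : forall x y, `|x| <= 3 -> `|y| <= 3 -> `|G x - G y| <= L * `|x - y|.
Variable a : E.
Implicit Types s : R -> R.

Let far s r := translate A a `&` ecball 0 r `&` [set z | s r < eucl_dist Gam z].

Lemma ap_negligibleP s : ap_negligible (translate A a) Gam m s <->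
  forall eta, 0 < eta -> exists2 rho, 0 < rho &
    forall r, 0 < r <= rho -> (hausdorff m (far s r) <= (eta * r ^+ m)%:E)%E.
Proof.
rewrite /ap_negligible ubv.
exact: (cvg_ratioP (f := fun r => hausdorff m (far s r)) c0 (fun r => hausdorff_ge0 _ _)).
Qed.

Lemma le_ap_negligible s s' : (forall r, 0 < r -> s r <= s' r) ->
  ap_negligible (translate A a) Gam m s -> ap_negligible (translate A a) Gam m s'.
Proof.
move=> ss /ap_negligibleP H; apply/ap_negligibleP => eta eta0.
have [rho rho0 Hr] := H eta eta0; exists rho => // r r01; have /andP[r0 _] := r01.
apply: le_trans (Hr r r01); apply: le_hausdorff => z [z1 z2]; split=> //=.
exact: le_lt_trans (ss r r0) z2.
Qed.

(** The point [z - G z] of the graph is at distance [enorm (G z)] from [z], so being far from the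
    graph forces a large defect. *)
Lemma close_at_negligible s lam b : (forall r, 0 < r -> lam * r `^ b <= s r) ->
  close_at m A a G (lam / N) b -> ap_negligible (translate A a) Gam m s.
Proof.
move=> ss H; apply: (le_ap_negligible ss); apply/ap_negligibleP => eta eta0.
have [rho rho0 Hr] := H eta eta0; exists rho => // r r01; have /andP[r0 _] := r01.
apply: le_trans (Hr r r01); rewrite /far -setIA; apply: subset_nu => z [/= zr zd]; split.
  by apply: le_trans (le_norm_enorm _) _; move: zr; rewrite /ecball /= subr0.
rewrite mulrAC ltr_pdivrMr // [ltRHS]mulrC; apply: lt_le_trans (enorm_le_norm _).
apply: lt_le_trans zd _.
apply: ge_inf; first by exists 0 => _ [b' _ <-]; exact: enorm_ge0.
by exists (z - G z) => //; rewrite subKr.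
Qed.

(** [G] vanishes on the graph and is Lipschitz, so a point near the graph has a small defect. The
    factor 2 pays for an almost nearest point, the power of [N] for the Euclidean ball of radius
    [N * r] containing the sup-norm ball of radius [r]. *)
Lemma negligible_close_at s lam b : 0 < lam -> 1 <= b ->
  (forall r, 0 < r -> s r <= lam * r `^ b) ->
  ap_negligible (translate A a) Gam m s ->
  close_at m A a G (2 * L * N `^ b * lam) b.
Proof.
move=> lam0 b1 ss Hs.
have /ap_negligibleP H := le_ap_negligible (s' := fun r => lam * r `^ b) ss Hs.
move=> eta eta0; have eta0' : 0 < eta / N ^+ m by rewrite divr_gt0 // exprn_gt0.
have [rho rho0 Hr] := H _ eta0'.
pose rho1 := Num.min (rho / N) (Num.min (N^-1) (lam^-1 / N)).
exists rho1; first by rewrite !lt_min; apply/and3P; split; rewrite ?divr_gt0 ?invr_gt0.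
move=> r /andP[r0]; rewrite !le_min => /andP[rr /andP[rN rl]].
have Nr0 : 0 < N * r by rewrite mulr_gt0.
have Nr : 0 < N * r <= rho by rewrite Nr0 /= mulrC -ler_pdivlMr.
have Nr1 : N * r <= 1 by rewrite mulrC -ler_pdivlMr // div1r.
have Nrl : lam * (N * r) <= 1.
  by rewrite mulrC -ler_pdivlMr // mulrC -ler_pdivlMr // div1r.
have := Hr _ Nr; rewrite exprMn mulrA divfK ?gt_eqF ?exprn_gt0 //.
apply: le_trans; rewrite /far -setIA; apply: subset_nu => y [/= yr Gy]; split.
  by rewrite /ecball /= subr0; apply: le_trans (enorm_le_norm _) _; rewrite ler_pM2l.
rewrite /= ltNge; apply/negP => yd; move: Gy; apply/negP; rewrite -leNgt.
set t := lam * (N * r) `^ b in yd.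
have t0 : 0 < t by rewrite mulr_gt0 // powR_gt0.
have t1 : t <= 1.
  apply: le_trans Nrl; rewrite ler_pM2l // -[leRHS]powRr1 ?(ltW Nr0) //.
  by apply: ger_powR => //; rewrite Nr0.
have hinf : has_inf [set enorm (y - b0) | b0 in Gam].
  split; first by exists (enorm (y - (y - G y))), (y - G y).
  by exists 0 => _ [b' _ <-]; exact: enorm_ge0.
have [_ [b' Gb' <-] yb'] := inf_adherent t0 hinf.
have yb : `|y - b'| <= 2 * t.
  apply: le_trans (le_norm_enorm _) _; apply: le_trans (ltW yb') _.
  by rewrite mulr_natl mulr2n lerD2r.
have y1 : `|y| <= 1.
  by apply: le_trans yr _; apply: le_trans Nr1; rewrite ler_peMl // ltW.
have y3 : `|y| <= 3 by rewrite (le_trans y1) // ler1n.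
(* Origin of the radius 3 in the Lipschitz hypothesis: 1 for [y] plus [2 * t] with [t] at most 1. *)
have b3 : `|b'| <= 3.
  rewrite -[b'](subKr y); apply: le_trans (ler_normB _ _) _.
  have : 2 * t <= 2 by rewrite ler_piMr.
  lra.
rewrite -[G y]subr0 -(G0 Gb'); apply: le_trans (GL y3 b3) _.
apply: (@le_trans _ _ (L * (2 * t))); first exact: ler_wpM2l.
rewrite /t powRM ?(ltW r0) ?(ltW N0) // le_eqVlt; apply/orP; left; apply/eqP; ring.
Qed.

Lemma ap_closeP k al : (1 <= k)%N -> 0 <= al ->
  ap_close (translate A a) Gam m k al <->
  (forall s : R, 0 < s -> close_at m A a G s k%:R) /\
  (0 < al -> exists2 lam, 0 <= lam & close_at m A a G lam (k%:R + al)).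
Proof.
move=> k1 al0; have k1' : 1 <= k%:R :> R by rewrite ler1n.
have kal : 1 <= k%:R + al by rewrite (le_trans k1') // lerDl.
split=> [[H1 H2]|[H1 H2]]; split.
- move=> s s0; pose C := 2 * L * N `^ k%:R.
  have C0 : 0 <= C by rewrite mulr_ge0 ?powR_ge0 // mulr_ge0.
  have C1 : 0 < C + 1 by rewrite ltr_wpDl.
  have e0 : 0 < s / (C + 1) by rewrite divr_gt0.
  apply: (@close_at_le _ _ _ _ _ _ (C * (s / (C + 1)))); last first.
    by rewrite mulrA ler_pdivrMr // mulrC ler_pM2l // lerDl.
  apply: (negligible_close_at e0 k1' _ (H1 _ e0)) => r r0.
  by rewrite powR_mulrn // ltW.
- move=> /H2[lam lam0 Hl]; exists (2 * L * N `^ (k%:R + al) * (lam + 1)).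
    by rewrite mulr_ge0 ?addr_ge0 // mulr_ge0 ?powR_ge0 // mulr_ge0.
  apply: (negligible_close_at _ kal _ Hl); first by rewrite ltr_wpDl.
  by move=> r r0; apply: ler_wpM2r; [exact: powR_ge0|rewrite lerDl].
- move=> e e0; apply: (@close_at_negligible _ e k%:R); last exact/H1/divr_gt0.
  by move=> r r0; rewrite powR_mulrn // ltW.
- move=> /H2[lam lam0 Hl]; exists (lam * N); first by rewrite mulr_ge0 // ltW.
  apply: (@close_at_negligible _ (lam * N) (k%:R + al)) => //.
  by rewrite mulfK // gt_eqF.
Qed.

End CloseToGraph.

End Conversion.

(** * Positivity of the volume of the unit ball *)

Section SmallCovers.
Context {R : realType} {n : nat}.
Local Notation E := 'rV[R]_n.

Lemma ediam_le_norm (S : set E) (d : R) : 0 <= d ->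
  (forall x y, S x -> S y -> n%:R * `|x - y| <= d) -> (ediam S <= d%:E)%E.
Proof.
move=> d0 H; apply: ge_ereal_sup => _ [[x y] [/= Sx Sy] <-].
by rewrite lee_fin; apply: le_trans (enorm_le_norm _) (H x y Sx Sy).
Qed.

(** The pieces are the cells of a grid of side [t^-1], numbered by encoding the vector of integer
    parts. *)
Lemma small_cover (d : R) : 0 < d ->
  exists S : nat -> set E, (forall i, (ediam (S i) <= d%:E)%E) /\ \bigcup_i S i = setT.
Proof.
move=> d0; pose t := (n%:R + 1) / d; have N1 : 0 < n%:R + 1 :> R by rewrite ltr_wpDl.
have t0 : 0 < t by rewrite divr_gt0.
pose fl (x : E) : {ffun 'I_n -> int} := [ffun l => Num.floor (t * x 0 l)].
exists (fun i => [set x | pickle (fl x) = i]); split=> [i|]; last first.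
  by apply/seteqP; split=> // x _; exists (pickle (fl x)).
apply: ediam_le_norm => [|x y /= xi yi]; first exact: ltW.
have flE : fl x = fl y by apply: (pcan_inj (@pickleK _)); rewrite /= xi yi.
apply: (@le_trans _ _ (n%:R * t^-1)); last first.
  by rewrite invf_div mulrCA ler_piMr ?(ltW d0) // ler_pdivrMr // mul1r lerDl.
apply: ler_wpM2l => //; rewrite [leLHS]/Num.norm /= mx_normrE.
apply/bigmax_leP; split; first by rewrite invr_ge0 ltW.
move=> [p l] _ /=; rewrite ord1 !mxE -(ler_pM2l t0) divff ?gt_eqF //.
rewrite -{1}(gtr0_norm t0) -normrM mulrBr.
have := ffunE (fun l => Num.floor (t * x 0 l)) l; rewrite -/(fl x) flE ffunE => fE.
have /andP[x1 x2] := floor_itv (t * x 0 l); have /andP[y1 y2] := floor_itv (t * y 0 l).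
rewrite fE intrD in y1 y2; rewrite intrD in x2.
by rewrite ler_norml; apply/andP; split; lra.
Qed.

Lemma hausdorff_vol0 m (S : set E) : unit_ball_vol m = 0%E :> \bar R -> hausdorff m S = 0%E.
Proof.
move=> v0; apply/eqP; rewrite eq_le hausdorff_ge0 andbT.
apply: ge_ereal_sup => _ [d /= d0 <-]; have [C [dC CT]] := small_cover d0.
apply: ereal_inf_lbound; exists C; split=> //; first by rewrite CT.
by rewrite eseries0 // => i _ _; rewrite v0 !mul0e.
Qed.

(** With volume 0 every term of every cover would be 0, contradicting positive density at the
    origin. *)
Lemma ap_density_vol m (S : set E) (T : {vspace E}) : ap_density S m T ->
  (0 < unit_ball_vol m :> \bar R)%E.
Proof.
move=> D; rewrite lt_neqAle unit_ball_vol_ge0 andbT eq_sym.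
apply/negP => /eqP v0; have [rho [eta [rho0 eta0 H]]] := D 1 ltr01.
have zB : ecball 0 rho (0 : E).
  by apply: le_trans (enorm_le_norm _) _; rewrite subrr normr0 mulr0 ltW.
have := H rho 0 _ (mem0v T) zB; rewrite lexx ltW // => /(_ isT).
by rewrite hausdorff_vol0 // lee_fin leNgt mulr_gt0 // exprn_gt0.
Qed.

End SmallCovers.

(** * Jets of the set and the Borel maps *)

Section Jets.
Context {R : realType} {n : nat}.
Local Notation E := 'rV[R]_n.
Local Notation Par k := 'rV[R]_#|{: {bseq k of 'I_n} * 'I_n}|.
Hypothesis n1 : (1 <= n)%N.
Variable A : set E.
Implicit Types (T : {vspace E}) (a z : E).

Lemma graph_sub_defect T (P : subvs_of T -> subvs_of (orthc T)) z : graph P (z - defect P z).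
Proof.
exists (vsproj T (orthproj T z)) => //; rewrite vsprojK ?orthproj_mem //.
by rewrite /defect mulmxBr mulmx1 mul_orthproj !opprB addrA addrC addrA subrK addrC.
Qed.

Lemma defect_graph T (P : subvs_of T -> subvs_of (orthc T)) b : graph P b -> defect P b = 0.
Proof.
move=> [x _ <-]; have xE : orthproj T (vsval x + vsval (P x)) = vsval x.
  by apply: orthproj_eq; rewrite ?subvsP // addrAC subrr add0r subvsP.
by rewrite /defect mulmxBr mulmx1 mul_orthproj xE vsvalK [vsval x + _]addrC addrK subrr.
Qed.

Lemma ap_close_graphP T (P : subvs_of T -> subvs_of (orthc T)) m L a k al :
  (0 < unit_ball_vol m :> \bar R)%E -> 0 <= L ->
  (forall x y, `|x| <= 3 -> `|y| <= 3 -> `|defect P x - defect P y| <= L * `|x - y|) ->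
  (1 <= k)%N -> 0 <= al ->
  ap_close (translate A a) (graph P) m k al <->
  (forall s, 0 < s -> close_at m A a (defect P) s k%:R) /\
  (0 < al -> exists2 lam, 0 <= lam & close_at m A a (defect P) lam (k%:R + al)).
Proof.
move=> v0 L0 PL k1 al0; have := unit_ball_vol_fin (R := R) m; move: v0.
case vE : (unit_ball_vol m) => [c| |] // c0 _; rewrite lte_fin in c0.
exact: (ap_closeP n1 A c0 vE L0 (graph_sub_defect P) (@defect_graph _ P) PL a k1 al0).
Qed.

Lemma ap_jetP k T (P : subvs_of T -> subvs_of (orthc T)) m (c : Par k) a al :
  (1 <= k)%N -> (1 <= m)%N -> 0 <= al -> (0 < unit_ball_vol m :> \bar R)%E ->
  tan_mx c = proj_mx T -> (forall z, pev c z = defect P z) ->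
  (ap_density (translate A a) m T /\ ap_close (translate A a) (graph P) m k al) <->
  jet m A al a c.
Proof.
move=> k1 m1 al0 v0 cT cP; have pE : pev c = defect P by exact/funext.
have [L L0 HL] := pev_lip (R := R) (n := n) (k := k) (B := 3) (ler0n _ _).
have PL x y : `|x| <= 3 -> `|y| <= 3 -> `|defect P x - defect P y| <= L * `|c| * `|x - y|.
  by move=> x3 y3; rewrite -pE; exact: HL.
have cl := ap_close_graphP a v0 (mulr_ge0 L0 (normr_ge0 c)) PL k1 al0.
have de := ap_densityP n1 A T a m1; rewrite /jet pE cT.
split=> [[/de D /cl[]]|[D C1 C2]]; first by split.
by split; [exact/de|exact/cl].
Qed.

Lemma tan_atP T m a : (1 <= m)%N -> (0 < unit_ball_vol m :> \bar R)%E -> \dim T = m ->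
  (ap_density (translate A a) m T /\
   ap_close (translate A a) (graph (fun _ : subvs_of T => 0 : subvs_of (orthc T))) m 1 0) <->
  tan_at A m a (proj_mx T).
Proof.
move=> m1 v0 dT; have [_ oP trP] := orthproj_spec T.
pose P0 : subvs_of T -> subvs_of (orthc T) := fun=> 0.
have dE : defect P0 = fun z => z *m (1%:M - proj_mx T).
  by apply/funext => z; rewrite /defect (_ : vsval _ = 0) ?subr0 //; exact: linear0.
have PL x y : `|x| <= 3 -> `|y| <= 3 -> `|defect P0 x - defect P0 y| <= (n%:R + 1) * `|x - y|.
  move=> _ _; rewrite dE -mulmxBl mulmxBr mulmx1; apply: le_trans (ler_normB _ _) _.
  by rewrite mulrDl mul1r addrC lerD2r; exact: norm_mul_proj.
have cl := ap_close_graphP a v0 (addr_ge0 (ler0n _ n) ler01) PL (leqnn 1) (lexx 0).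
have de := ap_densityP n1 A T a m1; rewrite dE in cl.
split=> [[/de D /cl[C _]]|[_ _ /de D C]].
  by split; rewrite // -dT.
by split=> //; apply/cl; split=> //; rewrite ltxx.
Qed.

Definition is_jet k al a m (c : Par k) := [/\ (1 <= m <= n)%N,
  (0 < unit_ball_vol m :> \bar R)%E, graph_par m c & jet m A al a c].

Lemma dim_proj_mx T m : \tr (proj_mx T) = m%:R -> \dim T = m.
Proof.
by have [_ _ ->] := orthproj_spec T; move=> /eqP; rewrite eqr_nat => /eqP.
Qed.

Lemma ap_jet_is_jet k T (P : subvs_of T -> subvs_of (orthc T)) al a :
  (1 <= k)%N -> 0 <= al -> (1 <= \dim T <= n)%N -> ap_jet A a (\dim T) k al P ->
  exists c : Par k, [/\ tan_mx c = proj_mx T, forall z, pev c z = defect P z &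
    is_jet al a (\dim T) c].
Proof.
move=> k1 al0 mn [[pP P0 P'0] D C]; have [c [gc cT cP]] := par_of_poly k1 pP P0 P'0.
have v0 := ap_density_vol D; have /andP[m1 _] := mn.
by exists c; split=> //; split=> //; apply/(ap_jetP a k1 m1 al0 v0 cT cP).
Qed.

Lemma is_jet_ap_jet k T al a m (c : Par k) : (1 <= k)%N -> 0 <= al ->
  is_jet al a m c -> tan_mx c = proj_mx T -> exists P, ap_jet A a m k al P (T := T).
Proof.
move=> k1 al0 [/andP[m1 _] v0 gc jc] cT; have [P [pP P0 P'0 cP]] := poly_of_par k1 gc cT.
by have [D C] := (ap_jetP a k1 m1 al0 v0 cT cP).2 jc; exists P.
Qed.

Lemma ap_diffP k al a : (1 <= k)%N -> 0 <= al ->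
  ap_diff A k al a <-> exists m (c : Par k), is_jet al a m c.
Proof.
move=> k1 al0; split=> [[m [T [P [mn dT jP]]]]|].
  rewrite /grassmannian /= in dT; subst m.
  by have [c [_ _ jc]] := ap_jet_is_jet k1 al0 mn jP; exists (\dim T), c.
move=> [m [c jc]]; have [mn _ gc _] := jc.
have [T TE] := orthproj_of_mx (graph_par_proj gc).
have [P jP] := is_jet_ap_jet k1 al0 jc (esym TE).
by exists m, T, P; split=> //; apply: dim_proj_mx; rewrite /proj_mx TE (graph_par_tr gc).
Qed.

(** The chosen [ap_tan] satisfies its specification for some dimension; [tan_at_dim] used both ways
    identifies it with [m], then planes of equal dimension are unique. *)
Lemma ap_tan_is_jet k al a m (c : Par k) : (1 <= k)%N -> is_jet al a m c ->
  proj_mx (ap_tan A a) = tan_mx c /\ \dim (ap_tan A a) = m.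
Proof.
move=> k1 [mn v0 gc jc]; have [T TE] := orthproj_of_mx (graph_par_proj gc).
have dT : \dim T = m by apply: dim_proj_mx; rewrite /proj_mx TE (graph_par_tr gc).
have tT := jet_tan_at k1 gc jc; have /andP[m1 _] := mn.
rewrite -TE -/(proj_mx T) in tT.
have /xgetPex : exists T : {vspace E}, exists m, [/\ (1 <= m <= n)%N, grassmannian m T,
    ap_density (translate A a) m T &
    ap_close (translate A a) (graph (fun _ : subvs_of T => 0 : subvs_of (orthc T))) m 1 0].
  by exists T, m; have [D C] := (tan_atP a m1 v0 dT).2 tT.
move=> /(_ 0%VS); rewrite -/(ap_tan A a) => -[m0 [/andP[m01 _] dT0 D C]].
have v00 := ap_density_vol D; have tT0 := (tan_atP a m01 v00 dT0).1 (conj D C).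
have mE : m0 = m.
  by apply/eqP; rewrite eqn_leq (tan_at_dim n1 v0 tT tT0) (tan_at_dim n1 v00 tT0 tT).
move: mE tT0 dT0 => -> tT0 dT0; split=> //.
by rewrite (tan_at_uniq n1 tT0 tT).
Qed.

(** For fixed [m] the range and volume conditions do not depend on the point, so the set is either
    empty or the one of [borel_jet]. *)
Lemma borel_is_jet k (V : Par k -> Prop) al : (1 <= k)%N -> 0 <= al ->
  (forall c, tsym (coef c) -> V c -> exists2 d, 0 < d &
     forall c', tsym (coef c') -> `|c' - c| <= d -> V c') ->
  borel [set a | exists m (c : Par k), is_jet al a m c /\ V c].
Proof.
move=> k1 al0 Vo.
pose F m := [set a | exists c : Par k, [/\ graph_par m c, V c & jet m A al a c]].
have -> : [set a | exists m (c : Par k), is_jet al a m c /\ V c] =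
    \bigcup_m [set a | [/\ (1 <= m <= n)%N, (0 < unit_ball_vol m :> \bar R)%E & F m a]].
  apply/seteqP; split=> [a [m [c [[mn v0 gc jc] Vc]]]|a [m _ [mn v0 [c [gc Vc jc]]]]].
    by exists m => //; split=> //; exists c.
  by exists m, c.
apply: borel_bigcup => m.
have [mn|mn] := boolP (1 <= m <= n)%N; last first.
  by rewrite (_ : [set a | _] = set0); [exact: borel0|apply/seteqP; split=> // a []].
have [v0|v0] := boolP (0 < unit_ball_vol m :> \bar R)%E; last first.
  by rewrite (_ : [set a | _] = set0); [exact: borel0|apply/seteqP; split=> // a []].
rewrite (_ : [set a | _] = F m); last by apply/seteqP; split=> [a []|a].
apply: borel_jet => // c gc Vc; have [d d0 Hd] := Vo c (graph_par_sym gc) Vc.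
by exists d => // c' gc'; apply: Hd; exact: graph_par_sym gc'.
Qed.

(** The derivative of order [j] at the origin of the polynomial composed with the projection. The
    sign appears because in degrees at least 2 the defect is minus the polynomial. *)
Definition jet_diff j (c : Par j) (v : 'I_j -> E) : E :=
  - (j`!%:R *: mlin (coef c) [seq v i | i <- enum 'I_j]).

Lemma ap_D_is_jet j a m (c : Par j) : (2 <= j)%N -> is_jet 0 a m c ->
  ap_D A j a = jet_diff c.
Proof.
move=> j2 jc; have j1 := ltnW j2; have [TE dT] := ap_tan_is_jet j1 jc.
have [mn v0 gc jjc] := jc.
have [P0 jP0] := is_jet_ap_jet j1 (lexx 0) jc (esym TE).
rewrite -dT in jP0 mn.
have jP : ap_jet A a (\dim (ap_tan A a)) j 0 (ap_poly A j a).
  by apply: xgetPex; exists P0.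
have [c' [TE' cP [_ _ gc' jc']]] := ap_jet_is_jet j1 (lexx 0) mn jP.
rewrite dT in gc' jc'; have cE := jet_uniq n1 j1 gc' gc jc' jjc.
subst c'; apply/funext => v; rewrite /ap_D.
(* Normal projection minus defect: the parameter of the polynomial composed with the projection. *)
pose d := lpar (lin_mx c) - c.
have -> : (fun x => vsval (ap_poly A j a (vsproj (ap_tan A a) (orthproj (ap_tan A a) x)))) = pev d.
  apply/funext => x; rewrite pevB pev_lpar // cP /defect -TE'.
  by rewrite subKr opprB addrC subrK.
rewrite Dn_pev //; last first.
  by move=> u p q w; rewrite !coefB tsym_lpar // (graph_par_sym gc).
rewrite /jet_diff -scalerN -[- mlin _ _]scaleN1r -(mlinZ (-1)); congr (_ *: _); apply: eq_mlin => w.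
rewrite size_map size_enum_ord => wj; rewrite coefB coef_lpar // scaleN1r.
have {wj} : (1 < size w)%N by rewrite wj.
by case: w => [|? [|? ?]] //= _; rewrite sub0r.
Qed.

Lemma jet_diff_symmultilinear j (c : Par j) : tsym (coef c) ->
  symmultilinear E E j (jet_diff c).
Proof.
move=> sc; split=> [p v a u u'|s v]; rewrite /jet_diff.
  have [s1 [s2 [eqs /andP[p1 p2]]]] := enum_ord_split p.
  have mapE x : [seq (if l == p then x else v l) | l <- enum 'I_j] =
      [seq v l | l <- s1] ++ x :: [seq v l | l <- s2].
    rewrite eqs map_cat /= eqxx; congr (_ ++ _ :: _); apply/eq_in_map => l ls.
      by case: eqP => // lp; rewrite -lp ls in p1.
    by case: eqP => // lp; rewrite -lp ls in p2.
  rewrite !mapE mlin_linear scalerDr opprD; congr (_ - _).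
  by rewrite scalerN !scalerA mulrC.
congr (- (_ *: _)); apply: mlin_perm => //.
have -> : [seq (v \o s) l | l <- enum 'I_j] = [seq v l | l <- [seq s l | l <- enum 'I_j]].
  by rewrite -[RHS]map_comp.
apply: perm_map; apply: uniq_perm; rewrite ?enum_uniq //.
  by rewrite map_inj_uniq ?enum_uniq //; exact: perm_inj.
move=> l; rewrite mem_enum; apply/mapP; exists ((s^-1)%g l); rewrite ?mem_enum //.
by rewrite permKV.
Qed.

(** On vectors of length at most 1 the form depends on the coefficients with a Lipschitz constant
    given by [j] and [n] alone. *)
Lemma jet_diff_open j (O : set (('I_j -> E) -> E)) (c : Par j) :
  symmultilinear_open j O -> O (jet_diff c) ->
  exists2 d, 0 < d & forall c' : Par j, tsym (coef c') -> `|c' - c| <= d -> O (jet_diff c').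
Proof.
move=> [_ Oo] /Oo[e e0 He]; pose K : R := n%:R * (j`!%:R * n%:R ^+ j).
have K0 : 0 <= K by rewrite !mulr_ge0 ?exprn_ge0.
have K1 : 0 < K + 1 by rewrite ltr_wpDl.
exists (e / (K + 1)); first by rewrite divr_gt0.
move=> c' sc' cc'; apply: He; first exact: jet_diff_symmultilinear.
move=> v v1; apply: le_trans (enorm_le_norm _) _.
have -> : jet_diff c' v - jet_diff c v =
    - (j`!%:R *: mlin (coef (c' - c)) [seq v i | i <- enum 'I_j]).
  rewrite /jet_diff -opprD -scalerBr -mlinB; congr (- (_ *: _)).
  by apply: eq_mlin => w _; rewrite coefB.
rewrite normrN normrZ normr_nat.
have := @norm_mlin R n (coef (c' - c)) [seq v i | i <- enum 'I_j] 1 `|c' - c|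
  (normr_ge0 _) ler01 (fun w _ => norm_coef _ w).
rewrite mulr1 size_map size_enum_ord => H.
apply: (@le_trans _ _ (K * `|c' - c|)).
  rewrite /K -!mulrA; apply: ler_wpM2l => //; apply: ler_wpM2l => //; apply: H.
  by move=> _ /mapP[i _ ->]; apply: le_trans (le_norm_enorm _) (v1 i).
apply: (@le_trans _ _ ((K + 1) * (e / (K + 1)))).
  by apply: ler_pM => //; rewrite lerDl.
by rewrite mulrC divfK // gt_eqF.
Qed.

End Jets.

Theorem theorem5p5 (R : realType) (n k : nat) (al : R) (A : set 'rV[R]_n)
    (hn : (1 <= n)%N) (hk : (1 <= k)%N) (hal : 0 <= al <= 1) :
  [/\ borel [set a | ap_diff A k al a],
      borel [set a | ap_diff A 1 0 a] /\
      borel_map [set: 'M[R]_n] (@open 'M[R]_n)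
        [set a | ap_diff A 1 0 a] (ap_tan_proj A)
    & forall j : nat, (2 <= j)%N ->
      borel [set a | ap_diff A j 0 a] /\
      borel_map (symmultilinear 'rV[R]_n 'rV[R]_n j)
        (symmultilinear_open j)
        [set a | ap_diff A j 0 a] (ap_D A j)].
Proof.
have X_borel l b : (1 <= l)%N -> 0 <= b -> borel [set a | ap_diff A l b a].
  move=> l1 b0; rewrite (_ : [set a | _] =
      [set a | exists m (c : 'rV[R]_#|{: {bseq l of 'I_n} * 'I_n}|), is_jet A b a m c /\ True]).
    by apply: borel_is_jet => // c _ _; exists 1.
  apply/seteqP; split=> a; first by move=> /(ap_diffP hn _ _ l1 b0)[m [c jc]]; exists m, c.
  by move=> [m [c [jc _]]]; apply/ap_diffP => //; exists m, c.
have /andP[al0 _] := hal.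
split; [exact: X_borel|split; first exact: X_borel|move=> j j2; split].
- split=> // O oO; rewrite (_ : _ `&` _ = [set a | exists m
      (c : 'rV[R]_#|{: {bseq 1 of 'I_n} * 'I_n}|), is_jet A 0 a m c /\ O (tan_mx c)]).
    apply: borel_is_jet => // c _ Oc.
    have /nbhs_ballP[e /= e0 He] := open_nbhs_nbhs (conj oO Oc).
    exists (e / 2); first by rewrite divr_gt0.
    move=> c' _ cc'; apply: He; rewrite -ball_normE /= distrC.
    apply: le_lt_trans (tan_mx_lip _ _) _; apply: le_lt_trans cc' _.
    by rewrite ltr_pdivrMr // ltr_pMr // ltr1n.
  apply/seteqP; split=> a /=.
    move=> [/ap_diffP-/(_ hn (leqnn 1) (lexx 0))[m [c jc]] Oa]; exists m, c; split=> //.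
    by have [<- _] := ap_tan_is_jet hn (leqnn 1) jc.
  move=> [m [c [jc Oc]]]; split; first by apply/ap_diffP => //; exists m, c.
  by have [E _] := ap_tan_is_jet hn (leqnn 1) jc; rewrite /ap_tan_proj -/(proj_mx _) E.
- by apply: X_borel => //; exact: ltnW.
have j1 := ltnW j2; split=> [a /= /(ap_diffP hn _ _ j1 (lexx 0))[m [c jc]]|O oO].
  have [_ _ gc _] := jc; rewrite (ap_D_is_jet hn j2 jc).
  exact: jet_diff_symmultilinear (graph_par_sym gc).
rewrite (_ : _ `&` _ = [set a | exists m
    (c : 'rV[R]_#|{: {bseq j of 'I_n} * 'I_n}|), is_jet A 0 a m c /\ O (jet_diff c)]).
  by apply: borel_is_jet => // c _ Oc; exact: jet_diff_open.
apply/seteqP; split=> a /=.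
  move=> [/(ap_diffP hn _ _ j1 (lexx 0))[m [c jc]] Oa]; exists m, c; split=> //.
  by rewrite -(ap_D_is_jet hn j2 jc).
move=> [m [c [jc Oc]]]; split; first by apply/ap_diffP => //; exists m, c.
by rewrite (ap_D_is_jet hn j2 jc).
Qed.
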